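(* Let $\mathcal H$ and $\mathcal K$ be complex separable Hilbert spaces. Let $T\in\mathcal L(\mathcal H)$ be power bounded, i.e. $M:=\sup_{n\geq 0}\|T^n\|<\infty$, and suppose $T=V+(\cdot,v)u$ for some unitary operator $V\in\mathcal L(\mathcal H)$ and some vectors $u,v\in\mathcal H$. Let $U\in\mathcal L(\mathcal K)$ be a singular unitary operator and suppose $T\prec U$. Then $T$ is invertible and $$\sup_{n\geq 0}\|T^{-n}\|\leq\bigl(2M^2+1\bigr)\cdot M^5 .$$ Consequently, $T$ is similar to $U$.
   Context: $(\cdot,v)u$ denotes the rank-at-most-one operator $x\mapsto (x,v)u$. A unitary operator is singular if its spectral measure is singular with respect to Lebesgue measure on the unit circle $\mathbb T$. $T\prec U$ ($T$ is a quasiaffine transform of $U$) means there exists $X\in\mathcal L(\mathcal H,\mathcal K)$ with $\ker X=\{0\}$, $X\mathcal H$ dense in $\mathcal K$, and $XT=UX$. $T$ similar to $U$ means $XT=UX$ for some invertible (bounded, with bounded inverse) $X\in\mathcal L(\mathcal H,\mathcal K)$. *)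

(* Defs.v *)
From HB Require Import structures.
From mathcomp Require Import all_boot all_order all_algebra.
From mathcomp Require Import all_classical all_reals all_analysis.
From mathcomp.real_closed Require Import complex.
Set Implicit Arguments. Unset Strict Implicit. Unset Printing Implicit Defensive.
Import Order.TTheory GRing.Theory Num.Theory.
Local Open Scope classical_set_scope.
Local Open Scope ring_scope.

Section Hilbert.
Variable R : realType.
Local Notation C := (R[i]).

Section IP.
Variable H : lmodType C.
Variable ip : H -> H -> C.

Definition hnorm (x : H) : R := Num.sqrt (complex.Re (ip x x)).

Definition is_inner_product : Prop :=
  [/\ (forall (a : C) (x y z : H), ip (a *: x + y) z = a * ip x z + ip y z),
      (forall x y : H, ip y x = conjc (ip x y)),
      (forall x : H, 0 <= ip x x) &
      (forall x : H, ip x x = 0 -> x = 0)].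

Definition hcomplete : Prop :=
  forall s : nat -> H,
    (forall e : R, 0 < e -> exists N : nat, forall m n : nat,
        (N <= m)%N -> (N <= n)%N -> hnorm (s m - s n) < e) ->
    exists l : H, forall e : R, 0 < e -> exists N : nat, forall n : nat,
        (N <= n)%N -> hnorm (s n - l) < e.

Definition hseparable : Prop :=
  exists d : nat -> H, forall (x : H) (e : R), 0 < e ->
    exists n : nat, hnorm (x - d n) < e.

Definition is_sep_hilbert : Prop :=
  [/\ is_inner_product, hcomplete & hseparable].
End IP.

Section Ops.
Variables (H K : lmodType C) (ipH : H -> H -> C) (ipK : K -> K -> C).

Definition is_linear_map (A : H -> K) : Prop :=
  forall (a : C) (x y : H), A (a *: x + y) = a *: A x + A y.

Definition bounded_op (A : H -> K) : Prop :=
  is_linear_map A /\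
  exists c : R, forall x : H, hnorm ipK (A x) <= c * hnorm ipH x.

Definition opnorm (A : H -> K) : R :=
  sup [set hnorm ipK (A x) | x in [set x : H | hnorm ipH x <= 1]].

End Ops.

Definition is_bounded_inverse (H K : lmodType C) (ipH : H -> H -> C)
    (ipK : K -> K -> C) (A : H -> K) (B : K -> H) : Prop :=
  [/\ bounded_op ipH ipK A, bounded_op ipK ipH B, cancel A B & cancel B A].

Definition quasiaffinity (H K : lmodType C) (ipH : H -> H -> C)
    (ipK : K -> K -> C) (X : H -> K) : Prop :=
  [/\ bounded_op ipH ipK X, injective X &
      forall (y : K) (e : R), 0 < e -> exists x : H, hnorm ipK (y - X x) < e].

(* the unit circle T parametrised by [0, 2 pi) via t |-> e^{it} *)
Definition circ_param : set R := `[0%R, pi *+ 2[%classic.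

Section Unitary.
Variables (H : lmodType C) (ipH : H -> H -> C).

Definition unitary (V : H -> H) : Prop :=
  bounded_op ipH ipH V /\
  exists W : H -> H, [/\ bounded_op ipH ipH W,
     (forall x y : H, ipH (V x) y = ipH x (W y)),
     cancel V W & cancel W V].

(* V is singular: for every x, the scalar spectral measure mu_x of V
   (the positive Borel measure on the circle, parametrised by [0, 2pi),
   whose Fourier coefficients are (V^n x, x)) is singular with respect to
   Lebesgue measure. *)
Definition singular_unitary (V : H -> H) : Prop :=
  unitary V /\
  forall x : H, exists mu : {measure set (measurableTypeR R) -> \bar R},
   [/\ mu (~` circ_param) = 0%E,
       (forall n : nat,
         (\int[mu]_(t in circ_param) (cos (n%:R * t))%:E)%E
           = (complex.Re (ipH (iter n V x) x))%:E /\
         (\int[mu]_(t in circ_param) (sin (n%:R * t))%:E)%E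
           = (complex.Im (ipH (iter n V x) x))%:E) &
       exists N : set R, [/\ measurable N, N `<=` circ_param,
          (lebesgue_measure N = 0)%E & mu (circ_param `\` N) = 0%E]].
End Unitary.

End Hilbert.

(* Main.v *)
(** For [T = V + (., v) u] put [d(l) = 1 - ((l - V)^-1 u, v)].  Then [(l - T) (l - V)^-1 u = d(l) u], so
    applying [X] and pairing with [y] such that [X* y] is close to [v] gives [d(l) (1 + c(l))] close to 1,
    where [c(l) = ((l - U)^-1 X u, y)].  As [U] is singular, there are polynomials [Q], bounded by 1 on
    the disc, with [Q(l0)] close to 1 and [Q(U) X u] close to 0, and then [Q (1 + c)] is almost a
    polynomial [S].  The function [conj d(1 / conj l) S(l)] is analytic in the disc, of modulus at most
    about 1 on the circle and close to [conj d(1 / conj l0) / d(l0)] at [l0]: by the maximum principle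
    [|d(1 / conj l)| <= |d(l)|] for [0 < |l| < 1].

    The transform [(l - T) (l' - T)^-1], with [l' = 1 / conj l], is a multiple of an isometry (coming
    from [V]) times a rank one perturbation of the identity, whose determinant is [d(l) / d(l')].  The
    resolvent of the power bounded [T] outside the disc bounds this perturbation, and since its
    determinant is at least 1 in modulus, the same constant bounds its inverse.  Hence
    [|(l - T)^-1 x|] is controlled by [|(l' - T)^-1 x|].  Averaging the squares over the N-th roots of
    unity turns both sides into sums over the orbit of [x] (Parseval), and letting the radius tend to 1
    gives [|x| <= M^2 (2 M + 1) |T^n x|].  The similarity follows: a Banach limit of [(T^n x, T^n y)] is
    an equivalent inner product making [T] unitary, and the unitary part in the polar decomposition of
    [X] intertwines [T] and [U]. *)

Require Import Defs.
From HB Require Import structures.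
From mathcomp Require Import all_boot all_order all_algebra.
From mathcomp Require Import all_classical all_reals all_analysis.
From mathcomp.real_closed Require Import complex.
From mathcomp Require Import ring lra measurable_realfun.
Import Order.TTheory GRing.Theory Num.Theory.
Import Normc numFieldNormedType.Exports.
Local Open Scope classical_set_scope.
Local Open Scope ring_scope.
Local Open Scope complex_scope.
Local Notation Re := complex.Re.
Local Notation Im := complex.Im.

(** * Inner product spaces *)

Section ComplexModulus.
Context {R : realType}.
Implicit Types (z w : R[i]) (x : R).

(** The obstacle in the maximum principle is growth: [d] and [c] come from resolvents and need not
    be bounded near the circle. They are multiplied by bounded analytic functions, the normalizers,
    built from contractions that differ from the unitary operators by rank one; the products have
    mean squares over circles bounded uniformly in the radius. Moduli are thus controlled on
    average, and the maximum principle is used as a Poisson mean inequality. The normalizers tend to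
    1 with parameters [a] and [b], but the mean square bounds grow like 1 / sqrt a and 1 / sqrt b.
    Hence the order of the limits: the error of [Q], then [b], then the distance from [X' y] to [v],
    then [a]. Apart from the spectral measure, no integral occurs: means are taken over N-th roots
    of unity, and analytic functions are uniform limits of polynomials. In M^2 (2 M + 1), the factor
    2 M + 1 is the limit of the reflection constant as the radius tends to 1; one M bounds the outer
    sums by |T^n x|, the other bounds |x| by the inner sums. *)

Lemma normc_ge0 z : 0 <= normc z.
Proof. by case: z => a b; apply: sqrtr_ge0. Qed.

Lemma normc_sqr z : normc z ^+ 2 = Re z ^+ 2 + Im z ^+ 2.
Proof. by case: z => a b /=; rewrite sqr_sqrtr // addr_ge0 ?sqr_ge0. Qed.

Lemma normcJ z : normc (conjc z) = normc z.
Proof. by case: z => a b /=; rewrite sqrrN. Qed.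

Lemma normc_mulJ z : z * conjc z = (normc z ^+ 2)%:C.
Proof.
rewrite normc_sqr; case: z => a b /=.
by apply/eqP; rewrite eq_complex /=; apply/andP; split; apply/eqP; ring.
Qed.

Lemma normcR x : normc x%:C = `|x|.
Proof. by rewrite /= expr0n /= addr0 sqrtr_sqr. Qed.

Lemma conjcM z w : conjc (z * w) = conjc z * conjc w. Proof. exact: rmorphM. Qed.
Lemma conjcD z w : conjc (z + w) = conjc z + conjc w. Proof. exact: rmorphD. Qed.
Lemma conjcN z : conjc (- z) = - conjc z. Proof. exact: rmorphN. Qed.
Lemma conjcB z w : conjc (z - w) = conjc z - conjc w. Proof. exact: rmorphB. Qed.
Lemma conjcV z : conjc (z^-1) = (conjc z)^-1. Proof. exact: fmorphV. Qed.
Lemma conjcX z n : conjc (z ^+ n) = conjc z ^+ n. Proof. exact: rmorphXn. Qed.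

Lemma conjc_sum (I : Type) (r : seq I) (P : pred I) (F : I -> R[i]) :
  conjc (\sum_(i <- r | P i) F i) = \sum_(i <- r | P i) conjc (F i).
Proof. by elim/big_rec2: _ => [|i y z _ <-]; rewrite ?conjc0 ?conjcD. Qed.

Lemma real_complex_sum (I : Type) (r : seq I) (P : pred I) (F : I -> R) :
  (\sum_(i <- r | P i) F i)%:C = \sum_(i <- r | P i) (F i)%:C.
Proof. by elim/big_rec2: _ => [//|i y z _ <-]; rewrite rmorphD. Qed.

Lemma real_complex_eq0 x : (x%:C == 0) = (x == 0).
Proof. by rewrite eq_complex /= eqxx andbT. Qed.

Lemma normc_nat n : normc (n%:R : R[i]) = n%:R.
Proof. by rewrite -(rmorph_nat (real_complex R)) normcR ger0_norm. Qed.

Lemma normc_eq0 z : normc z = 0 -> z = 0.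
Proof. exact: eq0_normc. Qed.

Lemma normc_gt0 z : z != 0 -> 0 < normc z.
Proof.
by move=> z0; rewrite lt_neqAle normc_ge0 andbT; apply: contra z0 => /eqP/esym/normc_eq0 ->.
Qed.

Lemma normc1_neq0 z : normc z = 1 -> z != 0.
Proof. by move=> z1; apply: contraTneq isT => h; move: z1; rewrite h normc0 => /eqP; rewrite eq_sym oner_eq0. Qed.

Lemma normcD z w : normc (z + w) <= normc z + normc w.
Proof. exact: le_normcD. Qed.

Lemma normcB z w : normc (z - w) <= normc z + normc w.
Proof. by rewrite -[normc w]normcN; apply: normcD. Qed.

Lemma normc_subC z w : normc (z - w) = normc (w - z).
Proof. by rewrite -normcN opprB. Qed.

Lemma normc_subr_ge z w : normc z - normc w <= normc (z - w).
Proof. by rewrite lerBlDr; have := normcD (z - w) w; rewrite subrK. Qed.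

Lemma normcX z n : normc (z ^+ n) = normc z ^+ n.
Proof. by elim: n => [|n IH]; rewrite ?expr0 ?normc1 // !exprS normcM IH. Qed.

Lemma normc_sum (I : Type) (r : seq I) (P : pred I) (F : I -> R[i]) :
  normc (\sum_(i <- r | P i) F i) <= \sum_(i <- r | P i) normc (F i).
Proof.
elim/big_rec2: _ => [|i y z _ H]; first by rewrite normc0.
by apply: le_trans (normcD _ _) _; rewrite lerD2l.
Qed.

Lemma Re_le_normc z : Re z <= normc z.
Proof.
case: z => a b /=; apply: le_trans (ler_norm a) _.
by rewrite -sqrtr_sqr ler_wsqrtr // lerDl sqr_ge0.
Qed.

Lemma ReD z w : Re (z + w) = Re z + Re w.
Proof. by case: z; case: w. Qed.

Lemma ReN z : Re (- z) = - Re z.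
Proof. by case: z. Qed.

Lemma ReZ x z : Re (x%:C * z) = x * Re z.
Proof. by case: z => a b /=; rewrite mul0r subr0. Qed.

Lemma Re_sum (I : Type) (r : seq I) (P : pred I) (F : I -> R[i]) :
  Re (\sum_(i <- r | P i) F i) = \sum_(i <- r | P i) Re (F i).
Proof. by elim/big_rec2: _ => [//|i y z _ <-]; rewrite ReD. Qed.

Lemma ReJ z : Re (conjc z) = Re z.
Proof. by case: z. Qed.

End ComplexModulus.

Section InnerProduct.
Context {R : realType} {H : lmodType R[i]} {ip : H -> H -> R[i]}.
Hypothesis hip : is_inner_product ip.
Implicit Types (x y z : H) (a b : R[i]).
Local Notation nrm := (hnorm ip).

Lemma ipC x y : ip y x = conjc (ip x y).
Proof. by case: hip. Qed.

Lemma ip_lin a x y z : ip (a *: x + y) z = a * ip x z + ip y z.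
Proof. by case: hip. Qed.

Lemma ip0l z : ip 0 z = 0.
Proof.
have := ip_lin 1 0 0 z; rewrite scale1r addr0 mul1r => /eqP.
by rewrite eq_sym -subr_eq0 addrK => /eqP.
Qed.

Lemma ipDl x y z : ip (x + y) z = ip x z + ip y z.
Proof. by have := ip_lin 1 x y z; rewrite scale1r mul1r. Qed.

Lemma ipZl a x z : ip (a *: x) z = a * ip x z.
Proof. by have := ip_lin a x 0 z; rewrite !addr0 ip0l addr0. Qed.

Lemma ipNl x z : ip (- x) z = - ip x z.
Proof. by rewrite -scaleN1r ipZl mulN1r. Qed.

Lemma ipBl x y z : ip (x - y) z = ip x z - ip y z.
Proof. by rewrite ipDl ipNl. Qed.

Lemma ip_suml (I : Type) (r : seq I) (P : pred I) (F : I -> H) z :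
  ip (\sum_(i <- r | P i) F i) z = \sum_(i <- r | P i) ip (F i) z.
Proof. by elim/big_rec2: _ => [|i u v _ <-]; rewrite ?ip0l ?ipDl. Qed.

Lemma ip0r z : ip z 0 = 0.
Proof. by rewrite ipC ip0l conjc0. Qed.

Lemma ipDr x y z : ip z (x + y) = ip z x + ip z y.
Proof. by rewrite ipC ipDl rmorphD /= -!ipC. Qed.

Lemma ipZr a x z : ip z (a *: x) = conjc a * ip z x.
Proof. by rewrite ipC ipZl rmorphM /= -ipC. Qed.

Lemma ipNr x z : ip z (- x) = - ip z x.
Proof. by rewrite ipC ipNl rmorphN /= -ipC. Qed.

Lemma ipBr x y z : ip z (x - y) = ip z x - ip z y.
Proof. by rewrite ipDr ipNr. Qed.

Lemma ip_sumr (I : Type) (r : seq I) (P : pred I) (F : I -> H) z :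
  ip z (\sum_(i <- r | P i) F i) = \sum_(i <- r | P i) ip z (F i).
Proof. by elim/big_rec2: _ => [|i u v _ <-]; rewrite ?ip0r ?ipDr. Qed.

Lemma hnorm_ge0 x : 0 <= nrm x.
Proof. exact: sqrtr_ge0. Qed.

Lemma ip_self x : ip x x = (nrm x ^+ 2)%:C.
Proof.
have h : 0 <= ip x x by case: hip.
move: h; rewrite lecE /= => /andP[/eqP h1 h2].
by rewrite /hnorm sqr_sqrtr //; case: (ip x x) h1 h2 => a b /= -> _.
Qed.

Lemma hnorm_sqr x : nrm x ^+ 2 = Re (ip x x).
Proof. by rewrite ip_self. Qed.

Lemma hnorm_eq0 x : nrm x = 0 -> x = 0.
Proof. by move=> h; case: hip => _ _ _; apply; rewrite ip_self h expr0n. Qed.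

Lemma hnorm0 : nrm 0 = 0.
Proof. by rewrite /hnorm ip0l sqrtr0. Qed.

Lemma hnorm_gt0 x : x != 0 -> 0 < nrm x.
Proof.
move=> x0; rewrite lt_neqAle hnorm_ge0 andbT.
by apply: contra x0 => /eqP/esym/hnorm_eq0 ->.
Qed.

Lemma hnorm_le0 x : nrm x <= 0 -> x = 0.
Proof. by move=> h; apply: hnorm_eq0; apply/le_anti; rewrite h hnorm_ge0. Qed.

Lemma hnormZ a x : nrm (a *: x) = normc a * nrm x.
Proof.
apply/eqP; rewrite -(@eqrXn2 _ 2) // ?mulr_ge0 ?normc_ge0 ?hnorm_ge0 //.
apply/eqP/complexI; rewrite -ip_self ipZl ipZr mulrA normc_mulJ ip_self.
by rewrite -rmorphM exprMn.
Qed.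

Lemma hnormN x : nrm (- x) = nrm x.
Proof. by rewrite -scaleN1r hnormZ normcN normc1 mul1r. Qed.

Lemma hnorm_subC x y : nrm (x - y) = nrm (y - x).
Proof. by rewrite -hnormN opprB. Qed.

Lemma hnormD_sqr x y :
  nrm (x + y) ^+ 2 = nrm x ^+ 2 + Re (ip x y) *+ 2 + nrm y ^+ 2.
Proof.
rewrite !hnorm_sqr !ipDl !ipDr !ReD (ipC x y) ReJ mulr2n; ring.
Qed.

Lemma hnormB_sqr x y :
  nrm (x - y) ^+ 2 = nrm x ^+ 2 - Re (ip x y) *+ 2 + nrm y ^+ 2.
Proof. by rewrite hnormD_sqr hnormN ipNr ReN mulNrn. Qed.

Lemma parallelogram x y :
  nrm (x + y) ^+ 2 + nrm (x - y) ^+ 2 = (nrm x ^+ 2 + nrm y ^+ 2) *+ 2.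
Proof. by rewrite hnormD_sqr hnormB_sqr; ring. Qed.

Lemma cauchy_schwarz x y : normc (ip x y) <= nrm x * nrm y.
Proof.
have [->|y0] := eqVneq y 0; first by rewrite ip0r normc0 hnorm0 mulr0.
have ny := hnorm_gt0 _ y0.
pose c := (nrm y ^+ 2)^-1; pose t := c%:C * ip x y.
have h : 0 <= nrm (x - t *: y) ^+ 2 by apply: sqr_ge0.
have e : nrm (x - t *: y) ^+ 2 = nrm x ^+ 2 - normc (ip x y) ^+ 2 / nrm y ^+ 2.
  have ny2 : nrm y ^+ 2 != 0 by rewrite expf_neq0 // gt_eqF.
  rewrite hnormB_sqr hnormZ ipZr exprMn.
  have -> : Re (conjc t * ip x y) = normc (ip x y) ^+ 2 / nrm y ^+ 2.
    have -> : conjc t * ip x y = c%:C * (ip x y * conjc (ip x y)).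
      by rewrite /t [X in X * _]rmorphM [X in X * _ * _]conjc_real; ring.
    by rewrite normc_mulJ ReZ /= mulrC.
  rewrite normcM normcR ger0_norm ?invr_ge0 ?sqr_ge0 // exprMn /c.
  by field; rewrite gt_eqF.
rewrite e subr_ge0 ler_pdivrMr ?exprn_gt0 // -exprMn in h.
by rewrite -(@ler_pXn2r _ 2) // nnegrE ?mulr_ge0 ?normc_ge0 ?hnorm_ge0.
Qed.

Lemma hnormD x y : nrm (x + y) <= nrm x + nrm y.
Proof.
rewrite -(@ler_pXn2r _ 2) // ?nnegrE ?addr_ge0 ?hnorm_ge0 // hnormD_sqr sqrrD.
rewrite lerD2r lerD2l lerMn2r /=.
exact: le_trans (Re_le_normc _) (cauchy_schwarz _ _).
Qed.

Lemma hnormB x y : nrm (x - y) <= nrm x + nrm y.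
Proof. by rewrite -[nrm y]hnormN; apply: hnormD. Qed.

Lemma hnorm_subr_ge x y : nrm x - nrm y <= nrm (x - y).
Proof. by rewrite lerBlDr; have := hnormD (x - y) y; rewrite subrK. Qed.

Lemma hnorm_dist x y z : nrm (x - z) <= nrm (x - y) + nrm (y - z).
Proof. by have := hnormD (x - y) (y - z); rewrite addrA subrK. Qed.

Lemma ip_ext x y : (forall z, ip x z = ip y z) -> x = y.
Proof.
move=> h; apply/eqP; rewrite -subr_eq0; apply/eqP/hnorm_eq0/eqP.
by rewrite -sqrf_eq0 hnorm_sqr ipBl h subrr.
Qed.

End InnerProduct.

Section LinearMaps.
Context {R : realType} {H K L : lmodType R[i]}.
Implicit Types (A : H -> K) (B : K -> L).

Lemma lin0 A : is_linear_map A -> A 0 = 0.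
Proof.
move=> h; have := h 1 0 0; rewrite !scale1r addr0 => /eqP.
by rewrite -subr_eq0 opprD addNKr oppr_eq0 => /eqP.
Qed.

Lemma linD A x y : is_linear_map A -> A (x + y) = A x + A y.
Proof. by move=> h; have := h 1 x y; rewrite !scale1r. Qed.

Lemma linZ A a x : is_linear_map A -> A (a *: x) = a *: A x.
Proof. by move=> h; have := h a x 0; rewrite !addr0 lin0 ?addr0. Qed.

Lemma linN A x : is_linear_map A -> A (- x) = - A x.
Proof. by move=> h; rewrite -scaleN1r linZ // scaleN1r. Qed.

Lemma linB A x y : is_linear_map A -> A (x - y) = A x - A y.
Proof. by move=> h; rewrite linD // linN. Qed.

Lemma lin_sum A (I : Type) (r : seq I) (P : pred I) (F : I -> H) :
  is_linear_map A -> A (\sum_(i <- r | P i) F i) = \sum_(i <- r | P i) A (F i).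
Proof. by move=> h; elim/big_rec2: _ => [|i u v _ <-]; rewrite ?lin0 ?linD. Qed.

End LinearMaps.

Lemma lin_iter {R : realType} {H : lmodType R[i]} (A : H -> H) n :
  is_linear_map A -> is_linear_map (iter n A).
Proof. by move=> hA; elim: n => [//|n IH] a x y /=; rewrite IH hA. Qed.

(** Vector identities are paired with an arbitrary vector, which leaves scalar identities for [ring]
    and [field]. *)
Ltac hmod hip tac :=
  apply: (ip_ext hip) => ?;
  rewrite ?(ipDl hip, ipNl hip, ipZl hip, ip0l hip); tac.
Ltac hring hip := hmod hip ltac:(ring).
Ltac hfield hip := hmod hip ltac:(field).

Section RealLimits.
Context {R : realType}.
Implicit Types (e c r : R).

Lemma invS_lt e : 0 < e -> exists N : nat, forall n, (N <= n)%N -> n.+1%:R^-1 < e.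
Proof.
move=> e0; exists (Num.bound e^-1) => n Nn.
have e1 : 0 <= e^-1 by rewrite invr_ge0 ltW.
rewrite invf_plt ?posrE ?ltr0n //; apply: lt_le_trans (archi_boundP e1) _.
by rewrite ler_nat; apply: leq_trans Nn _.
Qed.

Lemma geometric_lt c r e : 0 <= r < 1 -> 0 < e ->
  exists N : nat, forall n, (N <= n)%N -> c * r ^+ n < e.
Proof.
move=> /andP[r0 r1] e0.
have h : `|r| < 1 by rewrite ger0_norm.
have /cvgrPdist_lt := cvg_expr h => /(_ (e / (`|c| + 1))).
have c1 : 0 < `|c| + 1 by rewrite ltr_wpDl.
rewrite divr_gt0 // => /(_ isT) [N _ HN].
exists N => n Nn; have := HN n Nn; rewrite /= sub0r normrN ger0_norm ?exprn_ge0 //.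
rewrite ltr_pdivlMr // => {}HN; apply: le_lt_trans HN.
rewrite mulrC ler_wpM2l ?exprn_ge0 //; apply: le_trans (ler_norm c) _.
by rewrite lerDl.
Qed.

Lemma ler_of_forall_addgt x y : (forall e, 0 < e -> x <= y + e) -> x <= y :> R.
Proof. by move=> h; apply/ler_addgt0Pr => e /h. Qed.

Lemma ler_of_forall_mulgt x y c : (forall e, 0 < e -> x <= y + c * e) -> x <= y :> R.
Proof.
move=> h; apply: ler_of_forall_addgt => e e0.
have c1 : 0 < `|c| + 1 by rewrite ltr_wpDl.
apply: (le_trans (h (e / (`|c| + 1)) (divr_gt0 e0 c1))); rewrite lerD2l.
rewrite mulrA ler_pdivrMr // mulrC ler_wpM2l ?(ltW e0) //.
by apply: le_trans (ler_norm c) _; rewrite lerDl.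
Qed.

End RealLimits.

(** * Projection, Riesz representation and resolvents *)

Section Hilbert.
Context {R : realType} {H : lmodType R[i]} {ip : H -> H -> R[i]}.
Hypothesis hip : is_inner_product ip.
Local Notation nrm := (hnorm ip).

Definition hcvg (s : nat -> H) (l : H) := forall e : R, 0 < e ->
  exists N : nat, forall n, (N <= n)%N -> nrm (s n - l) < e.

Definition contraction (A : H -> H) :=
  is_linear_map A /\ forall x, nrm (A x) <= nrm x.

Section Complete.
Hypothesis hc : hcomplete ip.

(** A minimising sequence for the distance from [v] to [D] is Cauchy by the parallelogram identity.
    Its limit [p] lies in the closure of [D], which is why it is described by approximation. *)
Lemma projection (D : set H) (v : H) : D 0 ->
  (forall a x y, D x -> D y -> D (a *: x + y)) ->
  exists p, (forall e : R, 0 < e -> exists2 d, D d & nrm (p - d) < e) /\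
    forall d, D d -> ip (v - p) d = 0.
Proof.
move=> D0 Dlin.
pose S : set R := [set nrm (v - d) | d in D].
have Slb : lbound S 0 by move=> _ [d _ <-]; apply: hnorm_ge0.
have Sinf : has_inf S by split; [exists (nrm (v - 0)), 0 | exists 0].
pose m := inf S.
have m0 : 0 <= m by apply: lb_le_inf => //; case: Sinf.
have mle d : D d -> m <= nrm (v - d) by move=> Dd; apply: ge_inf; [exists 0|exists d].
have /choice[s sP] : forall n : nat, exists d, D d /\ nrm (v - d) < m + n.+1%:R^-1.
  move=> n; have n0 : 0 < n.+1%:R^-1 :> R by rewrite invr_gt0 ltr0n.
  by have [_ [d Dd <-] hd] := inf_adherent n0 Sinf; exists d.
have cau i j : nrm (s i - s j) ^+ 2 <= (m *+ 4 + 2) * (i.+1%:R^-1 + j.+1%:R^-1).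
  have Dmid : m <= nrm (v - 2^-1 *: (s i + s j)).
    apply: mle; have := Dlin 2^-1 (s i + s j) 0; rewrite addr0; apply=> //.
    by have := Dlin 1 (s i) (s j); rewrite scale1r; apply; [have [] := sP i|have [] := sP j].
  have := parallelogram hip (v - s i) (v - s j).
  have -> : v - s i - (v - s j) = - (s i - s j) by hring hip.
  have -> : v - s i + (v - s j) = (2 : R[i]) *: (v - 2^-1 *: (s i + s j)) by hfield hip.
  rewrite (hnormN hip) (hnormZ hip) normc_nat.
  have [_ hi] := sP i; have [_ hj] := sP j.
  have pos k : 0 < (k.+1%:R^-1 : R) <= 1.
    by rewrite invr_gt0 ltr0n /= invf_le1 ?ltr0n // ler1n.
  have /andP[i0 i1] := pos i; have /andP[j0 j1] := pos j.
  have ni := hnorm_ge0 (ip := ip) (v - s i); have nj := hnorm_ge0 (ip := ip) (v - s j).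
  move: (nrm (v - s i)) (nrm (v - s j)) (nrm (v - _ *: _)) (nrm (s i - s j)) (i.+1%:R^-1) (j.+1%:R^-1)
    Dmid hi hj i0 i1 j0 j1 ni nj => a b c d e f; nra.
have scau : forall e : R, 0 < e -> exists N : nat, forall i j : nat,
    (N <= i)%N -> (N <= j)%N -> nrm (s i - s j) < e.
  move=> e e0; pose c := (m *+ 4 + 2) *+ 2.
  have c0 : 0 < c by rewrite /c; lra.
  have [|N HN] := @invS_lt R (e ^+ 2 / c); first by rewrite divr_gt0 ?exprn_gt0.
  exists N => i j Ni Nj; rewrite -(@ltr_pXn2r _ 2) ?nnegrE ?hnorm_ge0 ?(ltW e0) //.
  apply: le_lt_trans (cau i j) _.
  have := HN i Ni; have := HN j Nj; rewrite !ltr_pdivlMr // /c.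
  by move: (i.+1%:R^-1) (j.+1%:R^-1) => x y; nra.
have [p hp] := hc _ scau.
exists p; split.
  move=> e e0; have [N HN] := hp e e0; have [DN _] := sP N; exists (s N) => //.
  by rewrite (hnorm_subC hip) HN.
have pm : nrm (v - p) <= m.
  apply: (ler_of_forall_mulgt _ _ 2) => e e0.
  have [N1 H1] := hp e e0; have [N2 H2] := invS_lt _ e0.
  have [_ h] := sP (maxn N1 N2).
  have := H1 _ (leq_maxl N1 N2); have := H2 _ (leq_maxr N1 N2).
  have := hnorm_dist hip v (s (maxn N1 N2)) p.
  by move: h; move: (_.+1%:R^-1) => x; lra.
have pD d : D d -> m <= nrm (v - p - d).
  move=> Dd; apply: ler_of_forall_addgt => e e0.
  have [N HN] := hp e e0; have h := HN N (leqnn N).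
  have DN : D (d + s N) by have := Dlin 1 d (s N); rewrite scale1r; apply=> //; have [] := sP N.
  apply: le_trans (mle _ DN) _.
  have -> : v - (d + s N) = (v - p - d) - (s N - p) by hring hip.
  by apply: le_trans (hnormB hip _ _) _; rewrite lerD2l ltW.
move=> d Dd; pose w := ip (v - p) d.
(* Minimality is tested at [p] moved by [t w d]. The summand 1 covers [d = 0] and gives t |d|^2 = 1
   - t, so the squared distance would drop by t |w|^2 (1 + t). *)
pose t := (nrm d ^+ 2 + 1)^-1.
have d1 : 0 < nrm d ^+ 2 + 1 by rewrite ltr_wpDl ?sqr_ge0.
have h1 : m <= nrm (v - p - (t%:C * w) *: d).
  by apply: pD; have := Dlin (t%:C * w) d 0 Dd D0; rewrite addr0.
have h2 : nrm (v - p) ^+ 2 <= nrm (v - p - (t%:C * w) *: d) ^+ 2.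
  by rewrite ler_pXn2r ?nnegrE ?hnorm_ge0 //; apply: le_trans pm h1.
move: h2; rewrite [X in _ <= X](hnormB_sqr hip) (ipZr hip) (hnormZ hip) -/w.
rewrite rmorphM [X in X * _ * _]conjc_real -mulrA (mulrC (conjc w)) normc_mulJ ReZ /=.
rewrite normcM normcR ger0_norm; last by rewrite invr_ge0 ltW.
have dt : t * (nrm d ^+ 2 + 1) = 1 by rewrite /t mulVf ?gt_eqF.
have t0 : 0 < t by rewrite invr_gt0.
rewrite !exprMn.
have -> : t ^+ 2 * normc w ^+ 2 * nrm d ^+ 2 = t * normc w ^+ 2 * (1 - t).
  have -> : nrm d ^+ 2 = (1 - t) / t by rewrite -dt; field; rewrite gt_eqF.
  by field; rewrite gt_eqF.
move=> h3; apply: normc_eq0; apply/eqP; rewrite -sqrf_eq0.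
by have := sqr_ge0 (normc w); move: h3; set W := normc w ^+ 2; nra.
Qed.

Lemma riesz (f : H -> R[i]) (c : R) :
  (forall a x y, f (a *: x + y) = a * f x + f y) ->
  (forall x, normc (f x) <= c * nrm x) ->
  exists z, forall x, f x = ip x z.
Proof.
move=> flin fb.
have f0 : f 0 = 0.
  by have := flin 1 0 0; rewrite scale1r addr0 mul1r => /eqP; rewrite -subr_eq subrr => /eqP.
have fZ a x : f (a *: x) = a * f x by have := flin a x 0; rewrite !addr0 f0 addr0.
have fD x y : f (x + y) = f x + f y by have := flin 1 x y; rewrite scale1r mul1r.
have [/asboolP all0|] := boolP `[<forall x, f x = 0>].
  by exists 0 => x; rewrite all0 (ip0r hip).
move=> /asboolPn/existsNP[v /eqP fv].
have [||p [hp orth]] := @projection [set x | f x = 0] v; first exact: f0.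
  by move=> a x y /= hx hy; rewrite flin hx hy mulr0 addr0.
have fp : f p = 0.
  apply: normc_eq0; apply/le_anti; rewrite normc_ge0 andbT.
  apply: (ler_of_forall_mulgt _ _ `|c|) => e /hp[d /= fd pd]; rewrite add0r.
  have -> : f p = f (p - d) by rewrite fD -scaleN1r fZ fd mulr0 addr0.
  apply: le_trans (fb _) _; apply: le_trans (ler_wpM2r (hnorm_ge0 _) (ler_norm c)) _.
  by rewrite ler_wpM2l // ltW.
pose e := v - p.
have fe : f e = f v by rewrite /e fD -scaleN1r fZ fp mulr0 addr0.
have ne : 0 < nrm e.
  by apply: (hnorm_gt0 hip); apply: contraNneq fv => e0; rewrite -fe e0 f0.
exists (((conjc (f v)) / (nrm e ^+ 2)%:C) *: e) => x.
have key : ip (x - (f x / f v) *: e) e = 0.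
  rewrite (ipC hip) orth ?conjc0 //= fD -scaleN1r !fZ fe mulrA.
  by rewrite mulN1r mulNr divfK // subrr.
move: key; rewrite (ipBl hip) (ipZl hip) (ip_self hip) (ipZr hip) => /eqP.
rewrite subr_eq0 => /eqP ->.
rewrite conjcM conjcV conjcK conjc_real; field.
by rewrite fv eq_complex /= eqxx andbT gt_eqF.
Qed.

End Complete.

Lemma hcvg_unique s l l' : hcvg s l -> hcvg s l' -> l = l'.
Proof.
move=> h h'; apply/eqP; rewrite -subr_eq0; apply/eqP/(hnorm_le0 hip).
apply: (ler_of_forall_mulgt _ _ 2) => e e0.
have [N1 H1] := h e e0; have [N2 H2] := h' e e0.
have := H1 _ (leq_maxl N1 N2); have := H2 _ (leq_maxr N1 N2).
have := hnorm_dist hip l (s (maxn N1 N2)) l'; rewrite (hnorm_subC hip l (s _)); lra.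
Qed.

(** Iterating [y |-> l^-1 (x + A y)] with this lemma solves the resolvent equation for a contraction
    [A] and |l| > 1 without summing a Neumann series. *)
Lemma banach_fixpoint (hc : hcomplete ip) (F : H -> H) (c : R) : 0 <= c < 1 ->
  (forall x y, nrm (F x - F y) <= c * nrm (x - y)) -> exists x, F x = x.
Proof.
move=> c01 hF; have /andP[c0 c1] := c01.
pose s n := iter n F 0; pose B := nrm (F 0) / (1 - c).
have B0 : 0 <= B by rewrite divr_ge0 ?hnorm_ge0 // subr_ge0 ltW.
have BE : (1 - c) * B = nrm (F 0) by rewrite mulrC divfK // gt_eqF // subr_gt0.
have s0 k : nrm (s k - s 0) <= B.
  elim: k => [|k IH]; first by rewrite subrr (hnorm0 hip).
  apply: le_trans (hnorm_dist hip _ (F 0) _) _; rewrite subr0 -BE.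
  have := hF (s k) 0; have : c * nrm (s k - 0) <= c * B by rewrite ler_wpM2l.
  rewrite /=; lra.
have sn n k : nrm (s (n + k)%N - s n) <= B * c ^+ n.
  elim: n => [|n IH]; first by rewrite add0n expr0 mulr1; apply: s0.
  rewrite addSn /=; apply: le_trans (hF _ _) _; rewrite exprS mulrCA.
  by rewrite ler_wpM2l.
have scau : forall e : R, 0 < e -> exists N : nat, forall i j : nat,
    (N <= i)%N -> (N <= j)%N -> nrm (s i - s j) < e.
  move=> e e0; have e2 : 0 < e / 2 by rewrite divr_gt0.
  have [N HN] := geometric_lt B _ _ c01 e2; exists N => i j Ni Nj.
  apply: le_lt_trans (hnorm_dist hip _ (s N) _) _.
  have := sn N (i - N)%N; have := sn N (j - N)%N; rewrite !subnKC // (hnorm_subC hip (s N)).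
  have := HN N (leqnn N); lra.
have [l hl] := hc _ scau; exists l.
apply: (hcvg_unique (fun n => s n.+1)); last first.
  by move=> e /hl[N HN]; exists N => n Nn; apply: HN; apply: leqW.
move=> e /hl[N HN]; exists N => n Nn /=.
apply: le_lt_trans (hF _ _) _; apply: le_lt_trans (HN n Nn).
by rewrite ler_piMl ?hnorm_ge0 // ltW.
Qed.

(** A total version of (l - A)^-1, with value 0 where no solution exists. The algebraic bijectivity
    in [resolvable] makes it meaningful; bounds are proved separately. *)
Definition resolvent (A : H -> H) (l : R[i]) (x : H) : H :=
  xget 0 [set y | l *: y - A y = x].

Definition resolvable (A : H -> H) (l : R[i]) :=
  (forall x, exists y, l *: y - A y = x) /\ (forall y, l *: y - A y = 0 -> y = 0).

Lemma resolventP A l x : resolvable A l ->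
  l *: resolvent A l x - A (resolvent A l x) = x.
Proof.
move=> hl; have [y hy] := hl.1 x.
exact: (@xgetPex _ 0 [set y | l *: y - A y = x] (ex_intro _ y hy)).
Qed.

Lemma resolventE A l x y : is_linear_map A -> resolvable A l ->
  l *: y - A y = x -> resolvent A l x = y.
Proof.
move=> hA hl h; apply/eqP; rewrite -subr_eq0; apply/eqP; apply: hl.2.
rewrite (linB A) //; set z := resolvent A l x.
have -> : l *: (z - y) - (A z - A y) = (l *: z - A z) - (l *: y - A y) by hring hip.
by rewrite h resolventP // subrr.
Qed.

Lemma resolvent_lin A l : is_linear_map A -> resolvable A l ->
  is_linear_map (resolvent A l).
Proof.
move=> hA hl a x y; apply: resolventE => //; rewrite hA.
set u := resolvent A l x; set v := resolvent A l y.
rewrite -[in RHS](resolventP A l x hl) -[in RHS](resolventP A l y hl) -/u -/v.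
by hring hip.
Qed.

Lemma resolvent_comm A l x : is_linear_map A -> resolvable A l ->
  resolvent A l (A x) = A (resolvent A l x).
Proof.
move=> hA hl; apply: resolventE => //.
by rewrite -(linZ A _ _ hA) -(linB A) // resolventP.
Qed.

Lemma resolvent_identity A l m x : is_linear_map A -> resolvable A l -> resolvable A m ->
  resolvent A l x - resolvent A m x = (m - l) *: resolvent A l (resolvent A m x).
Proof.
move=> hA hl hm; set u := resolvent A m x.
have hR := resolvent_lin _ _ hA hl.
have e : resolvent A l (m *: u - A u) = resolvent A l x by rewrite resolventP.
rewrite -e; apply/eqP; rewrite subr_eq; apply/eqP; apply: resolventE => //.
have h := resolventP A l u hl; set v := resolvent A l u in h *.
rewrite (linD A) // (linZ A) //.
have -> : l *: ((m - l) *: v + u) - ((m - l) *: A v + A u) =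
   (m - l) *: (l *: v - A v) + (l *: u - A u) by hring hip.
by rewrite h; hring hip.
Qed.

Lemma contraction_resolvable A l : hcomplete ip -> contraction A -> 1 < normc l ->
  resolvable A l.
Proof.
move=> hc [hA cA] l1.
have l0 : l != 0 by apply: contraTneq l1 => ->; rewrite normc0 ltNge ler01.
have nl0 : 0 < normc l by apply: lt_trans l1.
split=> [x|y].
  pose F y := l^-1 *: (x + A y).
  have [||y yE] := @banach_fixpoint hc F (normc l)^-1.
  - by rewrite invr_ge0 ltW //= invf_lt1.
  - move=> y z; rewrite /F -scalerBr opprD addrACA subrr add0r -(linB A) //.
    by rewrite (hnormZ hip) normcV ler_wpM2l // invr_ge0 ltW.
  exists y; rewrite -{1}yE /F scalerA divff // scale1r addrK //.
move=> /eqP; rewrite subr_eq0 => /eqP h; apply: (hnorm_le0 hip).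
have := cA y; rewrite -h (hnormZ hip) => {}h; have := hnorm_ge0 (ip := ip) y.
by move: l1 h; move: (nrm y) (normc l) => a b; nra.
Qed.

Lemma contraction_resolvent_le A l x : hcomplete ip -> contraction A -> 1 < normc l ->
  nrm (resolvent A l x) <= nrm x / (normc l - 1).
Proof.
move=> hc cA l1; have h := resolventP A l x (contraction_resolvable _ _ hc cA l1).
rewrite ler_pdivlMr ?subr_gt0 // -[in X in _ <= X]h.
apply: le_trans (hnorm_subr_ge hip _ _); rewrite (hnormZ hip).
by have := cA.2 (resolvent A l x); lra.
Qed.

Definition unitary_pair (V W : H -> H) :=
  [/\ is_linear_map V, is_linear_map W, forall x y, ip (V x) y = ip x (W y),
      cancel V W & cancel W V].

Lemma unitary_pair_sym V W : unitary_pair V W -> unitary_pair W V.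
Proof. by case=> lV lW ad c1 c2; split=> // x y; rewrite (ipC hip) -ad -(ipC hip). Qed.

Lemma unitary_hnorm V W x : unitary_pair V W -> nrm (V x) = nrm x.
Proof. by case=> lV lW ad c1 c2; rewrite /hnorm ad c1. Qed.

Lemma unitary_ip V W x y : unitary_pair V W -> ip (V x) (V y) = ip x y.
Proof. by case=> lV lW ad c1 c2; rewrite ad c1. Qed.

Lemma unitary_contraction V W : unitary_pair V W -> contraction V.
Proof. by move=> h; split=> [|x]; [case: h | rewrite (unitary_hnorm _ _ _ h)]. Qed.

Lemma unitary_resolvable_gt1 V W l : hcomplete ip -> unitary_pair V W -> 1 < normc l ->
  resolvable V l.
Proof. by move=> hc /unitary_contraction cV; apply: contraction_resolvable. Qed.

(** Inside the disc, l - V = - l V (l^-1 - W) with [W] the inverse of [V], and l^-1 lies outside. *)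
Lemma unitary_resolvable V W l : hcomplete ip -> unitary_pair V W ->
  l != 0 -> normc l != 1 -> resolvable V l.
Proof.
move=> hc hV l0; rewrite neq_lt => /orP[l1|]; last first.
  by apply: contraction_resolvable => //; apply: unitary_contraction hV.
have [lV lW ad c1 c2] := hV.
have l1' : 1 < normc l^-1 by rewrite normcV invf_gt1 // normc_gt0.
have [h1 h2] := contraction_resolvable _ _ hc (unitary_contraction _ _ (unitary_pair_sym _ _ hV)) l1'.
split=> [x|y h].
  have [y hy] := h1 (- l^-1 *: W x); exists y.
  have -> : l *: y - V y = - l *: V (l^-1 *: y - W y).
    by rewrite (linB V) // (linZ V) // c2 scalerBr scalerA mulNr divff //; hring hip.
  by rewrite hy (linZ V) // c2 scalerA mulrNN divff // scale1r.
apply: h2; have -> : l^-1 *: y - W y = - l^-1 *: W (l *: y - V y).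
  rewrite (linB W) // (linZ W) // c1 scalerBr scalerA mulNr mulVf //.
  by hring hip.
by rewrite h (lin0 W) // scaler0.
Qed.

Lemma unitary_resolvent_le V W l x : hcomplete ip -> unitary_pair V W -> l != 0 ->
  normc l < 1 -> nrm (resolvent V l x) <= nrm x / (1 - normc l).
Proof.
move=> hc hV l0 l1.
have h := resolventP V l x (unitary_resolvable _ _ _ hc hV l0 (negbT (lt_eqF l1))).
rewrite ler_pdivlMr ?subr_gt0 // -[in X in _ <= X]h (hnorm_subC hip).
apply: le_trans (hnorm_subr_ge hip _ _); rewrite (hnormZ hip).
by rewrite (unitary_hnorm _ _ _ hV); lra.
Qed.

Lemma resolvent_adj V W l x y : unitary_pair V W -> resolvable V l ->
  resolvable W (conjc l) -> ip (resolvent V l x) y = ip x (resolvent W (conjc l) y).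
Proof.
move=> [lV lW ad c1 c2] h h'.
rewrite -[in LHS](resolventP _ _ y h') -[in RHS](resolventP _ _ x h).
rewrite (ipBr hip) (ipZr hip) conjcK (ipBl hip) (ipZl hip); congr (_ - _).
by rewrite ad.
Qed.

End Hilbert.

(** * Bounded operators and adjoints *)

Section Bounded.
Context {R : realType} {H K : lmodType R[i]}.
Context {ipH : H -> H -> R[i]} {ipK : K -> K -> R[i]}.
Hypotheses (hH : is_inner_product ipH) (hK : is_inner_product ipK).
Local Notation nH := (hnorm ipH).
Local Notation nK := (hnorm ipK).
Implicit Types A : H -> K.

Lemma bounded_op_ge0 A : bounded_op ipH ipK A ->
  exists2 c, 0 <= c & forall x, nK (A x) <= c * nH x.
Proof.
move=> [_ [c hc]]; exists `|c| => // x; apply: le_trans (hc x) _.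
by rewrite ler_wpM2r ?hnorm_ge0 // ler_norm.
Qed.

Lemma opnorm_le A c : 0 <= c -> (forall x, nK (A x) <= c * nH x) ->
  opnorm ipH ipK A <= c.
Proof.
move=> c0 hc; apply: ge_sup.
  by exists (nK (A 0)), 0 => //=; rewrite (hnorm0 hH) ler01.
move=> _ [x /= x1 <-]; apply: le_trans (hc x) _.
by rewrite ler_piMr.
Qed.

Lemma le_opnorm A x : bounded_op ipH ipK A -> nK (A x) <= opnorm ipH ipK A * nH x.
Proof.
move=> hA; have [lA _] := hA; have [c c0 hc] := bounded_op_ge0 A hA.
have [->|x0] := eqVneq x 0; first by rewrite (lin0 _ lA) (hnorm0 hH) (hnorm0 hK) mulr0.
have nx := hnorm_gt0 hH _ x0.
rewrite -ler_pdivrMr //.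
have -> : nK (A x) / nH x = nK (A ((nH x)^-1%:C *: x)).
  by rewrite (linZ A) // (hnormZ hK) normcR ger0_norm ?invr_ge0 ?hnorm_ge0 // mulrC.
apply: ub_le_sup.
  exists c => _ [y /= y1 <-]; apply: le_trans (hc y) _; exact: ler_piMr.
exists ((nH x)^-1%:C *: x) => //=.
by rewrite (hnormZ hH) normcR ger0_norm ?invr_ge0 ?hnorm_ge0 // mulVf ?gt_eqF.
Qed.

Lemma adjoint_exists A : hcomplete ipH -> bounded_op ipH ipK A ->
  exists B : K -> H, forall x y, ipK (A x) y = ipH x (B y).
Proof.
move=> hc hA; have [lA _] := hA; have [c c0 hb] := bounded_op_ge0 A hA.
suff /choice[B hB] : forall y, exists z, forall x, ipK (A x) y = ipH x z by exists B.
move=> y; apply: (riesz hH hc (fun x => ipK (A x) y) (c * nK y)) => [a x z|x].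
  by rewrite lA (ip_lin hK).
apply: le_trans (cauchy_schwarz hK _ _) _.
by rewrite mulrAC ler_wpM2r ?hnorm_ge0.
Qed.

Lemma adjoint_lin A (B : K -> H) :
  (forall x y, ipK (A x) y = ipH x (B y)) -> is_linear_map B.
Proof.
move=> ad a x y; apply: (ip_ext hH) => z.
rewrite (ipC hH) -ad (ipDr hK) (ipZr hK) conjcD conjcM conjcK -!(ipC hK).
by rewrite (ip_lin hH) ![ipH (B _) _](ipC hH) -!ad -!(ipC hK).
Qed.

Lemma adjoint_hnorm A (B : K -> H) c : 0 <= c -> (forall x y, ipK (A x) y = ipH x (B y)) ->
  (forall x, nK (A x) <= c * nH x) -> forall y, nH (B y) <= c * nK y.
Proof.
move=> c0 ad hA y; have [->|By] := eqVneq (B y) 0.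
  by rewrite (hnorm0 hH) mulr_ge0 ?hnorm_ge0.
have nB := hnorm_gt0 hH _ By.
rewrite -(ler_pM2l nB) -expr2 (hnorm_sqr hH) -ad.
apply: le_trans (Re_le_normc _) _; apply: le_trans (cauchy_schwarz hK _ _) _.
by rewrite mulrCA mulrA ler_wpM2r ?hnorm_ge0.
Qed.

(* The orthogonal complement of the range of the adjoint is the kernel. *)
Lemma adjoint_dense A (B : K -> H) : hcomplete ipH ->
  (forall x y, ipK (A x) y = ipH x (B y)) -> (forall x, A x = 0 -> x = 0) ->
  forall v e, 0 < e -> exists y, nH (v - B y) < e.
Proof.
move=> hc ad inj v e e0; have lB := adjoint_lin A B ad.
have [||p [hp orth]] := @projection _ _ _ hH hc (range B) v.
- by exists 0 => //; apply: lin0.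
- by move=> a _ _ [x _ <-] [y _ <-]; exists (a *: x + y) => //; rewrite lB.
have /eqP : v - p = 0.
  apply: inj; apply: (hnorm_eq0 hK); apply/eqP; rewrite -sqrf_eq0 (hnorm_sqr hK) ad.
  by rewrite orth //; exists (A (v - p)).
by rewrite subr_eq0 => /eqP ->; have [_ [y _ <-] hy] := hp e e0; exists y.
Qed.

End Bounded.

Lemma unitary_pairP {R : realType} {H : lmodType R[i]} {ip : H -> H -> R[i]} (V : H -> H) :
  unitary ip V -> exists W, unitary_pair (ip := ip) V W.
Proof. by case=> [[lV _] [W [[lW _] ad c1 c2]]]; exists W. Qed.

(** * Averages over roots of unity *)

Section RootsOfUnity.
Context {R : realType}.
Local Notation C := R[i].

(** An enumeration of all N-th roots of unity. The vanishing power sums are the discrete form of the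
    orthogonality of characters and are kept as a field because most averages reduce to them. *)
Definition root_family (N : nat) (w : 'I_N -> C) :=
  [/\ (0 < N)%N, forall j, w j ^+ N = 1, injective w &
      forall k, (0 < k < N)%N -> \sum_j w j ^+ k = 0].

Definition avg (N : nat) (F : 'I_N -> R) : R := N%:R^-1 * \sum_j F j.

Lemma root_family_normc N (w : 'I_N -> C) j : root_family N w -> normc (w j) = 1.
Proof.
case=> N0 wN _ _; have := congr1 (@normc R) (wN j).
by rewrite normcX normc1 => /eqP; rewrite pexpr_eq1 ?normc_ge0 // => /eqP.
Qed.

Lemma root_family_conj N (w : 'I_N -> C) : root_family N w ->
  root_family N (fun j => conjc (w j)).
Proof.
case=> N0 wN winj ws; split=> // [j|i j /(can_inj (@conjcK R)) /winj //|k /ws h].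
  by rewrite -conjcX wN conjc1.
transitivity (conjc (\sum_j w j ^+ k)); last by rewrite h conjc0.
by rewrite conjc_sum; apply: eq_bigr => j _; rewrite conjcX.
Qed.

Lemma root_family_mulJ N (w : 'I_N -> C) j : root_family N w -> w j * conjc (w j) = 1.
Proof. by move=> h; rewrite normc_mulJ root_family_normc // expr1n. Qed.

Lemma root_family_orth N (w : 'I_N -> C) i j : root_family N w ->
  \sum_(k < N) (w i * conjc (w j)) ^+ k = if i == j then N%:R else 0.
Proof.
move=> hw; have [N0 wN winj _] := hw; case: eqVneq => [->|ij].
  under eq_bigr do rewrite root_family_mulJ // expr1n.
  by rewrite sumr_const card_ord.
set z := w i * _; have zN : z ^+ N = 1.
  by rewrite exprMn -conjcX !wN conjc1 mulr1.
have z1 : z - 1 != 0.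
  apply: contraNneq ij => /eqP; rewrite subr_eq0 => /eqP h; apply/eqP/winj.
  by rewrite -[LHS]mulr1 -(root_family_mulJ N w j hw) mulrCA -/z h mulr1.
by apply: (mulfI z1); rewrite -subrX1 zN subrr mulr0.
Qed.

(** Repeated square roots of -1. Orders that are powers of two suffice, since every average is used
    for N large. *)
Lemma primitive_pow2 m : exists z : C, (2 ^ m.+1).-primitive_root z.
Proof.
have [z hz] : exists z : C, z ^+ (2 ^ m) = -1.
  elim: m => [|m [z hz]]; first by exists (-1); rewrite expr1.
  by exists (sqrtC z); rewrite expnS exprM sqrtCK.
have z1 : z ^+ (2 ^ m.+1) = 1 by rewrite expnSr exprM hz sqrrN expr1n.
have [|d dz] := prim_order_exists _ z1; first by rewrite expn_gt0.
move=> /(dvdn_pfactor _ _ (isT : prime 2)) [e em de].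
exists z; suff -> : m.+1 = e by rewrite -de.
apply/eqP; move: em; rewrite leq_eqVlt eq_sym => /orP[//|].
rewrite ltnS => em; exfalso; have : z ^+ (2 ^ m) == 1.
  by rewrite -(prim_order_dvd dz) de dvdn_exp2l.
rewrite hz eq_sym -subr_eq0 opprK -[1 + 1]/(2%:R) pnatr_eq0.
by [].
Qed.

Lemma root_family_exists n : exists N, (n <= N)%N /\ exists w, root_family N w.
Proof.
exists (2 ^ n.+1)%N; split; first by rewrite ltnW // (ltn_trans (ltnSn n)) // ltn_expl.
have [z hz] := primitive_pow2 n; exists (fun j => z ^+ j); split.
- by rewrite expn_gt0.
- by move=> j; rewrite exprAC (prim_expr_order hz) expr1n.
- move=> i j /eqP; rewrite (eq_prim_root_expr hz) !modn_small // => /eqP.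
  exact: val_inj.
- move=> k /andP[k0 kN].
  have z1 : z ^+ k - 1 != 0.
    by rewrite subr_eq0 -(prim_order_dvd hz) gtnNdvd.
  apply: (mulfI z1); rewrite mulr0.
  under eq_bigr do rewrite exprAC.
  by rewrite -subrX1 exprAC (prim_expr_order hz) expr1n subrr.
Qed.

Lemma avg_le N (F G : 'I_N -> R) : (forall j, F j <= G j) -> avg N F <= avg N G.
Proof. by move=> h; rewrite ler_wpM2l ?invr_ge0 // ler_sum. Qed.

Lemma avgD N (F G : 'I_N -> R) : avg N (fun j => F j + G j) = avg N F + avg N G.
Proof. by rewrite /avg big_split mulrDr. Qed.

Lemma avgZ N c (F : 'I_N -> R) : avg N (fun j => c * F j) = c * avg N F.
Proof. by rewrite /avg -mulr_sumr mulrCA. Qed.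

Lemma avg_const N c : (0 < N)%N -> avg N (fun=> c) = c.
Proof.
move=> N0; rewrite /avg sumr_const card_ord -[c *+ N]mulr_natl mulKf //.
by rewrite pnatr_eq0 -lt0n.
Qed.

(** Young's inequality 2 F G <= t F^2 + t^-1 G^2 with [t = y / x]. The proof runs with positive [x]
    and [y] above [a] and [b] and lets them decrease, so that [a] or [b] may vanish. *)
Lemma avg_cauchy_schwarz N (F G : 'I_N -> R) (a b : R) : 0 <= a -> 0 <= b ->
  avg N (fun j => F j ^+ 2) <= a ^+ 2 -> avg N (fun j => G j ^+ 2) <= b ^+ 2 ->
  avg N (fun j => F j * G j) <= a * b.
Proof.
move=> a0 b0 hF hG.
have pos (x y : R) : 0 < x -> 0 < y -> a <= x -> b <= y ->
    avg N (fun j => F j * G j) <= x * y.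
  move=> x0 y0 ax b_y.
  have xF : avg N (fun j => F j ^+ 2) <= x ^+ 2.
    by apply: le_trans hF _; rewrite ler_pXn2r // nnegrE ltW.
  have yG : avg N (fun j => G j ^+ 2) <= y ^+ 2.
    by apply: le_trans hG _; rewrite ler_pXn2r // nnegrE ltW.
  pose t := y / x; have t0 : 0 < t by rewrite divr_gt0.
  apply: (@le_trans _ _ (avg N (fun j => t / 2 * F j ^+ 2 + t^-1 / 2 * G j ^+ 2))).
    apply: avg_le => j; rewrite -subr_ge0.
    have -> : t / 2 * F j ^+ 2 + t^-1 / 2 * G j ^+ 2 - F j * G j
        = t^-1 / 2 * (t * F j - G j) ^+ 2 by field; rewrite gt_eqF.
    by rewrite mulr_ge0 ?sqr_ge0 // divr_ge0 // invr_ge0 ltW.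
  rewrite avgD !avgZ.
  have h1 : t / 2 * avg N (fun j => F j ^+ 2) <= t / 2 * x ^+ 2.
    by rewrite ler_wpM2l // divr_ge0 // ltW.
  have h2 : t^-1 / 2 * avg N (fun j => G j ^+ 2) <= t^-1 / 2 * y ^+ 2.
    by rewrite ler_wpM2l // divr_ge0 // invr_ge0 ltW.
  have -> : x * y = t / 2 * x ^+ 2 + t^-1 / 2 * y ^+ 2.
    by rewrite /t; field; rewrite !gt_eqF.
  exact: lerD.
apply: (ler_of_forall_mulgt _ _ (a + b + 1)) => e e0.
have [e1|/ltW e1] := leP e 1.
  apply: le_trans (pos (a + e) (b + e) _ _ _ _) _; rewrite ?ltr_wpDl ?lerDl ?(ltW e0) //.
  by move: a b a0 b0 {hF hG pos} => x y; nra.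
apply: le_trans (pos (a + 1) (b + 1) _ _ _ _) _; rewrite ?ltr_wpDl ?lerDl //.
by move: a b a0 b0 {hF hG pos} => x y; nra.
Qed.

Lemma avg_le_sqrt N (F : 'I_N -> R) (a : R) : (0 < N)%N -> 0 <= a ->
  avg N (fun j => F j ^+ 2) <= a ^+ 2 -> avg N F <= a.
Proof.
move=> N0 a0 hF; have := @avg_cauchy_schwarz N F (fun=> 1) a 1 a0 ler01 hF.
rewrite expr1n avg_const // mulr1 => /(_ (lexx _)).
by under eq_fun do rewrite mulr1.
Qed.

End RootsOfUnity.

(** * Discrete Fourier coefficients of resolvents *)

Section DiscreteFourier.
Context {R : realType} {H : lmodType R[i]} {ip : H -> H -> R[i]}.
Hypothesis hip : is_inner_product ip.
Local Notation nrm := (hnorm ip).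
Variables (N : nat) (w : 'I_N -> R[i]).
Hypothesis hw : root_family N w.

(** The exponent is k + 1 because (s w - A)^-1 x expands as the sum of (s w)^-(k+1) A^k x: the k-th
    coefficient isolates A^k x up to aliasing modulo N. *)
Definition dft (f : 'I_N -> H) (k : nat) : H :=
  N%:R^-1 *: \sum_j w j ^+ k.+1 *: f j.

Let N0 : (N%:R : R[i]) != 0.
Proof. by case: hw => n0 _ _ _; rewrite pnatr_eq0 -lt0n. Qed.

Lemma parseval (f : 'I_N -> H) :
  \sum_(k < N) nrm (dft f k) ^+ 2 = avg N (fun j => nrm (f j) ^+ 2).
Proof.
apply: complexI; transitivity (N%:R^-1 * \sum_j ip (f j) (f j)); last first.
  rewrite /avg rmorphM fmorphV rmorph_nat; congr (_ * _).
  by rewrite [RHS]real_complex_sum; apply: eq_bigr => j _; rewrite (ip_self hip).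
rewrite real_complex_sum.
under eq_bigr do rewrite -(ip_self hip) /dft (ipZl hip) (ipZr hip) (ip_suml hip).
rewrite conjcV conjc_nat -!mulr_sumr; congr (_ * _).
transitivity (N%:R^-1 * \sum_i \sum_j (\sum_(k < N) (w i * conjc (w j)) ^+ k) *
   (w i * conjc (w j) * ip (f i) (f j))).
  congr (_ * _); rewrite exchange_big; apply: eq_bigr => i _ /=.
  under eq_bigr do rewrite (ip_sumr hip).
  rewrite exchange_big; apply: eq_bigr => j _ /=; rewrite mulr_suml.
  apply: eq_bigr => k _; rewrite (ipZl hip) (ipZr hip) conjcX exprMn !exprS.
  ring.
rewrite mulr_sumr; apply: eq_bigr => i _; rewrite (bigD1 i) //= [X in _ + X]big1 ?addr0.
  rewrite root_family_orth // eqxx [LHS]mulrA mulVf // mul1r.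
  by rewrite root_family_mulJ // mul1r.
by move=> j ji; rewrite root_family_orth // eq_sym (negPf ji) mul0r.
Qed.

End DiscreteFourier.

(** Regarding the scalars as a Hilbert space makes the vector form of Parseval's identity cover
    scalar functions as well. *)
Lemma complex_is_inner_product {R : realType} :
  is_inner_product (fun u v : R[i]^o => u * conjc v).
Proof.
split=> [a x y z|x y|x|x].
- by rewrite mulrDl -[a *: x]/(a * x) mulrA.
- by rewrite conjcM conjcK mulrC.
- by rewrite normc_mulJ ler0c sqr_ge0.
- by rewrite normc_mulJ => /complexI/eqP; rewrite sqrf_eq0 => /eqP/normc_eq0.
Qed.

Lemma parseval_ip {R : realType} {H : lmodType R[i]} (ip : H -> H -> R[i]) N
    (w : 'I_N -> R[i]) (f : 'I_N -> H) (y : H) :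
  is_inner_product ip -> root_family N w ->
  \sum_(k < N) normc (ip (dft N w f k) y) ^+ 2 = avg N (fun j => normc (ip (f j) y) ^+ 2).
Proof.
move=> hip hw; have hn (z : R[i]^o) : hnorm (fun u v : R[i]^o => u * conjc v) z = normc z.
  by rewrite /hnorm normc_mulJ /= sqrtr_sqr ger0_norm // normc_ge0.
have h := parseval complex_is_inner_product N w hw (fun j => ip (f j) y : R[i]^o).
transitivity (avg N (fun j => hnorm (fun u v : R[i]^o => u * conjc v) (ip (f j) y) ^+ 2)).
  rewrite -h; apply: eq_bigr => k _; rewrite hn; congr (normc _ ^+ 2).
  rewrite /dft (ipZl hip) (ip_suml hip); congr (_ * _).
  by apply: eq_bigr => j _; rewrite (ipZl hip).
by congr (_ * _); apply: eq_bigr => j _; rewrite hn.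
Qed.

Section Recursion.
Context {R : realType} {H : lmodType R[i]} {ip : H -> H -> R[i]}.
Hypothesis hip : is_inner_product ip.
Variables (N : nat) (w : 'I_N -> R[i]).
Hypothesis hw : root_family N w.
Local Notation dft := (dft N w).
Let N0 : (N%:R : R[i]) != 0.
Proof. by case: hw => n0 _ _ _; rewrite pnatr_eq0 -lt0n. Qed.
Variables (A : H -> H) (s : R[i]) (x : H) (f : 'I_N -> H).
Hypothesis lA : is_linear_map A.
Hypothesis hf : forall j, (s * w j) *: f j - A (f j) = x.

(** The equation [hf] gives A f_j = s w_j f_j - x, so [A] shifts the index. This is pure algebra
    with no expansion behind it, and it serves for |s| < 1 as well as for |s| > 1. *)
Lemma dft_step k : A (dft f k) =
  s *: dft f k.+1 - (N%:R^-1 * \sum_j w j ^+ k.+1) *: x.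
Proof.
rewrite /dft (linZ A) // (lin_sum A) // scalerA mulrC -!scalerA -scalerBr; congr (_ *: _).
rewrite scaler_sumr scaler_suml -sumrB; apply: eq_bigr => j _.
rewrite (linZ A) // -(hf j); set y := A _; set z := f j; rewrite [in RHS]exprS.
by hring hip.
Qed.

Lemma dft_iter k : (k < N)%N -> iter k A (dft f 0) = s ^+ k *: dft f k.
Proof.
elim: k => [|k IH] kN; first by rewrite expr0 scale1r.
rewrite /= IH ?(ltnW kN) // (linZ A) // dft_step.
by case: hw => _ _ _ -> //; rewrite mulr0 scale0r subr0 scalerA exprSr.
Qed.

Lemma dft_last : A (dft f N.-1) = s *: dft f 0 - x.
Proof.
have [n0 wN _ _] := hw; rewrite dft_step prednK //.
have -> : \sum_j w j ^+ N = N%:R.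
  by under eq_bigr do rewrite wN; rewrite sumr_const card_ord.
rewrite mulVf // scale1r; congr (_ *: _ - _); rewrite /dft; congr (_ *: _).
by apply: eq_bigr => j _; rewrite exprS wN mulr1 expr1.
Qed.

(** After N steps the index wraps round because w_j^N = 1, which leaves a linear equation for the
    coefficient of index 0. For |s| > 1 it says that this coefficient is s^-1 x up to an error with
    factor s^-N. *)
Lemma dft_cycle : iter N A (dft f 0) = s ^+ N *: dft f 0 - s ^+ N.-1 *: x.
Proof.
have [n0 _ _ _] := hw.
rewrite -{1}(prednK n0) /= dft_iter ?prednK // (linZ A) // dft_last.
by rewrite scalerBr scalerA -exprSr prednK.
Qed.

End Recursion.

(** * Poisson means *)

Section DiscAlgebra.
Context {R : realType}.
Local Notation C := R[i].

Lemma ler_of_forall_mulle1 (x y c : R) :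
  (forall e, 0 < e -> e <= 1 -> x <= y + c * e) -> x <= y.
Proof.
move=> h; apply: (ler_of_forall_mulgt _ _ `|c|) => e e0.
have hc : c <= `|c| by apply: ler_norm.
have c0 : 0 <= `|c| by [].
have [e1|/ltW e1] := leP e 1.
  by apply: le_trans (h e e0 e1) _; rewrite lerD2l ler_wpM2r // ltW.
by apply: le_trans (h 1 ltr01 (lexx _)) _; rewrite lerD2l; nra.
Qed.

Lemma horner_normc_le (p : {poly C}) (z : C) : normc z <= 1 ->
  normc p.[z] <= \sum_(i < size p) normc p`_i.
Proof.
move=> z1; rewrite horner_coef; apply: le_trans (normc_sum _ _ _ _) _.
apply: ler_sum => i _; rewrite normcM normcX ler_piMr ?normc_ge0 //.
by apply: exprn_ile1; rewrite ?normc_ge0.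
Qed.

(** Controls the passage from the unit circle to radius [s]. The range up to 2 admits both r and
    r^-1 for r >= 1/2. *)
Lemma horner_dilate (p : {poly C}) : exists2 L : R, 0 <= L &
  forall (s : R) (z : C), 0 <= s <= 2 -> normc z = 1 ->
    normc (p.[s%:C * z] - p.[z]) <= L * `|s - 1|.
Proof.
exists (\sum_(i < size p) normc p`_i * (i%:R * 2 ^+ i)).
  by apply: sumr_ge0 => i _; rewrite mulr_ge0 ?normc_ge0 ?mulr_ge0 ?exprn_ge0.
move=> s z /andP[s0 s2] z1; rewrite !horner_coef -sumrB.
apply: le_trans (normc_sum _ _ _ _) _; rewrite mulr_suml; apply: ler_sum => i _.
rewrite -mulrBr normcM -mulrA ler_wpM2l ?normc_ge0 // exprMn.
have -> : s%:C ^+ i * z ^+ i - z ^+ i = ((s ^+ i - 1)%:C) * z ^+ i.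
  by rewrite rmorphB rmorphXn rmorph1 mulrBl mul1r.
rewrite normcM normcX z1 expr1n mulr1 normcR subrX1 normrM mulrC ler_wpM2r //.
apply: le_trans (ler_norm_sum _ _ _) _.
apply: (@le_trans _ _ (\sum_(j < i) 2 ^+ i)); last first.
  by rewrite sumr_const card_ord -[_ *+ _]mulr_natl.
apply: ler_sum => j _; rewrite normrX ger0_norm //.
apply: (@le_trans _ _ (2 ^+ j)); first by apply: lerXn2r; rewrite ?nnegrE.
by rewrite ler_weXn2l ?ler1n // ltnW.
Qed.

(* The origin is excluded because the functions of interest involve z^-1, and 0^-1 = 0. *)
Definition disc_algebra (f : C -> C) := forall e : R, 0 < e ->
  exists p : {poly C}, forall z, z != 0 -> normc z <= 1 -> normc (f z - p.[z]) <= e.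

Lemma disc_algebra_poly (p : {poly C}) : disc_algebra (fun z => p.[z]).
Proof. by move=> e e0; exists p => z _ _; rewrite subrr normc0 ltW. Qed.

Lemma disc_algebra_ext f g : (forall z, z != 0 -> normc z <= 1 -> f z = g z) ->
  disc_algebra f -> disc_algebra g.
Proof.
move=> fg hf e /hf[p hp]; exists p => z z0 z1; rewrite -fg //; exact: hp.
Qed.

Lemma disc_algebra_bounded f : disc_algebra f -> exists2 c : R, 0 < c &
  forall z, z != 0 -> normc z <= 1 -> normc (f z) <= c.
Proof.
move=> /(_ 1 ltr01)[p hp]; exists (\sum_(i < size p) normc p`_i + 1).
  by rewrite ltr_wpDl // sumr_ge0 // => i _; rewrite normc_ge0.
move=> z z0 z1; rewrite -[f z](subrK p.[z]) addrC.
by apply: le_trans (normcD _ _) _; rewrite lerD ?horner_normc_le ?hp.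
Qed.

Lemma disc_algebraD f g : disc_algebra f -> disc_algebra g ->
  disc_algebra (fun z => f z + g z).
Proof.
move=> hf hg e e0; have e2 : 0 < e / 2 by rewrite divr_gt0.
have [p hp] := hf _ e2; have [q hq] := hg _ e2.
exists (p + q) => z z0 z1; rewrite hornerD opprD addrACA.
by apply: le_trans (normcD _ _) _; have := hp z z0 z1; have := hq z z0 z1; lra.
Qed.

Lemma disc_algebraM f g : disc_algebra f -> disc_algebra g ->
  disc_algebra (fun z => f z * g z).
Proof.
move=> hf hg e e0.
have [a a0 ha] := disc_algebra_bounded _ hf; have [b b0 hb] := disc_algebra_bounded _ hg.
pose t := Num.min 1 (e / (a + b + 1)).
have ab : 0 < a + b + 1 by lra.
have t0 : 0 < t by rewrite lt_min ltr01 divr_gt0.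
have t1 : t <= 1 by rewrite ge_min lexx.
have t2 : t * (a + b + 1) <= e by rewrite -ler_pdivlMr // ge_min lexx orbT.
have [p hp] := hf _ t0; have [q hq] := hg _ t0.
exists (p * q) => z z0 z1; rewrite hornerM.
have -> : f z * g z - p.[z] * q.[z] =
   (f z - p.[z]) * g z + f z * (g z - q.[z]) - (f z - p.[z]) * (g z - q.[z]) by ring.
apply: le_trans (normcB _ _) _; apply: le_trans (lerD (normcD _ _) (lexx _)) _.
rewrite !normcM.
have := hp z z0 z1; have := hq z z0 z1; have := ha z z0 z1; have := hb z z0 z1.
have := normc_ge0 (f z - p.[z]); have := normc_ge0 (g z - q.[z]).
have := normc_ge0 (f z); have := normc_ge0 (g z).
move: (normc (f z)) (normc (g z)) (normc (f z - _)) (normc (g z - _)) => F G P Q.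
move=> F0 G0 Q0 P0 Gb Fa Qt Pt.
have h1 : P * G <= t * b by apply: ler_pM.
have h2 : F * Q <= a * t by apply: ler_pM.
have h3 : P * Q <= t * 1 by apply: ler_pM => //; apply: le_trans t1.
nra.
Qed.

Lemma disc_algebraJ f : disc_algebra f -> disc_algebra (fun z => conjc (f (conjc z))).
Proof.
move=> hf e /hf[p hp]; exists (map_poly (@conjc R) p) => z z0 z1.
have -> : (map_poly (@conjc R) p).[z] = conjc p.[conjc z].
  by rewrite -[in LHS](conjcK z) horner_map.
by rewrite -conjcB normcJ hp ?conjc_eq0 // normcJ.
Qed.

End DiscAlgebra.

(** * The Poisson kernel on roots of unity *)

Section Poisson.
Context {R : realType}.
Local Notation C := R[i].
Variable q : C.
Hypothesis q1 : normc q < 1.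

Definition poisson (z : C) : R := (1 - normc q ^+ 2) / normc (1 - conjc q * z) ^+ 2.

Let den z : normc z = 1 -> 1 - conjc q * z != 0.
Proof.
move=> z1; rewrite subr_eq0; apply: contraTneq q1 => h.
have := congr1 (@normc R) h; rewrite normc1 normcM normcJ z1 mulr1 => <-.
by rewrite ltxx.
Qed.

Lemma poisson_ge0 z : 0 <= poisson z.
Proof.
rewrite divr_ge0 ?sqr_ge0 // subr_ge0 expr_le1 ?normc_ge0 //.
exact: ltW.
Qed.

Lemma poisson_le z : normc z = 1 -> poisson z <= 2 / (1 - normc q).
Proof.
move=> z1; have d0 : 0 < 1 - normc q by rewrite subr_gt0.
have h : 1 - normc q <= normc (1 - conjc q * z).
  by have := normc_subr_ge 1 (conjc q * z); rewrite normc1 normcM normcJ z1 mulr1.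
have h0 : 0 < normc (1 - conjc q * z) by apply: lt_le_trans h.
rewrite /poisson ler_pdivrMr ?exprn_gt0 // mulrAC ler_pdivlMr //.
move: h d0 h0; have := normc_ge0 q; move: (normc (1 - _)) (normc q) => b a a0 h d0 h0.
have h1 : (1 - a) ^+ 2 <= b ^+ 2 by rewrite ler_pXn2r // nnegrE ltW.
have h2 : 0 <= (1 - a) ^+ 2 * (1 - a) by rewrite mulr_ge0 ?sqr_ge0 // ltW.
by move: h1 h2; nra.
Qed.

Lemma poissonE z : normc z = 1 ->
  (poisson z)%:C = (1 - conjc q * z)^-1 + conjc ((1 - conjc q * z)^-1) - 1.
Proof.
move=> z1; have d0 := den z z1.
have d0' : conjc (1 - conjc q * z) != 0 by rewrite conjc_eq0.
have zz : z * conjc z = 1 by rewrite normc_mulJ z1 expr1n.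
rewrite /poisson rmorphM fmorphV /= -/(_%:C).
rewrite rmorphB rmorph1 -!normc_mulJ conjcV.
have e : conjc (1 - conjc q * z) = 1 - q * conjc z by rewrite conjcB conjcM conjcK conjc1.
rewrite e in d0' *.
transitivity ((1 - q * conjc q * (z * conjc z)) / ((1 - conjc q * z) * (1 - q * conjc z))).
  by rewrite zz mulr1 normc_mulJ.
by field; rewrite d0 d0'.
Qed.

(** Multiplying the kernel by [z - q] cancels its antianalytic half: the right side has only
    positive powers of [z], so its mean tends to 0. This drives the induction on moments. *)
Lemma poisson_step z : normc z = 1 ->
  (poisson z)%:C * (z - q) = (1 - q * conjc q) * (z / (1 - conjc q * z)).
Proof.
move=> z1; have d0 := den z z1.
have d0' : conjc (1 - conjc q * z) != 0 by rewrite conjc_eq0.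
have zz : z * conjc z = 1 by rewrite normc_mulJ z1 expr1n.
rewrite poissonE // conjcV.
have e : conjc (1 - conjc q * z) = 1 - q * conjc z by rewrite conjcB conjcM conjcK conjc1.
rewrite e in d0' *.
have -> : z - q = z * (1 - q * conjc z) by rewrite mulrBr mulr1 mulrCA zz mulr1.
transitivity ((1 - q * conjc q * (z * conjc z)) * (z / (1 - conjc q * z))).
  by field; rewrite d0 d0'.
by rewrite zz mulr1.
Qed.

Lemma root_family_sum_shift N (w : 'I_N -> C) m : root_family N w -> (0 < m < N)%N ->
  \sum_j w j ^+ (m + N) = 0.
Proof.
case=> N0 wN _ ws hm; under eq_bigr do rewrite exprD wN mulr1.
exact: ws.
Qed.

(** On N-th roots of unity the geometric series folds into a sum of N terms divided by 1 - conj q^N,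
    and averaging against w^m keeps the term of index N - m alone. *)
Lemma avg_cauchy_kernel N (w : 'I_N -> C) m : root_family N w -> (0 < m <= N)%N ->
  N%:R^-1 * \sum_j w j ^+ m / (1 - conjc q * w j) = conjc q ^+ (N - m) / (1 - conjc q ^+ N).
Proof.
move=> hw /andP[m0 mN]; have [N0 wN winj ws] := hw.
have NC : (N%:R : C) != 0 by rewrite pnatr_eq0 -lt0n.
have qN : 1 - conjc q ^+ N != 0.
  have h : normc (conjc q ^+ N) < 1.
    by rewrite normcX normcJ exprn_ilt1 ?normc_ge0 // -lt0n.
  by rewrite subr_eq0; apply: contraTneq h => <-; rewrite normc1 ltxx.
have geo j : (1 - conjc q * w j)^-1 = (\sum_(k < N) (conjc q * w j) ^+ k) / (1 - conjc q ^+ N).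
  have d0 := den _ (root_family_normc N w j hw).
  have e : 1 - conjc q ^+ N = (1 - conjc q * w j) * \sum_(k < N) (conjc q * w j) ^+ k.
    have := subrX1 (conjc q * w j) N; rewrite exprMn wN mulr1 => h.
    by rewrite -[LHS]opprB h -mulNr opprB.
  rewrite [in RHS]e invfM mulrCA divff ?mulr1 //.
  by apply: contraNneq qN => h; rewrite e h mulr0.
under eq_bigr do rewrite geo mulrA.
rewrite -mulr_suml mulrA; congr (_ / _).
transitivity (N%:R^-1 * \sum_(k < N) conjc q ^+ k * \sum_j w j ^+ (m + k)).
  congr (_ * _); under eq_bigr do rewrite mulr_sumr.
  rewrite exchange_big; apply: eq_bigr => k _; rewrite mulr_sumr.
  by apply: eq_bigr => j _; rewrite exprMn exprD; ring.
have kN : (N - m < N)%N by rewrite ltn_subrL m0.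
rewrite (bigD1 (Ordinal kN)) //= subnKC // [X in _ + X]big1 ?addr0.
  have -> : \sum_j w j ^+ N = N%:R.
    by under eq_bigr do rewrite wN; rewrite sumr_const card_ord.
  by rewrite mulrCA mulVf // mulr1.
move=> k kne; have kne' : (m + k != N)%N.
  by apply: contra kne => /eqP h; apply/eqP/val_inj; rewrite /= -[LHS](addKn m) h.
have [h|h] := ltnP (m + k) N; first by rewrite ws ?mulr0 // h addn_gt0 m0.
rewrite -(subnK h) root_family_sum_shift ?mulr0 //.
rewrite subn_gt0 ltn_neqAle eq_sym kne' h /= ltn_subLR //.
by have := ltn_ord k; rewrite -(ltn_add2l N); apply: leq_ltn_trans; rewrite leq_add2r.
Qed.

(** Induction on [n]: by [poisson_step], the moment of order n + 1 is [q] times the one of order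
    [n], plus an average of Cauchy kernels that tends to 0 geometrically in N. *)
Lemma poisson_moment n (e : R) : 0 < e -> exists N0, forall N (w : 'I_N -> C),
  (N0 <= N)%N -> root_family N w ->
  normc (N%:R^-1 * \sum_j (poisson (w j))%:C * w j ^+ n - q ^+ n) <= e.
Proof.
have q01 : 0 <= normc q < 1 by rewrite normc_ge0.
have small c e' : 0 < e' -> exists N0, forall N, (N0 <= N)%N ->
    normc (conjc q ^+ (N - c)%N / (1 - conjc q ^+ N)) <= e' /\ (c < N)%N.
  move=> e0; have e2 : 0 < e' / 2 by rewrite divr_gt0.
  have [N1 H1] := geometric_lt 1 _ _ q01 e2.
  have [N2 H2] := geometric_lt 1 _ _ q01 (ltac:(lra) : (0 : R) < 2^-1).
  exists (N1 + N2 + c).+1 => N hN; split; last by apply: leq_ltn_trans hN; rewrite leq_addl.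
  have := H1 (N - c)%N; have := H2 N; rewrite !mul1r => h2 h1.
  have {}h1 : normc q ^+ (N - c) < e' / 2.
    apply: h1; rewrite leq_subRL; first by rewrite addnC; apply: leq_trans (ltnW hN); rewrite leq_add2r leq_addr.
    by apply: leq_trans (ltnW hN); rewrite leq_addl.
  have {}h2 : normc q ^+ N < 2^-1.
    by apply: h2; apply: leq_trans (ltnW hN); rewrite -addnA (addnC N2) addnA leq_addl.
  rewrite normcM normcV normcX normcJ.
  have h3 : 2^-1 <= normc (1 - conjc q ^+ N).
    have := normc_subr_ge 1 (conjc q ^+ N); rewrite normc1 normcX normcJ; lra.
  have h4 : 0 < normc (1 - conjc q ^+ N) by apply: lt_le_trans h3; lra.
  rewrite ler_pdivrMr //; nra.
elim: n e => [|n IH] e e0.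
  have e2 : 0 < e / 2 by rewrite divr_gt0.
  have [N0 H0] := small 0%N _ e2; exists N0.+1 => N w hN hw.
  have [N1 wN _ _] := hw.
  have [h _] := H0 _ (ltnW hN); rewrite subn0 in h.
  have c0 : N%:R^-1 * \sum_j (1 - conjc q * w j)^-1 = (1 - conjc q ^+ N)^-1.
    have := avg_cauchy_kernel N w N hw; rewrite subnn expr0 mul1r N1 leqnn => /(_ isT) <-.
    by congr (_ * _); apply: eq_bigr => j _; rewrite wN mul1r.
  have NC : (N%:R : C) != 0 by rewrite pnatr_eq0 -lt0n.
  have -> : N%:R^-1 * \sum_j (poisson (w j))%:C * w j ^+ 0 - q ^+ 0 =
     ((1 - conjc q ^+ N)^-1 - 1) + conjc ((1 - conjc q ^+ N)^-1 - 1).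
    rewrite expr0 conjcB conjc1 -c0 conjcM conjcV conjc_nat conjc_sum.
    transitivity (N%:R^-1 * (\sum_j (1 - conjc q * w j)^-1 +
       \sum_j conjc ((1 - conjc q * w j)^-1) - \sum_(j < N) 1) - 1).
      congr (_ * _ - _); rewrite -big_split -sumrB; apply: eq_bigr => j _.
      by rewrite expr0 mulr1 poissonE // (root_family_normc N w).
    rewrite sumr_const card_ord mulrBr mulVf // mulrDr; ring.
  have qN : 1 - conjc q ^+ N != 0.
    have h' : normc (conjc q ^+ N) < 1.
      by rewrite normcX normcJ exprn_ilt1 ?normc_ge0 // -lt0n.
    by rewrite subr_eq0; apply: contraTneq h' => <-; rewrite normc1 ltxx.
  have -> : (1 - conjc q ^+ N)^-1 - 1 = conjc q ^+ N / (1 - conjc q ^+ N).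
    by field.
  apply: le_trans (normcD _ _) _; rewrite normcJ; lra.
have e2 : 0 < e / 2 by rewrite divr_gt0.
have [N1 H1] := IH _ e2; have [N2 H2] := small n.+1 _ e2.
exists (N1 + N2)%N => N w hN hw.
have {}H1 := H1 N w (leq_trans (leq_addr _ _) hN) hw.
have [{}H2 nN] := H2 N (leq_trans (leq_addl _ _) hN).
have step : N%:R^-1 * (\sum_j (poisson (w j))%:C * w j ^+ n.+1) =
   q * (N%:R^-1 * \sum_j (poisson (w j))%:C * w j ^+ n) +
   (1 - q * conjc q) * (conjc q ^+ (N - n.+1) / (1 - conjc q ^+ N)).
  have nN' : (0 < n.+1 <= N)%N by exact: ltnW nN.
  rewrite -(avg_cauchy_kernel N w n.+1 hw nN').
  rewrite mulrCA [X in _ = _ + X]mulrCA -mulrDr; congr (_ * _).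
  rewrite !mulr_sumr -big_split; apply: eq_bigr => j _ /=.
  have h := poisson_step (w j) (root_family_normc N w j hw).
  transitivity (w j ^+ n * (q * (poisson (w j))%:C + (poisson (w j))%:C * (w j - q))).
    by rewrite exprS; ring.
  by rewrite h exprS; ring.
rewrite step exprS.
have -> : forall g c : C, q * g + (1 - q * conjc q) * c - q * q ^+ n =
   q * (g - q ^+ n) + (1 - q * conjc q) * c by move=> g c; ring.
apply: le_trans (normcD _ _) _.
rewrite [normc (q * _)]normcM [normc ((1 - q * conjc q) * _)]normcM.
have h1 : normc (1 - q * conjc q) <= 1.
  rewrite normc_mulJ -(rmorph1 (real_complex R)) -rmorphB normcR ger0_norm.
    by rewrite gerBl sqr_ge0.
  by rewrite subr_ge0 expr_le1 ?normc_ge0 // ltW.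
rewrite [X in _ <= X]splitr.
apply: lerD; rewrite -[X in _ <= X]mul1r; apply: ler_pM; rewrite ?normc_ge0 //.
exact: ltW.
Qed.

Lemma poisson_mean_poly (p : {poly C}) (e : R) : 0 < e -> exists N0, forall N (w : 'I_N -> C),
  (N0 <= N)%N -> root_family N w ->
  normc (N%:R^-1 * \sum_j (poisson (w j))%:C * p.[w j] - p.[q]) <= e.
Proof.
move: e; pose P (r : {poly C}) := forall e : R, 0 < e -> exists N0, forall N (w : 'I_N -> C),
  (N0 <= N)%N -> root_family N w ->
  normc (N%:R^-1 * \sum_j (poisson (w j))%:C * r.[w j] - r.[q]) <= e.
have PD r s : P r -> P s -> P (r + s).
  move=> hr hs e e0; have e2 : 0 < e / 2 by rewrite divr_gt0.
  have [N1 H1] := hr _ e2; have [N2 H2] := hs _ e2.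
  exists (N1 + N2)%N => N w hN hw.
  have {}H1 := H1 N w (leq_trans (leq_addr _ _) hN) hw.
  have {}H2 := H2 N w (leq_trans (leq_addl _ _) hN) hw.
  have -> : \sum_j (poisson (w j))%:C * (r + s).[w j] =
      \sum_j (poisson (w j))%:C * r.[w j] + \sum_j (poisson (w j))%:C * s.[w j].
    by rewrite -big_split; apply: eq_bigr => j _; rewrite hornerD mulrDr.
  rewrite hornerD mulrDr opprD addrACA.
  by apply: le_trans (normcD _ _) _; rewrite [e]splitr lerD.
have PZ (c : C) n : P (c *: 'X^n).
  move=> e e0; have c1 : 0 < normc c + 1 by rewrite ltr_wpDl // normc_ge0.
  have ec : 0 < e / (normc c + 1) by rewrite divr_gt0.
  have [N0 H0] := poisson_moment n _ ec.
  exists N0 => N w hN hw; have {}H0 := H0 N w hN hw.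
  have -> : \sum_j (poisson (w j))%:C * (c *: 'X^n).[w j] =
      c * \sum_j (poisson (w j))%:C * w j ^+ n.
    by rewrite mulr_sumr; apply: eq_bigr => j _; rewrite hornerZ hornerXn mulrCA.
  rewrite hornerZ hornerXn mulrCA -mulrBr normcM.
  apply: (@le_trans _ _ ((normc c + 1) * (e / (normc c + 1)))).
    by apply: ler_pM; rewrite ?normc_ge0 // lerDl.
  by rewrite mulrC divfK // gt_eqF.
rewrite -/(P p) -[p]coefK poly_def; apply: (big_ind P) => [|//|i _]; last exact: PZ.
by have := PZ 0 0%N; rewrite scale0r.
Qed.

Lemma poisson_mass (e : R) : 0 < e -> exists N0, forall N (w : 'I_N -> C),
  (N0 <= N)%N -> root_family N w -> avg N (fun j => poisson (w j)) <= 1 + e.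
Proof.
move=> /(poisson_moment 0)[N0 H]; exists N0 => N w hN hw.
have := le_trans (Re_le_normc _) (H N w hN hw); rewrite expr0 ReD ReN /= lerBlDl.
apply: le_trans; rewrite le_eqVlt; apply/orP; left; apply/eqP.
rewrite /avg -[LHS]/(Re (_%:C)) rmorphM fmorphV rmorph_nat; congr (Re (_ * _)).
by rewrite [LHS]real_complex_sum; apply: eq_bigr => j _; rewrite expr0 mulr1.
Qed.

(** The maximum principle in the form needed later: the boundary values of [f] enter through a
    weighted mean of their moduli and no uniform bound is asked for. *)
Lemma poisson_submean (f : C -> C) (e : R) : disc_algebra f -> q != 0 -> 0 < e ->
  exists N0, forall N (w : 'I_N -> C), (N0 <= N)%N -> root_family N w ->
  normc (f q) <= avg N (fun j => poisson (w j) * normc (f (w j))) + e.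
Proof.
move=> hf q0 e0; have e8 : 0 < e / 4 by rewrite divr_gt0.
have e1 : 0 < Num.min 1 (e / 4) by rewrite lt_min ltr01.
have [p hp] := hf _ e1.
(* Error budget: e/4 for replacing [f] by [p] at [q], e/4 for the discrete mean of [p], and e/4
   times a kernel mass of at most 2 for returning to [f] on the circle. *)
have [N1 H1] := poisson_mean_poly p _ e8; have [N2 H2] := poisson_mass _ ltr01.
exists (N1 + N2)%N => N w hN hw.
have {}H1 := H1 N w (leq_trans (leq_addr _ _) hN) hw.
have {}H2 := H2 N w (leq_trans (leq_addl _ _) hN) hw.
have fq : normc (f q) <= normc p.[q] + e / 4.
  rewrite -lerBlDl; apply: le_trans (normc_subr_ge _ _) _.
  by apply: le_trans (hp q q0 (ltW q1)) _; rewrite ge_min lexx orbT.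
have pq : normc p.[q] <= normc (N%:R^-1 * \sum_j (poisson (w j))%:C * p.[w j]) + e / 4.
  rewrite -lerBlDl; apply: le_trans (normc_subr_ge _ _) _; by rewrite normc_subC.
have pavg : normc (N%:R^-1 * \sum_j (poisson (w j))%:C * p.[w j]) <=
    avg N (fun j => poisson (w j) * normc (f (w j)) + e / 4 * poisson (w j)).
  rewrite normcM normcV normc_nat ler_wpM2l ?invr_ge0 //.
  apply: le_trans (normc_sum _ _ _ _) _; apply: ler_sum => j _.
  rewrite normcM normcR ger0_norm ?poisson_ge0 // [e / 4 * _]mulrC -mulrDr.
  rewrite ler_wpM2l ?poisson_ge0 // -lerBlDl.
  apply: le_trans (normc_subr_ge _ _) _; rewrite normc_subC.
  have wj := root_family_normc N w j hw.
  have wj0 : w j != 0 by apply: normc1_neq0.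
  by apply: le_trans (hp _ wj0 _) _; rewrite ?wj // ge_min lexx orbT.
rewrite avgD avgZ in pavg.
nra.
Qed.

End Poisson.

(** * The perturbation determinant *)

Section OuterResolvent.
Context {R : realType} {H : lmodType R[i]} {ip : H -> H -> R[i]}.
Hypotheses (hip : is_inner_product ip) (hc : hcomplete ip).
Local Notation nrm := (hnorm ip).
Local Notation C := R[i].

Lemma contraction_iter (A : H -> H) k x : contraction (ip := ip) A ->
  nrm (iter k A x) <= nrm x.
Proof.
by move=> [_ cA]; elim: k => [//|k IH] /=; apply: le_trans (cA _) IH.
Qed.

(** Functions analytic outside the closed disc are read inside it through [z |-> (r z)^-1] with r <
    1, which keeps a fixed distance from the circle. *)
Lemma outer_normc (r : R) (z : C) : 0 < r < 1 -> z != 0 -> normc z <= 1 ->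
  r^-1 <= normc ((r%:C * z)^-1).
Proof.
move=> /andP[r0 r1] z0 z1; rewrite normcV normcM normcR gtr0_norm //.
rewrite lef_pV2 ?posrE ?mulr_gt0 ?normc_gt0 //.
by rewrite ger_pMr.
Qed.

Lemma outer_normc_gt1 (r : R) (z : C) : 0 < r < 1 -> z != 0 -> normc z <= 1 ->
  1 < normc ((r%:C * z)^-1).
Proof.
move=> /andP[r0 r1] z0 z1; apply: lt_le_trans (outer_normc _ _ _ z0 z1).
  by rewrite invf_gt1.
by rewrite r0.
Qed.

Lemma resolvent_expansion (A : H -> H) (l : C) n x : contraction (ip := ip) A ->
  1 < normc l -> resolvent A l x =
    \sum_(k < n) l^-1 ^+ k.+1 *: iter k A x + l^-1 ^+ n *: resolvent A l (iter n A x).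
Proof.
move=> cA l1; have lA := cA.1.
have hR := contraction_resolvable hip _ _ hc cA l1.
have l0 : l != 0 by apply: contraTneq l1 => ->; rewrite normc0 ltNge ler01.
have step y : resolvent A l y = l^-1 *: y + l^-1 *: resolvent A l (A y).
  rewrite (resolvent_comm hip) // -scalerDr -{2}(resolventP _ _ y hR) subrK.
  by rewrite scalerA mulVf // scale1r.
elim: n => [|n IH]; first by rewrite big_ord0 add0r expr0 scale1r.
rewrite big_ord_recr /= IH -addrA; congr (_ + _).
by rewrite {1}step scalerDr !scalerA -!exprSr.
Qed.

(** Partial Neumann sums are polynomials in [z], and the tail is geometric in [r], uniformly on the
    disc. *)
Lemma disc_algebra_resolvent (A : H -> H) (r : R) (x y : H) :
  contraction (ip := ip) A -> 0 < r < 1 ->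
  disc_algebra (fun z => ip (resolvent A ((r%:C * z)^-1) x) y).
Proof.
move=> cA r01 e e0; have /andP[r0 r1] := r01.
have r1' : 1 < r^-1 by rewrite invf_gt1.
have [N HN] := geometric_lt (nrm x * nrm y / (r^-1 - 1)) r e (ltac:(by rewrite ltW) : 0 <= r < 1) e0.
exists (\sum_(k < N) (r%:C ^+ k.+1 * ip (iter k A x) y) *: 'X^(k.+1)) => z z0 z1.
set l := (r%:C * z)^-1; have l1 : 1 < normc l by apply: outer_normc_gt1.
rewrite (resolvent_expansion A l N) // (ipDl hip) (ip_suml hip) horner_sum.
have -> : \sum_(k < N) ip (l^-1 ^+ k.+1 *: iter k A x) y =
   \sum_(k < N) ((r%:C ^+ k.+1 * ip (iter k A x) y) *: 'X^(k.+1)).[z].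
  apply: eq_bigr => k _; rewrite (ipZl hip) hornerZ hornerXn /l invrK exprMn; ring.
rewrite addrAC subrr add0r (ipZl hip) normcM normcX.
have ll : normc l^-1 <= r.
  by rewrite /l invrK normcM normcR gtr0_norm // ler_piMr // ltW.
apply: le_trans (ltW (HN N (leqnn N))); rewrite mulrC; apply: ler_pM; rewrite ?exprn_ge0 ?normc_ge0 //.
  apply: le_trans (cauchy_schwarz hip _ _) _; rewrite mulrAC ler_wpM2r ?hnorm_ge0 //.
  apply: le_trans (contraction_resolvent_le hip _ _ _ hc cA l1) _.
  apply: ler_pM; rewrite ?hnorm_ge0 ?contraction_iter ?invr_ge0 ?subr_ge0 ?(ltW l1) //.
  by rewrite lef_pV2 ?posrE ?subr_gt0 // lerD2r; apply: outer_normc.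
by apply: lerXn2r; rewrite ?nnegrE ?normc_ge0 ?(ltW r0).
Qed.

End OuterResolvent.

(** * Normalizers and uniform mean square bounds *)

Section Normalizer.
Context {R : realType} {H : lmodType R[i]} {ip : H -> H -> R[i]}.
Hypotheses (hip : is_inner_product ip) (hc : hcomplete ip).
Local Notation nrm := (hnorm ip).
Local Notation C := R[i].
Variables (W W' : H -> H) (y : H) (b : R).
Hypotheses (hW : unitary_pair (ip := ip) W W') (b0 : 0 < b) (by1 : b * nrm y ^+ 2 <= 1).

(** Damping the component along [y] before applying [W] loses at least b |(x, y)|^2 of squared norm,
    which is where the mean square bound comes from. *)
Definition compressed (x : H) : H := W (x - (b%:C * ip x y) *: y).

(* Multiplication by [normalizer l] turns [(resolvent W l w, y)] into [(resolvent compressed l w, y)],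
   whose square means over the circles [|l| = r], [r > 1], are bounded uniformly in [r]. *)
Definition normalizer (l : C) : C := 1 - b%:C * ip (resolvent compressed l (W y)) y.

Let lW : is_linear_map W. Proof. by case: hW. Qed.

Lemma compressed_sqr x :
  nrm (compressed x) ^+ 2 + b * normc (ip x y) ^+ 2 <= nrm x ^+ 2.
Proof.
rewrite /compressed (unitary_hnorm _ _ _ hW) (hnormB_sqr hip) (ipZr hip) (hnormZ hip).
rewrite conjcM conjc_real -mulrA (mulrC (conjc _)) normc_mulJ ReZ /= normcM normcR gtr0_norm //.
have := mulr_ge0 (ltW b0) (sqr_ge0 (normc (ip x y))).
move: by1; set t := nrm y ^+ 2; set s := normc _.
rewrite !exprMn -/t; nra.
Qed.

Lemma compressed_contraction : contraction (ip := ip) compressed.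
Proof.
split=> [a x z|x].
  rewrite /compressed -lW; congr W; rewrite (ip_lin hip); hring hip.
rewrite -(@ler_pXn2r _ 2) ?nnegrE ?hnorm_ge0 //; apply: le_trans (compressed_sqr x).
by rewrite lerDl mulr_ge0 ?sqr_ge0 ?ltW.
Qed.

(** The losses of [compressed_sqr] telescope along the orbit, so the bound does not depend on
    [n]. *)
Lemma compressed_sum n x :
  b * \sum_(k < n) normc (ip (iter k compressed x) y) ^+ 2 <= nrm x ^+ 2.
Proof.
suff h : nrm (iter n compressed x) ^+ 2 +
    b * \sum_(k < n) normc (ip (iter k compressed x) y) ^+ 2 <= nrm x ^+ 2.
  by apply: le_trans h; rewrite lerDr sqr_ge0.
elim: n => [|n IH]; first by rewrite big_ord0 mulr0 addr0.
rewrite big_ord_recr /= mulrDr; have := compressed_sqr (iter n compressed x); lra.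
Qed.

Section Outside.
Variable l : C.
Hypothesis l1 : 1 < normc l.

Let hR := contraction_resolvable hip _ _ hc compressed_contraction l1.
Let hRW := contraction_resolvable hip _ _ hc (unitary_contraction _ _ hW) l1.

Lemma normalizerE x : ip (resolvent compressed l x) y = normalizer l * ip (resolvent W l x) y.
Proof.
have lR := resolvent_lin hip _ _ compressed_contraction.1 hR.
set p := resolvent W l x.
have e : p = resolvent compressed l x + (b%:C * ip p y) *: resolvent compressed l (W y).
  apply/esym; rewrite -(linZ _ _ _ lR) -(linD _ _ _ lR).
  apply: (resolventE hip) => //; first exact: compressed_contraction.1.
  rewrite -(resolventP W l x hRW) -/p /compressed (linB W) // (linZ W) //.
  by hring hip.
have := congr1 (fun z => ip z y) e; rewrite (ipDl hip) (ipZl hip) /normalizer => h.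
by rewrite mulrBl mul1r {1}h; ring.
Qed.

(** With z = (l - compressed)^-1 W y and g the normalizer, l z = W (z + g y). Comparing norms and
    using |l| > 1 gives |g| (2 - t) <= 2 for t = b |y|^2, and 2 / (2 - t) <= 1 + t when t <= 1. *)
Lemma normalizer_le : normc (normalizer l) <= 1 + b * nrm y ^+ 2.
Proof.
set z := resolvent compressed l (W y); set g := normalizer l.
have e : l *: z = W (z + g *: y).
  have := resolventP compressed l (W y) hR; rewrite -/z => /eqP; rewrite subr_eq => /eqP ->.
  by rewrite -(linD _ _ _ lW) /g /normalizer -/z; congr W; hring hip.
have bz : b%:C * ip z y = 1 - g by rewrite /g /normalizer -/z; ring.
have en : normc l ^+ 2 * nrm z ^+ 2 =
    nrm z ^+ 2 + Re (ip z (g *: y)) *+ 2 + normc g ^+ 2 * nrm y ^+ 2.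
  by rewrite -exprMn -(hnormZ hip) e (unitary_hnorm _ _ _ hW) (hnormD_sqr hip) (hnormZ hip) exprMn.
have re : b * Re (ip z (g *: y)) = Re g - normc g ^+ 2.
  rewrite -ReZ (ipZr hip) mulrCA bz mulrBr mulr1 (mulrC (conjc g)) normc_mulJ ReD ReN ReJ.
  by [].
have l2 : 1 <= normc l ^+ 2 by rewrite expr_ge1 // ?normc_ge0 // ltW.
have h : 0 <= Re (ip z (g *: y)) *+ 2 + normc g ^+ 2 * nrm y ^+ 2.
  have : nrm z ^+ 2 <= normc l ^+ 2 * nrm z ^+ 2 by rewrite ler_peMl ?sqr_ge0.
  by rewrite en; lra.
have h2 : 0 <= b * (Re (ip z (g *: y)) *+ 2 + normc g ^+ 2 * nrm y ^+ 2).
  by rewrite mulr_ge0 // ltW.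
have h3 : 0 <= (Re g - normc g ^+ 2) *+ 2 + normc g ^+ 2 * (b * nrm y ^+ 2).
  by rewrite -re; move: h2; lra.
have := Re_le_normc g; have g0 := normc_ge0 g.
have t0 : 0 <= b * nrm y ^+ 2 by rewrite mulr_ge0 ?sqr_ge0 ?ltW.
move: h3 by1 g0 t0; move: (b * nrm y ^+ 2) (normc g) (Re g) => t G r h3 t1 G0 t0 rG.
have h4 : G * (G * (2 - t)) <= G * 2 by nra.
have [->|Gn] := eqVneq G 0; first by lra.
have Gp : 0 < G by rewrite lt_neqAle eq_sym Gn.
have h5 : G * (2 - t) <= 2 by rewrite -(ler_pM2l Gp).
nra.
Qed.

(** At a fixed [l] the normalizer tends to 1 with [b]; this removes it once the estimate at an
    interior point is reached. *)
Lemma normalizer_sub1 : normc (normalizer l - 1) <= b * nrm y ^+ 2 / (normc l - 1).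
Proof.
have -> : normalizer l - 1 = - (b%:C * ip (resolvent compressed l (W y)) y).
  by rewrite /normalizer; ring.
rewrite normcN normcM normcR gtr0_norm // -mulrA ler_pM2l //.
apply: le_trans (cauchy_schwarz hip _ _) _; rewrite expr2 mulrAC ler_wpM2r ?hnorm_ge0 //.
apply: le_trans (contraction_resolvent_le hip _ _ _ hc compressed_contraction l1) _.
by rewrite (unitary_hnorm _ _ _ hW).
Qed.

End Outside.

Lemma disc_algebra_normalizer (r : R) : 0 < r < 1 ->
  disc_algebra (fun z => normalizer ((r%:C * z)^-1)).
Proof.
move=> r01; have h := disc_algebra_resolvent hip hc compressed r (W y) y compressed_contraction r01.
have h2 := disc_algebraD _ _ (disc_algebra_poly 1%:P)
  (disc_algebraM _ _ (disc_algebra_poly (- b%:C)%:P) h).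
by apply: disc_algebra_ext h2 => z _ _; rewrite !hornerC mulNr.
Qed.

Lemma disc_algebra_normalized (r : R) x : 0 < r < 1 ->
  disc_algebra (fun z => normalizer ((r%:C * z)^-1) * ip (resolvent W ((r%:C * z)^-1) x) y).
Proof.
move=> r01; have h := disc_algebra_resolvent hip hc compressed r x y compressed_contraction r01.
apply: disc_algebra_ext h => z z0 z1; rewrite normalizerE //.
exact: outer_normc_gt1.
Qed.

(** By Parseval the mean square is the sum of |(a_k, y)|^2, where a_k is r^k times the k-th iterate
    of [compressed] on a_0, and [compressed_sum] applies. The factor 2 comes from |a_0| <= r |x| +
    r^N |a_0| with r^N < 1/2. *)
Lemma normalized_mean_square (r : R) : 0 < r < 1 -> exists N0, forall N (w : 'I_N -> C),
  (N0 <= N)%N -> root_family N w -> forall x,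
  avg N (fun j => normc (normalizer ((r%:C * w j)^-1) * ip (resolvent W ((r%:C * w j)^-1) x) y) ^+ 2)
    <= (2 * nrm x / Num.sqrt b) ^+ 2.
Proof.
move=> r01; have /andP[r0 r1] := r01.
have [N0 HN] := geometric_lt 1 r (2^-1) (ltac:(by rewrite ltW) : 0 <= r < 1) (ltac:(lra)).
exists N0 => N w hN hw x; have {HN} := HN N hN; rewrite mul1r => rN.
have [n0 _ _ _] := hw.
have w1 j := root_family_normc N w j hw.
have w0 j : w j != 0.
  exact: normc1_neq0.
have hw' := root_family_conj N w hw.
(* The sample points are r^-1 times the conjugate roots, so the Fourier recursion runs over the
   conjugate family with s = r^-1. *)
have inv j : (r%:C * w j)^-1 = (r^-1)%:C * conjc (w j).
  rewrite invfM fmorphV; congr (_ * _); apply: (mulfI (w0 j)).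
  by rewrite divff // (root_family_mulJ N w j hw).
have l1 j : 1 < normc ((r%:C * w j)^-1) by apply: outer_normc_gt1; rewrite ?w1.
have cC := compressed_contraction; have lC := cC.1.
pose f j := resolvent compressed ((r%:C * w j)^-1) x.
have hf j : ((r^-1)%:C * conjc (w j)) *: f j - compressed (f j) = x.
  by rewrite -inv; apply: resolventP; apply: (contraction_resolvable hip).
pose a := dft N (fun j => conjc (w j)) f.
have rec k : (k < N)%N -> a k = r%:C ^+ k *: iter k compressed (a 0).
  move=> kN; rewrite (dft_iter hip N _ hw' compressed (r^-1)%:C x f lC hf k kN) scalerA.
  by rewrite -exprMn -rmorphM divff ?gt_eqF // rmorph1 expr1n scale1r.
have a0 : nrm (a 0) <= 2 * nrm x.
  have e : a 0 = r%:C *: x + r%:C ^+ N *: iter N compressed (a 0).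
    rewrite (dft_cycle hip N _ hw' compressed (r^-1)%:C x f lC hf).
    have rr : r%:C * (r^-1)%:C = 1 :> C by rewrite -rmorphM divff ?gt_eqF // rmorph1.
    have e1 : r%:C ^+ N * (r^-1)%:C ^+ N = 1 :> C by rewrite -exprMn rr expr1n.
    have e2 : r%:C ^+ N * (r^-1)%:C ^+ N.-1 = r%:C :> C.
      by rewrite -{1}(prednK n0) exprS -mulrA -exprMn rr expr1n mulr1.
    by rewrite scalerBr scalerA e1 scale1r scalerA e2 addrC subrK.
  have : nrm (a 0) <= r * nrm x + r ^+ N * nrm (a 0).
    move: e; move: (a 0) => A0 e.
    rewrite {1}e; apply: le_trans (hnormD hip _ _) _; rewrite !(hnormZ hip) normcX normcR gtr0_norm //.
    by rewrite lerD2l ler_wpM2l ?exprn_ge0 ?(ltW r0) // contraction_iter.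
  have := hnorm_ge0 (ip := ip) x; have := hnorm_ge0 (ip := ip) (a 0).
  move: rN; move: (r ^+ N) (nrm (a 0)) (nrm x) => t A X; nra.
have -> : avg N (fun j => normc (normalizer ((r%:C * w j)^-1) * ip (resolvent W ((r%:C * w j)^-1) x) y) ^+ 2)
   = \sum_(k < N) normc (ip (a k) y) ^+ 2.
  rewrite (parseval_ip ip N (fun j => conjc (w j)) f y hip hw').
  congr (N%:R^-1 * _); apply: eq_bigr => j _; congr (_ ^+ 2).
  by rewrite -normalizerE.
have -> : (2 * nrm x / Num.sqrt b) ^+ 2 = (2 * nrm x) ^+ 2 / b.
  by rewrite exprMn exprVn sqr_sqrtr // ltW.
rewrite ler_pdivlMr // mulrC.
apply: (@le_trans _ _ (nrm (a 0) ^+ 2)); last first.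
  by rewrite ler_pXn2r ?nnegrE ?hnorm_ge0 // mulr_ge0 ?hnorm_ge0.
apply: le_trans (compressed_sum N (a 0)); rewrite ler_pM2l //; apply: ler_sum => k _.
rewrite rec // (ipZl hip) normcM normcX normcR gtr0_norm // exprMn.
rewrite ler_piMl ?sqr_ge0 // exprn_ile1 ?exprn_ge0 ?exprn_ile1 //; exact: ltW.
Qed.

End Normalizer.

(** * Polynomials of an operator *)

Section PolynomialCalculus.
Context {R : realType} {K : lmodType R[i]} {ip : K -> K -> R[i]}.
Hypothesis hip : is_inner_product ip.
Local Notation C := R[i].
Variables (A : K -> K).
Hypothesis lA : is_linear_map A.

Definition polyop (p : {poly C}) (x : K) : K := \sum_(i < size p) p`_i *: iter i A x.

Lemma polyop_wide n (p : {poly C}) (x : K) : (size p <= n)%N -> polyop p x = \sum_(i < n) p`_i *: iter i A x.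
Proof.
move=> hn; rewrite /polyop (big_ord_widen n (fun i => p`_i *: iter i A x)) //.
rewrite big_mkcond; apply: eq_bigr => i _; case: ltnP => // h.
by rewrite nth_default // scale0r.
Qed.

Lemma polyopD (p q : {poly C}) (x : K) : polyop (p + q) x = polyop p x + polyop q x.
Proof.
rewrite !(polyop_wide (maxn (size p) (size q))) ?leq_maxl ?leq_maxr ?size_polyD //.
by rewrite -big_split; apply: eq_bigr => i _; rewrite coefD scalerDl.
Qed.

Lemma polyopZ (c : C) (p : {poly C}) (x : K) : polyop (c *: p) x = c *: polyop p x.
Proof.
rewrite (polyop_wide (size p)) ?size_scale_leq // scaler_sumr.
by apply: eq_bigr => i _; rewrite coefZ scalerA.
Qed.

Lemma polyopXn n (x : K) : polyop 'X^n x = iter n A x.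
Proof.
rewrite /polyop size_polyXn big_ord_recr /= coefXn eqxx scale1r big1 ?add0r // => i _.
by rewrite coefXn ltn_eqF ?scale0r.
Qed.

Lemma poly_linear_ind (P : {poly C} -> Prop) :
  (forall p q, P p -> P q -> P (p + q)) -> (forall c p, P p -> P (c *: p)) ->
  (forall n, P 'X^n) -> forall p, P p.
Proof.
move=> PD PZ PX p; rewrite -[p]coefK poly_def; apply: (big_ind P) => // [|i _].
  by rewrite -(scale0r ('X^0)); apply: PZ.
exact: PZ.
Qed.

(** [S] is ((p(l) - p(A)) (l - A)^-1 x, y): since l - A divides p(l) - p(A), it is a polynomial in
    [l], and the same one inside and outside the disc. This is the bridge across the circle. *)
Lemma difference_quotient (p : {poly C}) (x y : K) :
  exists S : {poly C}, forall l, resolvable A l ->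
    S.[l] = p.[l] * ip (resolvent A l x) y - ip (resolvent A l (polyop p x)) y.
Proof.
elim/poly_linear_ind: p => [p q [S hS] [T hT]|c p [S hS]|n].
- exists (S + T) => l hl; rewrite !hornerD hS // hT // polyopD.
  by rewrite (linD (resolvent A l)) ?(ipDl hip); [ring | apply: (resolvent_lin hip)].
- exists (c *: S) => l hl; rewrite !hornerZ hS // polyopZ.
  by rewrite (linZ (resolvent A l)) ?(ipZl hip); [ring | apply: (resolvent_lin hip)].
elim: n => [|n [S hS]].
  by exists 0 => l hl; rewrite polyopXn horner0 hornerXn mul1r subrr.
exists (S * 'X + (ip (iter n A x) y)%:P) => l hl.
rewrite hornerD hornerM hornerX hornerC hS // !polyopXn !hornerXn /=.
rewrite -[in ip (iter n A x)](resolventP A l (iter n A x) hl) (resolvent_comm hip) //.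
by rewrite (ipBl hip) (ipZl hip) exprS; ring.
Qed.

End PolynomialCalculus.

(** * The maximum principle with all parameters fixed *)

Section MainInequality.
Context {R : realType} {H K : lmodType R[i]}.
Context {ipH : H -> H -> R[i]} {ipK : K -> K -> R[i]}.
Hypotheses (hH : is_inner_product ipH) (hK : is_inner_product ipK).
Hypotheses (cH : hcomplete ipH) (cK : hcomplete ipK).
Local Notation C := R[i].
Local Notation nH := (hnorm ipH).
Local Notation nK := (hnorm ipK).
Variables (V V' : H -> H) (U U' : K -> K).
Hypotheses (hV : unitary_pair (ip := ipH) V V') (hU : unitary_pair (ip := ipK) U U').
Variables (u v z : H) (x y : K).
Hypothesis hrel : forall l, 1 < normc l ->
  (1 - ipH (resolvent V l u) v) * ipK (resolvent U l x) y = ipH (resolvent V l u) z.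
Variables (a b : R) (Q S : {poly C}) (w : K) (l0 : C).
Hypotheses (a0 : 0 < a) (au : a * nH u ^+ 2 <= 1).
Hypotheses (b0 : 0 < b) (by1 : b * nK y ^+ 2 <= 1).
Hypotheses (l00 : l0 != 0) (l01 : normc l0 < 1).
Hypothesis Q1 : forall t, normc t <= 1 -> normc Q.[t] <= 1.
Hypothesis hS : forall l, 1 < normc l ->
  S.[l] = Q.[l] * (1 + ipK (resolvent U l x) y) - ipK (resolvent U l w) y.

Let hV' := unitary_pair_sym hH V V' hV.
Local Notation G1 := (normalizer (ip := ipH) V' u a).
Local Notation G2 := (normalizer (ip := ipK) U y b).

Let g1 := 1 + a * nH u ^+ 2.
Let g2 := 1 + b * nK y ^+ 2.
(** [A1], [B1] and [C1] are the root mean square bounds of [normalized_mean_square] for the vectors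
    [z - v], [v] and [w]. *)
Let A1 := 2 * nH (z - v) / Num.sqrt a.
Let B1 := 2 * nH v / Num.sqrt a.
Let C1 := 2 * nK w / Num.sqrt b.
(** Bounds the Poisson kernel at every point of modulus at most (1 + |l0|) / 2. *)
Let Pm := 4 / (1 - normc l0).

Section Circle.
Variables (r e : R) (t : C).
Hypotheses (r01 : 0 < r < 1) (t1 : normc t = 1) (e0 : 0 <= e).
Let t0 : t != 0.
Proof. exact: normc1_neq0. Qed.
Let m := (r%:C * t)^-1.
Let l := (r%:C * conjc t)^-1.
Let al := normc (G1 m * ipH (resolvent V' m (z - v)) u).
Let be := normc (G1 m * ipH (resolvent V' m v) u).
Let ga := normc (G2 l * ipK (resolvent U l w) y).

Let conj_l : conjc l = m.
Proof. by rewrite /l /m conjcV conjcM conjcK conjc_real. Qed.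

(** The points r t and l = r^-1 t lie on one ray on either side of the circle. At [l] the product of
    [S] with the determinant is known; moving the polynomial [S] to r t costs [e]. The terms [al],
    [be] and [ga] stay because they are bounded only in mean square. *)
Lemma circle_bound :
  normc (S.[r%:C * t] - S.[l]) <= e -> normc (Q.[l] - Q.[t]) <= e ->
  normc (G1 m - G1 m * ipH (resolvent V' m v) u) * normc (G2 l) * normc S.[r%:C * t] <=
  (1 + e) * (g1 * g2 + g2 * al) + (g1 + be) * ga + (g1 + be) * g2 * e.
Proof.
move=> hSe hQe.
have m1 : 1 < normc m by apply: outer_normc_gt1; rewrite ?t1.
have l1 : 1 < normc l by rewrite -normcJ conj_l.
have rV := unitary_resolvable_gt1 hH _ _ _ cH hV l1.
have rV' : resolvable V' (conjc l).
  by rewrite conj_l; apply: (unitary_resolvable_gt1 hH _ _ _ cH hV').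
have adj s : ipH (resolvent V' m s) u = conjc (ipH (resolvent V l u) s).
  by rewrite (resolvent_adj hH V V') // conj_l -(ipC hH).
set d := 1 - ipH (resolvent V l u) v.
have h1E : normc (G1 m - G1 m * ipH (resolvent V' m v) u) = normc (G1 m) * normc d.
  rewrite -[X in normc (X - _)]mulr1 -mulrBr normcM adj; congr (_ * _).
  by rewrite -normcJ conjcB conjc1 conjcK.
have G1g : normc (G1 m) <= g1 by apply: (normalizer_le hH cH V' V).
have G2g : normc (G2 l) <= g2 by apply: (normalizer_le hK cK U U').
have h1g : normc (G1 m - G1 m * ipH (resolvent V' m v) u) <= g1 + be.
  by apply: le_trans (normcB _ _) _; rewrite lerD2r.
have g20 : 0 <= g2 by have := mulr_ge0 (ltW b0) (sqr_ge0 (nK y)); rewrite /g2; lra.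
have g10 : 0 <= g1 by have := mulr_ge0 (ltW a0) (sqr_ge0 (nH u)); rewrite /g1; lra.
have be0 : 0 <= be by apply: normc_ge0.
have al0 : 0 <= al by apply: normc_ge0.
have ga0 : 0 <= ga by apply: normc_ge0.
have Ql : normc Q.[l] <= 1 + e.
  rewrite -[Q.[l]](subrK Q.[t]) addrC; apply: le_trans (normcD _ _) _.
  by rewrite lerD // Q1 ?t1.
(* By [hrel], d (1 + c) = 1 + ((l - V)^-1 u, z - v): near 1 when [z] is near [v], while [w] small
   makes the last term small. *)
have dS : d * S.[l] = Q.[l] * (1 + ipH (resolvent V l u) (z - v)) - d * ipK (resolvent U l w) y.
  have := hrel l l1; rewrite -/d => dc.
  by rewrite hS // (ipBr hH) -dc /d; ring.
have key : normc (G1 m) * normc d * normc (G2 l) * normc S.[l] <=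
    (1 + e) * (g1 * g2 + g2 * al) + (g1 + be) * ga.
  have -> : normc (G1 m) * normc d * normc (G2 l) * normc S.[l] =
     normc (G2 l) * (normc (G1 m) * normc (d * S.[l])) by rewrite normcM; ring.
  apply: (@le_trans _ _ (normc (G2 l) * (normc (G1 m) *
      (normc Q.[l] * (1 + normc (ipH (resolvent V l u) (z - v))) +
       normc d * normc (ipK (resolvent U l w) y))))).
    rewrite !ler_wpM2l ?normc_ge0 // dS; apply: le_trans (normcB _ _) _.
    rewrite !normcM lerD2r ler_wpM2l ?normc_ge0 //.
    by apply: le_trans (normcD _ _) _; rewrite normc1.
  have -> : normc (G2 l) * (normc (G1 m) *
      (normc Q.[l] * (1 + normc (ipH (resolvent V l u) (z - v))) +
       normc d * normc (ipK (resolvent U l w) y))) =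
     normc Q.[l] * (normc (G1 m) * normc (G2 l) + normc (G2 l) * al) +
     normc (G1 m) * normc d * ga.
    by rewrite /al /ga !normcM adj normcJ; ring.
  rewrite -h1E; apply: lerD; last by apply: ler_pM; rewrite ?normc_ge0.
  apply: ler_pM => //; rewrite ?normc_ge0 ?addr_ge0 ?mulr_ge0 ?normc_ge0 //.
  by apply: lerD; apply: ler_pM; rewrite ?normc_ge0.
rewrite h1E; apply: (@le_trans _ _ (normc (G1 m) * normc d * normc (G2 l) * (normc S.[l] + e))).
  rewrite ler_wpM2l ?mulr_ge0 ?normc_ge0 //.
  by have := normc_subr_ge S.[r%:C * t] S.[l]; lra.
rewrite mulrDr; apply: lerD => //; rewrite -h1E; apply: ler_wpM2r => //.
by apply: ler_pM; rewrite ?normc_ge0.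
Qed.

End Circle.

(** [poisson_submean] for [F] at q = l0 / r. Constant terms meet the kernel through its mass, at
    most 1 + e; mean square terms meet it through its maximum [Pm], with Cauchy-Schwarz for the
    product of [be] and [ga]. *)
Lemma interior_bound :
  normc (G1 l0^-1) * normc (1 - ipH (resolvent V' l0^-1 v) u) *
    normc (G2 (conjc l0^-1)) * normc S.[l0] <=
  g1 * g2 + Pm * (g2 * A1 + g1 * C1 + B1 * C1).
Proof.
have g20 : 1 <= g2 by have := mulr_ge0 (ltW b0) (sqr_ge0 (nK y)); rewrite /g2; lra.
have g10 : 1 <= g1 by have := mulr_ge0 (ltW a0) (sqr_ge0 (nH u)); rewrite /g1; lra.
have A10 : 0 <= A1 by rewrite /A1 divr_ge0 ?mulr_ge0 ?hnorm_ge0 ?sqrtr_ge0.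
have B10 : 0 <= B1 by rewrite /B1 divr_ge0 ?mulr_ge0 ?hnorm_ge0 ?sqrtr_ge0.
have C10 : 0 <= C1 by rewrite /C1 divr_ge0 ?mulr_ge0 ?hnorm_ge0 ?sqrtr_ge0.
have d0 : 0 < 1 - normc l0 by rewrite subr_gt0.
have Pm0 : 0 <= Pm by rewrite /Pm divr_ge0 // ltW.
have l0p := normc_gt0 _ l00.
have [LS LS0 hLS] := horner_dilate S; have [LQ LQ0 hLQ] := horner_dilate Q.
apply: (ler_of_forall_mulle1 _ _ (g1 * g2 *+ 5 + Pm * (g2 * A1 + g2 * B1) + 1)) => e e0 e1.
have den : 0 < LS *+ 3 + LQ *+ 2 + 1 by rewrite ltr_wpDl // addr_ge0 // mulrn_wge0.
(* For r = 1 - s the three entries give r >= 1/2, |q| <= (1 + |l0|) / 2, and dilation errors at most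
   [e], as |r - 1| = s and r^-1 - 1 <= 2 s. *)
pose s := Num.min (2^-1) (Num.min ((1 - normc l0) / 2) (e / (LS *+ 3 + LQ *+ 2 + 1))).
have s0 : 0 < s by rewrite !lt_min invr_gt0 ltr0n /= !divr_gt0.
have s1 : s <= 2^-1 by rewrite ge_min lexx.
have s2 : s <= (1 - normc l0) / 2 by rewrite !ge_min lexx orbT.
have s3 : s * (LS *+ 3 + LQ *+ 2 + 1) <= e by rewrite -ler_pdivlMr // !ge_min lexx !orbT.
pose r := 1 - s; have r12 : 2^-1 <= r by rewrite /r; lra.
have r0 : 0 < r by lra.
have r1 : r < 1 by rewrite /r; lra.
have r01 : 0 < r < 1 by rewrite r0.
pose q := l0 / r%:C.
have rC : r%:C != 0 :> C by rewrite real_complex_eq0 gt_eqF.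
have q0 : q != 0 by rewrite mulf_neq0 ?invr_eq0.
have rq : r%:C * q = l0 by rewrite mulrC divfK.
have nq : normc q = normc l0 / r by rewrite normcM normcV normcR gtr0_norm.
have q12 : normc q <= (1 + normc l0) / 2.
  rewrite nq ler_pdivrMr // /r; nra.
have q1 : normc q < 1 by lra.
have PmP t : normc t = 1 -> poisson q t <= Pm.
  move=> t1; apply: le_trans (poisson_le _ q1 _ t1) _.
  by rewrite ler_pdivrMr ?subr_gt0 // /Pm mulrAC ler_pdivlMr //; lra.
(* Analytic in [t]: the determinant is written with the adjoint [V'], and the normalizer of [U] is
   conjugated both in its argument and in its value. *)
pose F t := (G1 (r%:C * t)^-1 - G1 (r%:C * t)^-1 * ipH (resolvent V' (r%:C * t)^-1 v) u) *
  conjc (G2 (r%:C * conjc t)^-1) * S.[r%:C * t].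
have dF : disc_algebra F.
  have h1 := disc_algebra_normalizer hH cH V' V u a hV' a0 au r r01.
  have h2 := disc_algebra_normalized hH cH V' V u a hV' a0 au r v r01.
  have h3 := disc_algebraJ _ (disc_algebra_normalizer hK cK U U' y b hU b0 by1 r r01).
  have h4 := disc_algebraD _ _ h1 (disc_algebraM _ _ (disc_algebra_poly (-1)%:P) h2).
  have h5 := disc_algebraM _ _ (disc_algebraM _ _ h4 h3) (disc_algebra_poly (S \Po (r%:C *: 'X))).
  apply: disc_algebra_ext h5 => t _ _.
  by rewrite /F horner_comp hornerZ hornerX hornerC mulN1r.
have [N1 H1] := poisson_submean q q1 F e dF q0 e0.
have [N2 H2] := poisson_mass q q1 e e0.
have [N3 H3] := normalized_mean_square hH cH V' V u a hV' a0 au r r01.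
have [N4 H4] := normalized_mean_square hK cK U U' y b hU b0 by1 r r01.
have [N [hN [om hom]]] := @root_family_exists R (N1 + (N2 + (N3 + N4))).
have Na : (0 < N)%N by case: hom.
have {}H1 := H1 N om (leq_trans (leq_addr _ _) hN) hom.
have {}hN := leq_trans (leq_addl _ _) hN.
have {}H2 := H2 N om (leq_trans (leq_addr _ _) hN) hom.
have {}hN := leq_trans (leq_addl _ _) hN.
have {}H3 := H3 N om (leq_trans (leq_addr _ _) hN) hom.
have {}hN := leq_trans (leq_addl _ _) hN.
have {}H4 := H4 N _ hN (root_family_conj N om hom).
pose m j := (r%:C * om j)^-1; pose l j := (r%:C * conjc (om j))^-1.
pose al j := normc (G1 (m j) * ipH (resolvent V' (m j) (z - v)) u).
pose be j := normc (G1 (m j) * ipH (resolvent V' (m j) v) u).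
pose ga j := normc (G2 (l j) * ipK (resolvent U (l j) w) y).
have om1 j : normc (om j) = 1 := root_family_normc N om j hom.
have lE j : l j = (r^-1)%:C * om j.
  rewrite /l invfM fmorphV; congr (_ * _); apply: (mulIf (x := conjc (om j))).
    by rewrite conjc_eq0 normc1_neq0.
  rewrite (root_family_mulJ N om j hom) mulVf // conjc_eq0.
  exact: normc1_neq0.
have rV : r^-1 <= 2 by rewrite -[2]invrK lef_pV2 // posrE // invr_gt0.
have rs : r^-1 - 1 <= s *+ 2.
  have -> : r^-1 - 1 = s * r^-1 by rewrite (_ : s = 1 - r) /r; [field; rewrite gt_eqF | ring].
  by rewrite -mulr_natr ler_pM2l.
have ri1 : 1 <= r^-1 by rewrite invf_ge1 // ltW.
have hSe j : normc (S.[r%:C * om j] - S.[l j]) <= e.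
  have -> : S.[r%:C * om j] - S.[l j] =
     (S.[r%:C * om j] - S.[om j]) - (S.[(r^-1)%:C * om j] - S.[om j]) by rewrite lE; ring.
  apply: le_trans (normcB _ _) _; apply: le_trans (lerD (hLS r _ _ (om1 j)) (hLS (r^-1) _ _ (om1 j))) _.
  - by rewrite ltW //= (le_trans (ltW r1)) // ler1n.
  - by rewrite rV andbT (le_trans ler01).
  rewrite ler0_norm ?subr_le0 ?(ltW r1) // [X in _ + _ * X]ger0_norm ?subr_ge0 //.
  by apply: le_trans s3; rewrite /r; move: rs LS0 LQ0 s0; move: (r^-1) => ri; nra.
have hQe j : normc (Q.[l j] - Q.[om j]) <= e.
  rewrite lE; apply: le_trans (hLQ (r^-1) _ _ (om1 j)) _; first by rewrite rV andbT (le_trans ler01).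
  rewrite ger0_norm ?subr_ge0 //.
  by apply: le_trans s3; move: rs LS0 LQ0 s0; move: (r^-1) => ri; nra.
have circ j : normc (F (om j)) <=
    (1 + e) * (g1 * g2 + g2 * al j) + (g1 + be j) * ga j + (g1 + be j) * g2 * e.
  rewrite /F !normcM normcJ.
  exact: (circle_bound r e (om j) r01 (om1 j) (ltW e0) (hSe j) (hQe j)).
have al0 j : 0 <= al j by apply: normc_ge0.
have be0 j : 0 <= be j by apply: normc_ge0.
have ga0 j : 0 <= ga j by apply: normc_ge0.
have aval : avg N al <= A1 by apply: avg_le_sqrt => //; apply: H3.
have avbe : avg N be <= B1 by apply: avg_le_sqrt => //; apply: H3.
have avga : avg N ga <= C1 by apply: avg_le_sqrt => //; apply: H4.
have avbg : avg N (fun j => be j * ga j) <= B1 * C1.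
  by apply: avg_cauchy_schwarz => //; [apply: H3 | apply: H4].
have Fq : normc (F q) = normc (G1 l0^-1) * normc (1 - ipH (resolvent V' l0^-1 v) u) *
    normc (G2 (conjc l0^-1)) * normc S.[l0].
  rewrite /F rq -[X in X - _]mulr1 -mulrBr !normcM normcJ; congr (_ * _ * normc (G2 _) * _).
  have e' : conjc l0 = r%:C * conjc q by rewrite -{1}rq [LHS]conjcM [X in X * _]conjc_real.
  by rewrite conjcV e'.
rewrite -Fq; apply: le_trans H1 _.
have g2p : 0 <= g2 by apply: le_trans g20.
have g1p : 0 <= g1 by apply: le_trans g10.
have ep1 : 0 <= 1 + e by rewrite addr_ge0 ?(ltW e0).
have majo j : poisson q (om j) * normc (F (om j)) <=
   (((1 + e) * (g1 * g2) + g1 * g2 * e) * poisson q (om j)) +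
   Pm * ((1 + e) * g2 * al j + (g1 * ga j + (be j * ga j + g2 * e * be j))).
  apply: le_trans (ler_wpM2l (poisson_ge0 _ q1 _) (circ j)) _.
  have -> : (1 + e) * (g1 * g2 + g2 * al j) + (g1 + be j) * ga j + (g1 + be j) * g2 * e =
    ((1 + e) * (g1 * g2) + g1 * g2 * e) +
    ((1 + e) * g2 * al j + (g1 * ga j + (be j * ga j + g2 * e * be j))) by ring.
  rewrite mulrDr [poisson _ _ * (_ + g1 * g2 * e)]mulrC lerD2l ler_wpM2r ?PmP //.
  exact: addr_ge0 (mulr_ge0 (mulr_ge0 ep1 g2p) (al0 j)) (addr_ge0 (mulr_ge0 g1p (ga0 j))
    (addr_ge0 (mulr_ge0 (be0 j) (ga0 j)) (mulr_ge0 (mulr_ge0 g2p (ltW e0)) (be0 j)))).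
apply: le_trans (lerD (avg_le _ _ _ majo) (lexx _)) _.
rewrite avgD (avgZ _ _ (fun j => poisson q (om j))).
move: H2; move: (avg N (fun j => poisson q (om j))) => ap H2.
rewrite avgZ !avgD !avgZ.
have k1 : ((1 + e) * (g1 * g2) + g1 * g2 * e) * ap <=
   (g1 * g2) * (1 + e *+ 5).
  apply: (@le_trans _ _ (((1 + e) * (g1 * g2) + g1 * g2 * e) * (1 + e))).
    apply: ler_wpM2l H2; exact: addr_ge0 (mulr_ge0 ep1 (mulr_ge0 g1p g2p))
      (mulr_ge0 (mulr_ge0 g1p g2p) (ltW e0)).
  have -> : ((1 + e) * (g1 * g2) + g1 * g2 * e) * (1 + e) = g1 * g2 * ((1 + e *+ 2) * (1 + e)) by ring.
  apply: ler_wpM2l; [exact: mulr_ge0 | nra].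
have k2 : (1 + e) * g2 * avg N al + (g1 * avg N ga + (avg N (fun j => be j * ga j) + g2 * e * avg N be))
   <= (1 + e) * g2 * A1 + (g1 * C1 + (B1 * C1 + g2 * e * B1)).
  apply: lerD; first exact: ler_wpM2l (mulr_ge0 ep1 g2p) _ _ aval.
  apply: lerD; first exact: ler_wpM2l g1p _ _ avga.
  exact: lerD avbg (ler_wpM2l (mulr_ge0 g2p (ltW e0)) avbe).
have k3 := ler_wpM2l Pm0 k2.
apply: le_trans (lerD (lerD k1 k3) (lexx _)) _; rewrite le_eqVlt; apply/orP; left; apply/eqP.
ring.
Qed.

End MainInequality.

(** * The determinant at reflected points: the four limits *)

Section PerturbationDeterminant.
Context {R : realType} {H K : lmodType R[i]}.
Context {ipH : H -> H -> R[i]} {ipK : K -> K -> R[i]}.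
Hypotheses (hH : is_inner_product ipH) (hK : is_inner_product ipK).
Hypotheses (cH : hcomplete ipH) (cK : hcomplete ipK).
Local Notation C := R[i].
Local Notation nH := (hnorm ipH).
Local Notation nK := (hnorm ipK).
Variables (V V' : H -> H) (U U' : K -> K).
Hypotheses (hV : unitary_pair (ip := ipH) V V') (hU : unitary_pair (ip := ipK) U U').
Variables (u v : H) (X : H -> K) (X' : K -> H).
Hypotheses (lX : is_linear_map X) (adX : forall x y, ipK (X x) y = ipH x (X' y)).
Hypothesis X'dense : forall h e, 0 < e -> exists y, nH (h - X' y) < e.
Hypothesis hXT : forall x, X (V x + ipH x v *: u) = U (X x).
Hypothesis hsing : forall l0 e, normc l0 < 1 -> 0 < e -> exists Q : {poly C},
  [/\ forall t, normc t <= 1 -> normc Q.[t] <= 1, normc (Q.[l0] - 1) <= e &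
      nK (polyop U Q (X u)) <= e].

(** The determinant of (l - T) (l - V)^-1, which is the identity minus the rank one operator x |->
    ((l - V)^-1 x, v) u. *)
Definition perturbation_det (l : C) : C := 1 - ipH (resolvent V l u) v.
Local Notation d := perturbation_det.

Let lU : is_linear_map U. Proof. by case: hU. Qed.

Lemma intertwined_resolvent l : resolvable V l -> resolvable U l ->
  d l *: resolvent U l (X u) = X (resolvent V l u).
Proof.
move=> rV rU; set p := resolvent V l u.
have lR := resolvent_lin hK _ _ lU rU.
rewrite -(linZ _ _ _ lR); apply: (resolventE hK) => //.
rewrite -hXT -!(linZ X) // -(linB X) //; congr X.
have := resolventP V l u rV; rewrite /d -/p => e.
have -> : l *: p - (V p + ipH p v *: u) = (l *: p - V p) - ipH p v *: u by hring hH.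
by rewrite e; hring hH.
Qed.

Lemma det_mul_cauchy l y : resolvable V l -> resolvable U l ->
  d l * ipK (resolvent U l (X u)) y = ipH (resolvent V l u) (X' y).
Proof. by move=> rV rU; rewrite -adX -(intertwined_resolvent l) // (ipZl hK). Qed.

Section InnerPoint.
Variable l0 : C.
Hypotheses (l00 : l0 != 0) (l01 : normc l0 < 1).
Let m := l0^-1.
Let hV' := unitary_pair_sym hH V V' hV.
(** The conjugate of the determinant at 1 / conj l0, written with [V'] so that it depends
    analytically on l0. *)
Let ds := 1 - ipH (resolvent V' m v) u.
Let Pm := 4 / (1 - normc l0).
Local Notation G1 a := (normc (normalizer (ip := ipH) V' u a m)).
Local Notation G2 y b := (normc (normalizer (ip := ipK) U y b (conjc m))).
Local Notation c y := (ipK (resolvent U l0 (X u)) y).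

Let m1 : 1 < normc m. Proof. by rewrite normcV invf_gt1 // normc_gt0. Qed.
Let rV0 : resolvable V l0.
Proof. by apply: (unitary_resolvable hH V V') => //; rewrite lt_eqF. Qed.
Let rU0 : resolvable U l0.
Proof. by apply: (unitary_resolvable hK U U') => //; rewrite lt_eqF. Qed.

(** Limit in the error [e] of [Q], with [a], [b] and [y] fixed: Q(U) X u tends to 0 and kills the
    terms with [C1], and S(l0) tends to 1 + c(l0). *)
Lemma det_bound1 a b y : 0 < a -> a * nH u ^+ 2 <= 1 -> 0 < b -> b * nK y ^+ 2 <= 1 ->
  G1 a * normc ds * G2 y b * normc (1 + c y) <=
  (1 + a * nH u ^+ 2) * (1 + b * nK y ^+ 2) +
  Pm * ((1 + b * nK y ^+ 2) * (2 * nH (X' y - v) / Num.sqrt a)).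
Proof.
move=> a0 au b0 yb; set g1 := 1 + a * _; set g2 := 1 + b * _; set A1 := 2 * _ / _.
set L := G1 a * normc ds * G2 y b.
have L0 : 0 <= L by rewrite !mulr_ge0 ?normc_ge0.
have d0 : 0 < 1 - normc l0 by rewrite subr_gt0.
have Pm0 : 0 <= Pm by rewrite divr_ge0 // ltW.
pose B1 := 2 * nH v / Num.sqrt a.
have B10 : 0 <= B1 by rewrite divr_ge0 ?mulr_ge0 ?hnorm_ge0 ?sqrtr_ge0.
have g10 : 0 <= g1 by have := mulr_ge0 (ltW a0) (sqr_ge0 (nH u)); rewrite /g1; lra.
have sb : 0 < Num.sqrt b by rewrite sqrtr_gt0.
apply: (ler_of_forall_mulgt _ _
  (Pm * ((g1 + B1) * (2 / Num.sqrt b)) + L * (normc (1 + c y) + nK y / (1 - normc l0)))) => e e0.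
have [Q [Q1 Ql Qw]] := hsing l0 e l01 e0.
have [S0 hS0] := difference_quotient hK U lU Q (X u) y.
pose w := polyop U Q (X u).
have hS l : resolvable U l -> (S0 + Q).[l] =
    Q.[l] * (1 + ipK (resolvent U l (X u)) y) - ipK (resolvent U l w) y.
  by move=> hl; rewrite hornerD hS0 //; rewrite -/w; ring.
have hrel l : 1 < normc l -> (1 - ipH (resolvent V l u) v) * ipK (resolvent U l (X u)) y =
    ipH (resolvent V l u) (X' y).
  move=> l1; apply: det_mul_cauchy.
    exact: (unitary_resolvable_gt1 hH _ _ _ cH hV l1).
  exact: (unitary_resolvable_gt1 hK _ _ _ cK hU l1).
have hSo l : 1 < normc l -> (S0 + Q).[l] =
    Q.[l] * (1 + ipK (resolvent U l (X u)) y) - ipK (resolvent U l w) y.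
  move=> l1; apply: hS.
  exact: (unitary_resolvable_gt1 hK _ _ _ cK hU l1).
have := interior_bound hH hK cH cK V V' U U' hV hU u v (X' y) (X u) y hrel a b Q (S0 + Q) w l0
  a0 au b0 yb l00 l01 Q1 hSo.
rewrite -/m -/ds -/L -/g1 -/g2 -/A1 -/B1 -/Pm.
set C1 := 2 * nK w / _ => main.
have C1e : C1 <= 2 / Num.sqrt b * e by rewrite /C1 mulrAC; apply: ler_wpM2l; rewrite ?divr_ge0 // ltW.
have Slow : normc (1 + c y) - e * (normc (1 + c y) + nK y / (1 - normc l0)) <= normc (S0 + Q).[l0].
  rewrite hS // mulrDr [e * (_ / _)]mulrCA opprD addrA.
  have e1 : Q.[l0] * (1 + c y) - ipK (resolvent U l0 w) y =
    (1 + c y) - ((1 - Q.[l0]) * (1 + c y) + ipK (resolvent U l0 w) y) by ring.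
  rewrite e1; apply: le_trans (normc_subr_ge _ _); rewrite -addrA -opprD lerD2l lerN2.
  apply: le_trans (normcD _ _) _; apply: lerD.
    by rewrite normcM ler_wpM2r ?normc_ge0 // normc_subC.
  apply: le_trans (cauchy_schwarz hK _ _) _; rewrite mulrC ler_wpM2l ?hnorm_ge0 //.
  apply: le_trans (unitary_resolvent_le hK U U' _ _ cK hU l00 l01) _.
  by rewrite ler_pM2r ?invr_gt0.
have h1 := ler_wpM2l L0 Slow.
have h2 : Pm * ((g1 + B1) * C1) <= Pm * ((g1 + B1) * (2 / Num.sqrt b * e)).
  by rewrite !ler_wpM2l // addr_ge0.
move: h1 h2 main; rewrite !mulrBr !mulrDr !mulrDl.
lra.
Qed.

Let k := (normc m - 1)^-1.
Let k0 : 0 < k. Proof. by rewrite invr_gt0 subr_gt0. Qed.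

(** Limit b -> 0 with [y] fixed. The term with 1 / sqrt b is already gone, so the normalizer of [U]
    can be let tend to 1. *)
Lemma det_bound2 a y : 0 < a -> a * nH u ^+ 2 <= 1 ->
  G1 a * normc ds * normc (1 + c y) <=
  1 + a * nH u ^+ 2 + Pm * (2 * nH (X' y - v) / Num.sqrt a).
Proof.
move=> a0 au; set A1 := 2 * _ / _; set L := G1 a * _ * _; set g := 1 + _ + _.
apply: (ler_of_forall_mulle1 _ _ (L * k + g)) => e e0 e1.
have y1 : 0 < nK y ^+ 2 + 1 by rewrite ltr_wpDl ?sqr_ge0.
pose b := e / (nK y ^+ 2 + 1); have b0 : 0 < b by rewrite divr_gt0.
have yb : b * nK y ^+ 2 <= e.
  by rewrite /b mulrAC ler_pdivrMr // ler_pM2l // lerDl.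
have := det_bound1 a b y a0 au b0 (le_trans yb e1).
rewrite mulrAC -/L -/A1 => main.
have cm1 : 1 < normc (conjc m) by rewrite normcJ.
have G2l : 1 - e * k <= G2 y b.
  have := normalizer_sub1 hK cK U U' y b hU b0 (le_trans yb e1) _ cm1; rewrite normcJ -/k => h.
  have h' : normc (normalizer (ip := ipK) U y b (conjc m) - 1) <= e * k.
    by apply: le_trans h _; rewrite ler_wpM2r // ltW.
  have := normc_subr_ge 1 (normalizer (ip := ipK) U y b (conjc m)).
  by rewrite normc1 normc_subC; lra.
have L0 : 0 <= L by rewrite !mulr_ge0 ?normc_ge0.
have h1 := ler_wpM2l L0 G2l.
have A10 : 0 <= A1 by rewrite divr_ge0 ?mulr_ge0 ?hnorm_ge0 ?sqrtr_ge0.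
have Pm0 : 0 <= Pm by rewrite divr_ge0 // ltW // subr_gt0.
have g0 : 0 <= g by rewrite /g !addr_ge0 // mulr_ge0 ?sqr_ge0 // ltW.
have h2 : (1 + b * nK y ^+ 2) * g <= (1 + e) * g by rewrite ler_wpM2r // lerD2l.
have e2 : (1 + a * nH u ^+ 2) * (1 + b * nK y ^+ 2) + Pm * ((1 + b * nK y ^+ 2) * A1)
  = (1 + b * nK y ^+ 2) * g by rewrite /g; ring.
rewrite e2 in main; have := le_trans h1 (le_trans main h2).
by move: (L) (g) => L1 g1; lra.
Qed.

(** Limit X' y -> v with [a] fixed, so that |X' y - v| / sqrt a tends to 0. Multiplying by d(l0)
    first turns 1 + c into a quantity tending to 1, though c itself depends on [y]. *)
Lemma det_bound3 a : 0 < a -> a * nH u ^+ 2 <= 1 ->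
  G1 a * normc ds <= (1 + a * nH u ^+ 2) * normc (d l0).
Proof.
move=> a0 au; set L := G1 a * _; set g := 1 + _.
have sa : 0 < Num.sqrt a by rewrite sqrtr_gt0.
have Pm0 : 0 <= Pm by rewrite divr_ge0 // ltW // subr_gt0.
have d0 : 0 < 1 - normc l0 by rewrite subr_gt0.
have L0 : 0 <= L by rewrite !mulr_ge0 ?normc_ge0.
apply: (ler_of_forall_mulgt _ _ (L * (nH u / (1 - normc l0)) + normc (d l0) * (Pm * (2 / Num.sqrt a)))).
move=> e e0; have [y hy] := X'dense v e e0.
have := det_bound2 a y a0 au; rewrite -/L -/g => main.
have ey : nH (X' y - v) <= e by rewrite (hnorm_subC hH) ltW.
have h1 : Pm * (2 * nH (X' y - v) / Num.sqrt a) <= Pm * (2 / Num.sqrt a) * e.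
  by rewrite -[X in _ <= X]mulrA ler_wpM2l // mulrAC ler_wpM2l // divr_ge0 // ltW.
have dc : normc (d l0) * normc (1 + c y) >= 1 - nH u / (1 - normc l0) * e.
  rewrite -normcM mulrDr mulr1 det_mul_cauchy //.
  have -> : d l0 + ipH (resolvent V l0 u) (X' y) = 1 - ipH (resolvent V l0 u) (v - X' y).
    by rewrite /d (ipBr hH); ring.
  apply: le_trans (normc_subr_ge _ _); rewrite normc1 lerD2l lerN2.
  apply: le_trans (cauchy_schwarz hH _ _) _; apply: ler_pM; rewrite ?hnorm_ge0 //; last exact: ltW.
  exact: (unitary_resolvent_le hH V V').
have h2 := ler_wpM2l L0 dc.
have h3 := ler_wpM2l (normc_ge0 (d l0)) main.
have h4 := ler_wpM2l (normc_ge0 (d l0)) h1.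
move: h2 h3 h4; move: (Pm * (2 * _ / _)) (Pm * (2 / _)) (nH u / _) (normc (1 + _)) => P' Pk q E.
by move: (normc (d l0)) (L) (g) => D L' g'; lra.
Qed.

(** Limit a -> 0, which removes the normalizer of [V']. *)
Lemma det_reflection : normc ds <= normc (d l0).
Proof.
apply: (ler_of_forall_mulle1 _ _ (normc ds * k + normc (d l0))) => e e0 e1.
have u1 : 0 < nH u ^+ 2 + 1 by rewrite ltr_wpDl ?sqr_ge0.
pose a := e / (nH u ^+ 2 + 1); have a0 : 0 < a by rewrite divr_gt0.
have ua : a * nH u ^+ 2 <= e.
  by rewrite /a mulrAC ler_pdivrMr // ler_pM2l // lerDl.
have main := det_bound3 a a0 (le_trans ua e1).
have G1l : 1 - e * k <= G1 a.
  have := normalizer_sub1 hH cH V' V u a hV' a0 (le_trans ua e1) _ m1; rewrite -/k => h.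
  have h' : normc (normalizer (ip := ipH) V' u a m - 1) <= e * k.
    by apply: le_trans h _; rewrite ler_wpM2r // ltW.
  have := normc_subr_ge 1 (normalizer (ip := ipH) V' u a m).
  by rewrite normc1 normc_subC; lra.
have h1 := ler_wpM2r (normc_ge0 ds) G1l.
have h2 : (1 + a * nH u ^+ 2) * normc (d l0) <= (1 + e) * normc (d l0).
  by rewrite ler_wpM2r ?normc_ge0 // lerD2l.
move: h1 h2 main; rewrite mulrBl !mulrDl !mul1r; lra.
Qed.

Lemma det_inside_outside : normc (d (conjc l0)^-1) <= normc (d l0).
Proof.
apply: le_trans det_reflection; rewrite le_eqVlt; apply/orP; left; apply/eqP.
have cm : conjc m = (conjc l0)^-1 by rewrite /m conjcV.
have cm1 : 1 < normc (conjc m) by rewrite normcJ.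
rewrite -cm -normcJ /d /ds conjcB conjc1 (resolvent_adj hH V V') // ?conjcK -?(ipC hH) //.
  exact: (unitary_resolvable_gt1 hH _ _ _ cH hV cm1).
exact: (unitary_resolvable_gt1 hH _ _ _ cH hV' m1).
Qed.

End InnerPoint.

End PerturbationDeterminant.
(** * Singular spectral measures *)

Section CircleExponential.
Context {R : realType}.
Local Notation C := R[i].

Definition expi (t : R) : C := cos t +i* sin t.

Lemma normc_expi t : normc (expi t) = 1.
Proof. by rewrite /expi /= cos2Dsin2 sqrtr1. Qed.

Lemma expiX n t : expi t ^+ n = expi (n%:R * t).
Proof.
elim: n => [|n IH]; first by rewrite expr0 mul0r /expi cos0 sin0.
rewrite exprS IH -natr1 mulrDl mul1r addrC /expi cosD sinD.
by apply/eqP; rewrite eq_complex /=; apply/andP; split; apply/eqP; ring.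
Qed.

Lemma conjc_expi t : conjc (expi t) * expi t = 1.
Proof. by rewrite mulrC normc_mulJ normc_expi expr1n. Qed.

Lemma lipschitz_of_derive (f df : R -> R) : (forall x : R, is_derive x (1 : R) f (df x)) ->
  (forall x, `|df x| <= 1) -> continuous f -> forall s t : R, s <= t -> `|f t - f s| <= t - s.
Proof.
move=> hf hdf cf s t st.
have [|c _ ->] := MVT_segment st (fun x _ => hf x); first exact: continuous_subspaceT.
by rewrite normrM (ger0_norm (_ : 0 <= t - s)) ?subr_ge0 // ler_piMl // subr_ge0.
Qed.

Lemma normc_le_abs (z : C) : normc z <= `|Re z| + `|Im z|.
Proof.
case: z => x y; have -> : x +i* y = x%:C + 'i * y%:C by rewrite [LHS]complexE.
apply: le_trans (normcD _ _) _; rewrite normcM !normcR /= expr0n /= expr1n add0r sqrtr1 mul1r.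
by rewrite !(mul0r, mul1r, addr0, subr0, add0r).
Qed.

Lemma expi_dist s t : s <= t -> normc (expi t - expi s) <= 2 * (t - s).
Proof.
move=> st; apply: le_trans (normc_le_abs _) _; rewrite mulr_natl mulr2n; apply: lerD => /=.
  apply: (lipschitz_of_derive (@cos R) (fun x => - sin x)) => // [x|]; last exact: continuous_cos.
  by rewrite normrN sin_max.
apply: (lipschitz_of_derive (@sin R) (@cos R)) => // [x|]; last exact: continuous_sin.
by rewrite cos_max.
Qed.

(** A Taylor polynomial of (1 - z) / (1 + d - z), which is bounded by 1 on the disc, vanishes at 1
    and is close to 1 far from 1 on the scale [d]. Dividing by 1 + h restores the bound 1 after a
    truncation error [h]. *)
Lemma notch_polynomial (d eta : R) : 0 < d -> 0 < eta -> exists p : {poly C},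
  [/\ forall z, normc z <= 1 -> normc p.[z] <= 1,
      forall z, normc z <= 1 -> normc p.[z] <= normc (1 - z) / d + eta &
      forall z, normc z < 1 -> normc (p.[z] - 1) <= d / (1 - normc z) + 2 * eta].
Proof.
move=> d0 eta0; pose D : R := 1 + d; have D1 : 1 < D by rewrite ltrDl.
have D0 : 0 < D by apply: lt_trans D1.
have Di : 0 <= D^-1 < 1 by rewrite invr_ge0 ltW //= invf_lt1.
have [n hn] := geometric_lt 1 _ _ Di eta0; have {hn} := hn n (leqnn n).
rewrite mul1r; set h := D^-1 ^+ n => hh.
have h0 : 0 <= h by rewrite exprn_ge0 // invr_ge0 ltW.
pose f (z : C) := (1 - z) / (D%:C - z).
have den z : normc z <= 1 -> d <= normc (D%:C - z).
  move=> z1; apply: le_trans (normc_subr_ge _ _); rewrite normcR gtr0_norm // /D; lra.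
have nz z : normc z <= 1 -> D%:C - z != 0.
  move=> /den hz; apply: contraTneq hz => ->; rewrite normc0 -ltNge //.
have DC : D%:C != 0 :> C by rewrite real_complex_eq0 gt_eqF.
pose P : {poly C} := 1%:P - (d / D)%:C *: \sum_(k < n) (D^-1 ^+ k)%:C *: 'X^k.
have PE z : normc z <= 1 -> P.[z] = f z + d%:C / (D%:C - z) * (z / D%:C) ^+ n.
  move=> z1; rewrite /P hornerD hornerN hornerZ hornerC horner_sum.
  have -> : \sum_(k < n) ((D^-1 ^+ k)%:C *: 'X^k).[z] = \sum_(k < n) (z / D%:C) ^+ k.
    apply: eq_bigr => k _; rewrite hornerZ hornerXn exprMn mulrC; congr (_ * _).
    by rewrite rmorphXn fmorphV.
  have e := subrX1 (z / D%:C) n; have zD := nz z z1.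
  have zD1 : z / D%:C - 1 != 0.
    by rewrite subr_eq0; apply: contra zD => /eqP h1; rewrite -[z](divfK DC) h1 mul1r subrr.
  have -> : \sum_(k < n) (z / D%:C) ^+ k = ((z / D%:C) ^+ n - 1) / (z / D%:C - 1).
    by apply: (canRL (mulfK zD1)); rewrite mulrC -e.
  have dD : (d / D)%:C = d%:C / D%:C :> C by rewrite rmorphM fmorphV.
  have DE : D%:C = 1 + d%:C :> C by rewrite rmorphD rmorph1.
  rewrite dD /f.
  have -> : z / D%:C - 1 = - ((D%:C - z) / D%:C) by field.
  have -> : d%:C = D%:C - 1 :> C by rewrite DE addrC addKr.
  by field; rewrite DC zD.
have f1 z : normc z <= 1 -> normc (f z) <= 1.
  move=> z1; rewrite normcM normcV ler_pdivrMr ?mul1r; last exact: lt_le_trans d0 (den z z1).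
  rewrite -(@ler_pXn2r _ 2) ?nnegrE ?normc_ge0 // !normc_sqr /D.
  have : Re z <= 1 by apply: le_trans (Re_le_normc z) z1.
  by case: z {z1} => a b /=; nra.
have fd z : normc z <= 1 -> normc (f z) <= normc (1 - z) / d.
  move=> z1; rewrite normcM normcV ler_wpM2l ?normc_ge0 // lef_pV2 ?posrE ?den //.
  exact: lt_le_trans d0 (den z z1).
have Pf z : normc z <= 1 -> normc (P.[z] - f z) <= h.
  move=> z1; rewrite PE // addrAC subrr add0r normcM normcX -[h]mul1r.
  have dz := lt_le_trans d0 (den z z1).
  apply: ler_pM; rewrite ?exprn_ge0 ?normc_ge0 //.
    by rewrite normcM normcV normcR gtr0_norm // ler_pdivrMr // mul1r den.
  rewrite /h; apply: lerXn2r; rewrite ?nnegrE ?normc_ge0 ?invr_ge0 ?(ltW D0) //.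
  by rewrite normcM normcV normcR gtr0_norm // ler_piMl // invr_ge0 ltW.
have h1 : 0 < 1 + h by rewrite ltr_wpDr.
have normP z : normc (((1 + h)^-1)%:C *: P).[z] = normc P.[z] / (1 + h).
  by rewrite hornerZ normcM normcR gtr0_norm ?invr_gt0 // mulrC.
have hb z : normc z <= 1 -> normc P.[z] <= normc (f z) + h.
  by move=> z1; have := normc_subr_ge P.[z] (f z); have := Pf z z1; lra.
exists (((1 + h)^-1)%:C *: P); split=> [z z1|z z1|z z1].
- by rewrite normP ler_pdivrMr // mul1r; have := hb z z1; have := f1 z z1; lra.
- rewrite normP ler_pdivrMr //; have := hb z z1; have := fd z z1.
  have t0 : 0 <= normc (1 - z) / d by rewrite divr_ge0 ?normc_ge0 // ltW.
  by move: t0 hh h0 eta0; move: (_ / d) => t; nra.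
have z1' := ltW z1; have q0 : 0 < 1 - normc z by rewrite subr_gt0.
have -> : (((1 + h)^-1)%:C *: P).[z] - 1 = ((1 + h)^-1)%:C * ((P.[z] - f z) + (f z - 1) - h%:C).
  have hC : 1 + h%:C != 0 :> C by rewrite -(rmorph1 (real_complex R)) -rmorphD real_complex_eq0 gt_eqF.
  by rewrite hornerZ fmorphV rmorphD rmorph1; field.
have f1z : normc (f z - 1) <= d / (1 - normc z).
  have -> : f z - 1 = - (d%:C / (D%:C - z)).
    rewrite /f (_ : d%:C = D%:C - 1); first by field; exact: nz.
    by rewrite /D rmorphD rmorph1 addrC addKr.
  rewrite normcN normcM normcV normcR gtr0_norm // ler_pM2l // lef_pV2 ?posrE //.
    by apply: le_trans (normc_subr_ge _ _); rewrite normcR gtr0_norm // /D; lra.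
  exact: lt_le_trans d0 (den z z1').
rewrite normcM normcR gtr0_norm ?invr_gt0 // mulrC ler_pdivrMr //.
have : normc (P.[z] - f z + (f z - 1) - h%:C) <= h + d / (1 - normc z) + h.
  apply: le_trans (normcB _ _) _; rewrite normcR (ger0_norm h0) lerD2r.
  by apply: le_trans (normcD _ _) _; rewrite lerD ?Pf.
have t0 : 0 <= d / (1 - normc z) by rewrite divr_ge0 // ltW.
by move: t0 hh h0 eta0; move: (d / _) (normc (_ - _)) => t s; nra.
Qed.

(** One notch of width [A * l k] rotated to each e^(i s_k). The k-th arc stays within 2 l_k of the
    centre of its notch, whence 2 / A; the other factors are at most 1, and the deviations from 1 at
    l0 add up. *)
Lemma notch_product (n : nat) (s l : nat -> R) (l0 : C) (A eta : R) :
  normc l0 < 1 -> 0 < A -> 0 < eta -> (forall k, 0 < l k) ->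
  exists Q : {poly C}, [/\ forall z, normc z <= 1 -> normc Q.[z] <= 1,
    normc (Q.[l0] - 1) <= A / (1 - normc l0) * \sum_(k < n) l k + n%:R * (2 * eta) &
    forall k t, (k < n)%N -> s k <= t <= s k + l k -> normc Q.[expi t] <= 2 / A + eta].
Proof.
move=> l01 A0 eta0 lpos; elim: n => [|n [Q [Q1 Ql Qt]]].
  exists 1; split=> [z _||//]; first by rewrite hornerC normc1.
  by rewrite hornerC subrr normc0 big_ord0 mulr0 mul0r addr0.
have [p [p1 pd pl]] := notch_polynomial (A * l n) eta (mulr_gt0 A0 (lpos n)) eta0.
pose P := p \Po (conjc (expi (s n)) *: 'X).
have PE z : P.[z] = p.[conjc (expi (s n)) * z] by rewrite horner_comp hornerZ hornerX.
have nE z : normc (conjc (expi (s n)) * z) = normc z by rewrite normcM normcJ normc_expi mul1r.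
exists (P * Q); split=> [z z1||k t].
- rewrite hornerM normcM PE mulr_ile1 ?normc_ge0 ?Q1 //.
  by apply: p1; rewrite nE.
- have -> : (P * Q).[l0] - 1 = P.[l0] * (Q.[l0] - 1) + (P.[l0] - 1) by rewrite hornerM; ring.
  apply: le_trans (normcD _ _) _; rewrite big_ord_recr /= -natr1.
  set T := \sum_(_ < n) _; set q := (1 - normc l0)^-1.
  have -> : A * q * (T + l n) + (n%:R + 1) * (2 * eta) =
    (A * q * T + n%:R * (2 * eta)) + (A * l n * q + 2 * eta) by ring.
  apply: lerD.
    rewrite normcM; apply: le_trans Ql; rewrite ler_piMl ?normc_ge0 // PE.
    by apply: p1; rewrite nE ltW.
  rewrite PE; apply: le_trans (pl _ _) _; rewrite nE //.
rewrite ltnS leq_eqVlt => /orP[/eqP -> /andP[st ts]|kn h]; last first.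
  rewrite hornerM normcM; apply: le_trans (Qt k t kn h); rewrite ler_piMl ?normc_ge0 // PE.
  by apply: p1; rewrite nE normc_expi.
rewrite hornerM normcM; apply: (@le_trans _ _ (normc P.[expi t])).
  by rewrite ler_piMr ?normc_ge0 // Q1 ?normc_expi.
rewrite PE; apply: le_trans (pd _ _) _; first by rewrite nE normc_expi.
rewrite lerD2r.
have -> : 1 - conjc (expi (s n)) * expi t = - (conjc (expi (s n)) * (expi t - expi (s n))).
  by rewrite mulrBr conjc_expi opprB.
rewrite normcN nE ler_pdivrMr ?mulr_gt0 //.
apply: le_trans (expi_dist _ _ st) _; rewrite mulrA divfK ?gt_eqF //.
by rewrite ler_pM2l // lerBlDl.
Qed.

End CircleExponential.

(** * Covering null sets by intervals *)

Section NullSets.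
Context {R : realType}.

(** Read off from Lebesgue measure as an infimum over covers by half-open intervals; empty members
    of a cover become intervals of length 0. *)
Lemma null_set_cover (N : set R) (e : R) : (lebesgue_measure N = 0)%E -> 0 < e ->
  exists s l : nat -> R, [/\ forall k, 0 <= l k,
    forall t, N t -> exists k, s k <= t <= s k + l k &
    forall n, \sum_(k < n) l k <= e].
Proof.
move=> N0 e0.
have : (lebesgue_measure N < e%:E)%E by rewrite N0 lte_fin.
move=> /ereal_inf_lt[z [/= M [mM covM] sMz ze]].
have /choice[f hf] : forall n, exists sl : R * R, [/\ 0 <= sl.2,
    M n `<=` [set t | sl.1 <= t <= sl.1 + sl.2] & (wlength idfun (M n) = sl.2%:E)%E].
  move=> n; have /ocitvP[M0|[[a b /= ab Mab]]] : ocitv (M n) by exact: mM.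
    exists (0, 0); rewrite M0 wlength0; split=> //; exact: sub0set.
  exists (a, b - a) => /=; split; first by rewrite subr_ge0 ltW.
    by move=> t; rewrite Mab /= in_itv /= addrC subrK => /andP[/ltW -> ->].
  by rewrite Mab wlength_itv /= lte_fin ab EFinB.
exists (fun n => (f n).1), (fun n => (f n).2); split=> [k|t /covM[k _ Mt]|n].
- by have [] := hf k.
- by exists k; have [_ + _] := hf k; apply.
have : (\sum_(0 <= k < n) wlength idfun (M k) <= z)%E.
  rewrite -sMz; apply: nneseries_lim_ge => k _ _.
  by have [h _ ->] := hf k; rewrite lee_fin.
rewrite big_mkord (eq_bigr (fun k : 'I_n => (f k).2%:E)) => [|k _]; last by have [] := hf k.
rewrite sumEFin => h; rewrite -lee_fin; exact: le_trans h (ltW ze).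
Qed.

Variable (mu : {measure set (measurableTypeR R) -> \bar R}).

(** Finitely many intervals suffice up to small [mu] mass: what the first n intervals leave of [D]
    decreases to a subset of the [mu]-null set [D \ N], and [mu] is continuous from above. *)
Lemma singular_cover (D N : set R) (e : R) : measurable D -> measurable N -> (mu D < +oo)%E ->
  (lebesgue_measure N = 0)%E -> (mu (D `\` N) = 0)%E -> 0 < e ->
  exists (n : nat) (s l : nat -> R), [/\ forall k : nat, 0 < l k, \sum_(k < n) l k <= e &
    (mu (D `\` \bigcup_(k in [set k : nat | (k < n)%N]) [set t : R | (s k <= t <= s k + l k)%R]) < e%:E)%E].
Proof.
move=> mD mN Dfin N0 DN0 e0; have e2 : 0 < e / 2 by rewrite divr_gt0.
have [s [l [l0 cov sl]]] := null_set_cover N _ N0 e2.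
pose I k : set (measurableTypeR R) := [set t | s k <= t <= s k + l k].
have mI k : measurable (I k).
  have -> : I k = `[s k, s k + l k]%classic by apply/seteqP; split=> t /=; rewrite in_itv.
  exact: measurable_itv.
pose F n : set (measurableTypeR R) := D `\` \bigcup_(k in [set k : nat | (k < n)%N]) I k.
have mF n : measurable (F n).
  by apply: measurableD => //; apply: bigcup_measurable => k _; exact: mI.
have capF : \bigcap_n F n `<=` D `\` N.
  move=> t Ft; split; first by have [] := Ft 0%N Logic.I.
  by move=> /cov[k hk]; have [_] := Ft k.+1 Logic.I; apply; exists k => //=.
have mcap : measurable (\bigcap_n F n) by exact: bigcap_measurable.
have F0 : (mu (F 0%N) < +oo)%E.
  by apply: le_lt_trans Dfin; apply: le_measure; rewrite ?inE // => t [].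
have niF : nonincreasing_seq F.
  move=> m n mn; apply/subsetPset => t [Dt nt]; split=> // -[k /= km Ik].
  by apply: nt; exists k => //=; apply: leq_trans km mn.
have := nonincreasing_cvg_mu F0 mF mcap niF.
have -> : mu (\bigcap_n F n) = 0%E.
  apply/eqP; rewrite eq_le measure_ge0 andbT -DN0.
  by apply: le_measure; rewrite ?inE //; exact: measurableD.
move=> cv; have /cv : nbhs (0%E : \bar R) [set x | (x < e%:E)%E].
  by apply: open_nbhs_nbhs; split; [exact: open_ereal_lt_ereal | rewrite /= lte_fin].
move=> [n _ /(_ n (leqnn n)) /= hn].
have n1 : 0 < n.+1%:R :> R by rewrite ltr0n.
(* Lengths are enlarged to become positive, as the width of a notch must be; the total increase is
   at most e/2. *)
exists n, s, (fun k => l k + e / 2 / n.+1%:R); split.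
- by move=> k; rewrite ltr_wpDl // divr_gt0.
- rewrite big_split /= sumr_const card_ord [X in _ <= X]splitr; apply: lerD; first exact: sl.
  by rewrite -[X in X <= _]mulr_natr [X in X <= _]mulrAC ler_pdivrMr // ler_wpM2l ?(ltW e2) // ler_nat.
apply: le_lt_trans hn; apply: le_measure; rewrite ?inE //.
  apply: measurableD => //; apply: bigcup_measurable => k _.
  rewrite (_ : [set _ | _] = `[s k, s k + (l k + e / 2 / n.+1%:R)]%classic); first exact: measurable_itv.
  by apply/seteqP; split=> t /=; rewrite in_itv.
move=> t [Dt nt]; split=> // -[k kn /andP[k1 k2]]; apply: nt; exists k => //=.
by rewrite k1 (le_trans k2) // lerD2l lerDl divr_ge0 // ltW.
Qed.

End NullSets.

(** * From spectral moments to polynomials of a unitary operator *)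

Section SpectralMoments.
Context {R : realType} {K : lmodType R[i]} {ip : K -> K -> R[i]}.
Hypothesis hip : is_inner_product ip.
Local Notation C := R[i].
Local Notation nrm := (hnorm ip).
Variables (U U' : K -> K) (x : K).
Hypothesis hU : unitary_pair (ip := ip) U U'.
Variable mu : {measure set (measurableTypeR R) -> \bar R}.
Local Notation D := (@circ_param R).
Hypothesis hmom : forall n : nat,
  (\int[mu]_(t in D) (cos (n%:R * t))%:E)%E = (Re (ip (iter n U x) x))%:E /\
  (\int[mu]_(t in D) (sin (n%:R * t))%:E)%E = (Im (ip (iter n U x) x))%:E.

Lemma measurable_circ : measurable (D : set (measurableTypeR R)).
Proof. exact: measurable_itv. Qed.

Lemma spectral_mass : mu D = (nrm x ^+ 2)%:E.
Proof.
have [h _] := hmom 0; rewrite (hnorm_sqr hip) -h.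
rewrite (eq_integral (fun=> 1%:E)) => [|t _]; last by rewrite mul0r cos0.
by rewrite integral_cst ?mul1e //; exact: measurable_circ.
Qed.

(** Carries boundedness and measurability along with the value, so that linear combinations of
    moments stay integrable. *)
Definition mean_value (f : R -> R) (r : R) : Prop :=
  [/\ measurable_fun setT f, exists M, forall t, `|f t| <= M &
      Rintegral mu D f = r].

Lemma mean_value_integrable f r : mean_value f r -> mu.-integrable D (EFin \o f).
Proof.
case=> mf [M hM] _; apply: measurable_bounded_integrable.
- exact: measurable_circ.
- by rewrite spectral_mass ltry.
- exact: measurable_funS mf.
- exists M; split; first exact: num_real.
  by move=> N MN t _; apply: le_trans (hM t) (ltW MN).
Qed.

Lemma mean_valueD f g r s : mean_value f r -> mean_value g s ->
  mean_value (fun t => f t + g t) (r + s).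
Proof.
move=> hf hg; have if_ := mean_value_integrable _ _ hf; have ig := mean_value_integrable _ _ hg.
case: hf hg => mf [M hM] <- [mg [N hN] <-]; split.
- by apply: measurable_funD.
- by exists (M + N) => t; apply: le_trans (ler_normD _ _) _; apply: lerD.
- by rewrite -RintegralD //; exact: measurable_circ.
Qed.

Lemma mean_valueZ c f r : mean_value f r -> mean_value (fun t => c * f t) (c * r).
Proof.
move=> hf; have if_ := mean_value_integrable _ _ hf.
case: hf => mf [M hM] <-; split.
- by apply: measurable_funM.
- by exists (`|c| * M) => t; rewrite normrM ler_wpM2l.
- by rewrite -RintegralZl //; exact: measurable_circ.
Qed.

Lemma mean_value_ext f g r : (forall t, f t = g t) -> mean_value f r -> mean_value g r.
Proof. by move=> fg; rewrite (funext fg). Qed.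

Lemma mean_value_sum (n : nat) (f : nat -> R -> R) (r : nat -> R) :
  (forall i, mean_value (f i) (r i)) ->
  mean_value (fun t => \sum_(i < n) f i t) (\sum_(i < n) r i).
Proof.
move=> h; elim: n => [|n IH].
  have := mean_valueZ 0 _ _ (h 0%N); rewrite mul0r big_ord0; apply: mean_value_ext => t.
  by rewrite big_ord0 mul0r.
rewrite big_ord_recr; apply: mean_value_ext (mean_valueD _ _ _ _ IH (h n)) => t.
by rewrite big_ord_recr.
Qed.

Lemma mean_value_cos n : mean_value (fun t => cos (n%:R * t)) (Re (ip (iter n U x) x)).
Proof.
split; last by rewrite /Rintegral (hmom n).1.
  apply: continuous_measurable_fun => t; apply: continuous_comp; last exact: continuous_cos.
  exact: mulrl_continuous.
by exists 1 => t; apply: cos_max.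
Qed.

Lemma mean_value_sin n : mean_value (fun t => sin (n%:R * t)) (Im (ip (iter n U x) x)).
Proof.
split; last by rewrite /Rintegral (hmom n).2.
  apply: continuous_measurable_fun => t; apply: continuous_comp; last exact: continuous_sin.
  exact: mulrl_continuous.
by exists 1 => t; apply: sin_max.
Qed.

Lemma iter_unitary_ip n y z : ip (iter n U y) (iter n U z) = ip y z.
Proof. by elim: n => [//|n IH] /=; rewrite (unitary_ip _ _ _ _ hU). Qed.

Lemma mean_value_monomial (c : C) i j :
  mean_value (fun t => Re (c * (expi t ^+ i * conjc (expi t ^+ j))))
    (Re (c * ip (iter i U x) (iter j U x))).
Proof.
(* Moments are given for nonnegative exponents; the case i < j is the complex conjugate of the
   other. *)
wlog ji : c i j / (j <= i)%N => [hw|].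
  have [/hw//|/ltnW/(hw (conjc c) _ _) h] := leqP j i.
  have -> : Re (c * ip (iter i U x) (iter j U x)) =
      Re (conjc c * ip (iter j U x) (iter i U x)).
    by rewrite -[LHS]ReJ conjcM -(ipC hip).
  apply: mean_value_ext h => t.
  by rewrite -[LHS]ReJ !conjcM !conjcK [conjc _ * _]mulrC.
have e t : expi t ^+ i * conjc (expi t ^+ j) = expi ((i - j)%:R * t).
  rewrite -expiX -{1}(subnK ji) exprD -mulrA.
  by rewrite normc_mulJ normcX normc_expi !expr1n mulr1.
have -> : ip (iter i U x) (iter j U x) = ip (iter (i - j) U x) x.
  by rewrite -{1}(subnKC ji) iterD iter_unitary_ip.
have reE (z : C) : Re (c * z) =
    Re c * Re z + (- Im c) * Im z.
  by case: c z => a b [p q] /=; rewrite mulNr.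
rewrite reE.
apply: mean_value_ext (mean_valueD _ _ _ _ (mean_valueZ _ _ _ (mean_value_cos (i - j)))
  (mean_valueZ _ _ _ (mean_value_sin (i - j)))) => t.
by rewrite e reE.
Qed.

(** The isometry of the spectral theorem, restricted to polynomials: expanding both squares leaves
    the moments, since (U^i x, U^j x) = (U^(i-j) x, x) for j <= i. *)
Lemma mean_value_poly (Q : {poly C}) :
  mean_value (fun t => normc Q.[expi t] ^+ 2) (nrm (polyop U Q x) ^+ 2).
Proof.
have h := mean_value_sum (size Q) _ _ (fun i => mean_value_sum (size Q) _ _
  (fun j => mean_value_monomial (Q`_i * conjc Q`_j) i j)).
rewrite (hnorm_sqr hip) /polyop (ip_suml hip) Re_sum.
under eq_bigr do rewrite (ip_sumr hip) Re_sum.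
under eq_bigr => i _ do under eq_bigr => j _ do rewrite (ipZl hip) (ipZr hip) mulrA.
apply: mean_value_ext h => t.
have -> : normc Q.[expi t] ^+ 2 = Re (Q.[expi t] * conjc Q.[expi t]) by rewrite normc_mulJ.
rewrite horner_coef mulr_suml Re_sum; apply: eq_bigr => i _.
rewrite conjc_sum mulr_sumr Re_sum; apply: eq_bigr => j _; congr (Re _).
by rewrite conjcM; ring.
Qed.

Hypothesis hsing : exists N : set R, [/\ measurable (N : set (measurableTypeR R)), N `<=` D,
  (lebesgue_measure N = 0)%E & (mu (D `\` N) = 0)%E].

(** A product of notches on arcs that carry almost all of [mu] yet have small total length: the
    length controls the damage at l0, and [mean_value_poly] converts smallness of [Q] in L^2(mu)
    into smallness of Q(U) x. *)
Lemma singular_polynomial (l0 : C) (e : R) : normc l0 < 1 -> 0 < e -> exists Q : {poly C},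
  [/\ forall t, normc t <= 1 -> normc Q.[t] <= 1, normc (Q.[l0] - 1) <= e &
      nrm (polyop U Q x) <= e].
Proof.
move=> l01 e0; have [N [mN _ N0 DN]] := hsing; have q0 : 0 < 1 - normc l0 by rewrite subr_gt0.
pose X := nrm x + 1; have X0 : 0 < X by rewrite ltr_wpDl ?hnorm_ge0.
(* On the arcs 2 / A + eta <= al, contributing al^2 |x|^2 <= e^2 / 2; off them |Q| <= 1 on a set of
   mass below e^2 / 2. At l0, the second entries of [e1] and of [eta], the latter chosen once n is
   known, cost e/2 each. *)
pose al := e / (2 * X); have al0 : 0 < al by rewrite divr_gt0 ?mulr_gt0.
pose A := 4 / al; have A0 : 0 < A by rewrite divr_gt0.
have Dfin : (mu D < +oo)%E by rewrite spectral_mass ltry.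
pose e1 := Num.min (e ^+ 2 / 2) (e / 2 * (1 - normc l0) / A).
have e10 : 0 < e1 by rewrite lt_min !divr_gt0 ?mulr_gt0 ?divr_gt0 ?exprn_gt0.
have [n [s [l [l0' sl muF]]]] := singular_cover mu _ _ _ measurable_circ mN Dfin N0 DN e10.
pose eta := Num.min (al / 2) (e / 2 / (2 * n.+1%:R)).
have n1 : 0 < n.+1%:R :> R by rewrite ltr0n.
have eta0 : 0 < eta by rewrite lt_min !divr_gt0 ?mulr_gt0.
have [Q [Q1 Ql Qt]] := notch_product n s l l0 A eta l01 A0 eta0 l0'.
exists Q; split=> //.
  apply: le_trans Ql _; rewrite [e in X in _ <= X]splitr; apply: lerD.
    rewrite mulrAC ler_pdivrMr // mulrC -ler_pdivlMr //.
    by apply: le_trans sl _; rewrite ge_min lexx orbT.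
  apply: (@le_trans _ _ (n.+1%:R * (2 * (e / 2 / (2 * n.+1%:R))))).
    apply: ler_pM => //; rewrite ?mulr_ge0 ?(ltW eta0) // ?ler_nat //.
    by rewrite ler_wpM2l // ge_min lexx orbT.
  by rewrite le_eqVlt; apply/orP; left; apply/eqP; field; rewrite gt_eqF.
pose I k : set (measurableTypeR R) := [set t | s k <= t <= s k + l k].
pose F := \bigcup_(k in [set k : nat | (k < n)%N]) I k.
have mF : measurable F.
  apply: bigcup_measurable => k _.
  have -> : I k = `[s k, s k + l k]%classic by apply/seteqP; split=> t /=; rewrite in_itv.
  exact: measurable_itv.
have h := mean_value_poly Q; have ih := mean_value_integrable _ _ h.
case: h => mQ _ hQ.
rewrite -(@ler_pXn2r _ 2) ?nnegrE ?hnorm_ge0 ?(ltW e0) // -lee_fin -hQ /Rintegral fineK; last first.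
  by apply: integrable_fin_num ih; exact: measurable_circ.
have mD := measurable_circ.
pose G : set (measurableTypeR R) := D `\` F; have mG : measurable G by exact: measurableD.
have le_f t : D t -> normc Q.[expi t] ^+ 2 <= al ^+ 2 + \1_G t.
  move=> Dt; have [Ft|Ft] := pselect (F t).
    apply: ler_wpDr; first by rewrite indicE.
    case: Ft => k /= kn /Qt hq; apply: lerXn2r; rewrite ?nnegrE ?normc_ge0 ?(ltW al0) //.
    apply: le_trans (hq kn) _; rewrite [al in X in _ <= X]splitr; apply: lerD.
      by rewrite /A invf_div mulrA ler_pdivrMr // le_eqVlt; apply/orP; left; apply/eqP; field.
    by rewrite ge_min lexx.
  apply: ler_wpDl; first exact: sqr_ge0.
  rewrite indicE mem_set //= expr_le1 ?normc_ge0 // Q1 // normc_expi //.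
apply: (@le_trans _ _ (\int[mu]_(t in D) ((al ^+ 2)%:E + (\1_G t)%:E))%E).
  apply: ge0_le_integral => //.
  - by move=> t _; rewrite lee_fin sqr_ge0.
  - by apply/measurable_EFinP; exact: measurable_funS mQ.
  - apply: emeasurable_funD; first exact: measurable_cst.
    by apply/measurable_EFinP; exact: measurable_indic.
rewrite ge0_integralD //; last first.
- by apply/measurable_EFinP; exact: measurable_indic.
- by move=> t _; rewrite lee_fin sqr_ge0.
rewrite integral_cst // integral_indic // spectral_mass.
have GD : G `&` D = G by apply/setIidl => t [].
rewrite GD -EFinM.
have alb : al ^+ 2 * nrm x ^+ 2 <= e ^+ 2 / 2.
  rewrite -exprMn /al.
  have h1 : e / (2 * X) * nrm x <= e / 2.
    rewrite invfM mulrA -mulrA ler_piMr ?divr_ge0 ?(ltW e0) //.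
    by rewrite mulrC ler_pdivrMr // mul1r /X lerDl.
  have h0 : 0 <= e / (2 * X) * nrm x by rewrite mulr_ge0 ?hnorm_ge0 ?divr_ge0 ?mulr_ge0 // ltW.
  have : (e / (2 * X) * nrm x) ^+ 2 <= (e / 2) ^+ 2 by apply: lerXn2r; rewrite ?nnegrE ?divr_ge0 // ltW.
  by have := sqr_ge0 e; rewrite [(e / 2) ^+ 2]exprMn; move: (e ^+ 2) (_ ^+ 2) => t r; lra.
apply: (@le_trans _ _ ((e ^+ 2 / 2)%:E + (e ^+ 2 / 2)%:E)%E).
  apply: leeD; first by rewrite lee_fin.
  apply: ltW; apply: lt_le_trans muF _; rewrite lee_fin ge_min lexx //.
by rewrite -EFinD -splitr.
Qed.

End SpectralMoments.

(** * The lower bound for powers *)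

Section RankOneLowerBound.
Context {R : realType} {H : lmodType R[i]} {ip : H -> H -> R[i]}.
Hypothesis hip : is_inner_product ip.
Local Notation C := R[i].
Local Notation nrm := (hnorm ip).
Variables (a b : H) (k : R).
Let J (x : H) : H := x + ip x b *: a.
Let c : C := 1 + ip a b.
Hypotheses (k1 : 1 <= k) (hJ : forall x, nrm (J x) <= k * nrm x) (c1 : 1 <= normc c).

Lemma pythagoras x y : ip x y = 0 -> nrm (x + y) ^+ 2 = nrm x ^+ 2 + nrm y ^+ 2.
Proof. by move=> h; rewrite (hnormD_sqr hip) h mul0rn addr0. Qed.

Section Plane.
Variable f : H.
Hypotheses (af : a = (ip a b / ip b b) *: b + f) (fb : ip f b = 0) (b0 : b != 0) (f0 : f != 0).
Let B := ip b b.
Let S := ip f f.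
Let Bc : conjc B = B. Proof. by rewrite /B (ip_self hip) conjc_real. Qed.
Let Sc : conjc S = S. Proof. by rewrite /S (ip_self hip) conjc_real. Qed.
Let bf : ip b f = 0. Proof. by rewrite (ipC hip) fb conjc0. Qed.
Let B0 : B != 0.
Proof. by rewrite /B (ip_self hip) real_complex_eq0 sqrf_eq0 gt_eqF // (hnorm_gt0 hip). Qed.

(* The determinant of J on the plane spanned by b and f is c, and in dimension two the smallest
   singular value is the determinant divided by the largest. *)
Lemma plane_lower_bound p q : nrm (p *: b + q *: f) <= k * nrm (J (p *: b + q *: f)).
Proof.
set x := _ + _.
have JE s t : J (s *: b + t *: f) = (c * s) *: b + (t + B * s) *: f.
  rewrite /J (ipDl hip) !(ipZl hip) fb mulr0 addr0 {1}af -/B.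
  have e : c = 1 + (ip a b / B) * B by rewrite divfK.
  by rewrite e; hring hip.
have rcM (s t : R) : (s * t)%:C = s%:C * t%:C :> C by exact: rmorphM.
pose n1 := - (c * (conjc q * S)); pose n2 := B * (conjc p - conjc q * S).
(* [y] is orthogonal to [x] with |y| = |b| |f| |x|, and [w] is related to [J y] in the same way.
   Thus (J x, w) is an area form and equals |b|^2 |f|^2 |x|^2 times the determinant [c];
   Cauchy-Schwarz and |J y| <= k |y| then give the claim. *)
pose y := (- (conjc q * S)) *: b + (conjc p * B) *: f.
pose w := (conjc n2 * S) *: b - (conjc n1 * B) *: f.
have Jy : J y = n1 *: b + n2 *: f.
  by rewrite JE; congr (_ *: _ + _ *: _); rewrite /n1 /n2; ring.
have gram s t s' t' : ip (s *: b + t *: f) (s' *: b + t' *: f) = s * conjc s' * B + t * conjc t' * S.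
  by rewrite !(ipDl hip) !(ipDr hip) !(ipZl hip) !(ipZr hip) fb bf -/B -/S; ring.
have xx : ip x x = p * conjc p * B + q * conjc q * S by rewrite gram.
have yy : nrm y ^+ 2 = nrm b ^+ 2 * nrm f ^+ 2 * nrm x ^+ 2.
  apply: complexI; rewrite [RHS]rcM [X in _ = X * _]rcM -!(ip_self hip) -/B -/S xx gram conjcN !conjcM !conjcK Bc Sc.
  ring.
have wwE m1 m2 : ip ((conjc m2 * S) *: b + (- (conjc m1 * B)) *: f)
      ((conjc m2 * S) *: b + (- (conjc m1 * B)) *: f) =
    B * S * ip (m1 *: b + m2 *: f) (m1 *: b + m2 *: f).
  by rewrite !gram conjcN !conjcM !conjcK Bc Sc; ring.
have ww : nrm w ^+ 2 = nrm b ^+ 2 * nrm f ^+ 2 * nrm (J y) ^+ 2.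
  have wE : w = (conjc n2 * S) *: b + (- (conjc n1 * B)) *: f by rewrite /w scaleNr.
  apply: complexI; rewrite [RHS]rcM [X in _ = X * _]rcM -!(ip_self hip) -/B -/S Jy wE.
  exact: wwE.
have xw : ip (J x) w = B * S * c * ip x x.
  have wE : w = (conjc n2 * S) *: b + (- (conjc n1 * B)) *: f by rewrite /w scaleNr.
  have gramw m1 m2 : ip ((c * p) *: b + (q + B * p) *: f) ((conjc m2 * S) *: b + (- (conjc m1 * B)) *: f) =
      B * S * ((c * p) * m2 - (q + B * p) * m1).
    by rewrite gram conjcN !conjcM !conjcK Bc Sc; ring.
  by rewrite JE wE gramw xx /n1 /n2; ring.
have nb := hnorm_gt0 hip _ b0; have nf := hnorm_gt0 hip _ f0.
pose t := nrm b * nrm f; have t0 : 0 < t by rewrite mulr_gt0.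
have y1 : nrm y = t * nrm x.
  by apply/eqP; rewrite -(@eqrXn2 _ 2) ?mulr_ge0 ?hnorm_ge0 // yy /t !exprMn.
have w1 : nrm w = t * nrm (J y).
  by apply/eqP; rewrite -(@eqrXn2 _ 2) ?mulr_ge0 ?hnorm_ge0 // ww /t !exprMn.
have := cauchy_schwarz hip (J x) w; rewrite xw !normcM w1.
rewrite /B /S !(ip_self hip) !normcR !ger0_norm ?sqr_ge0 // => h.
have h1 : t ^+ 2 * nrm x ^+ 2 <= nrm (J x) * (t * (k * (t * nrm x))).
  apply: (@le_trans _ _ (nrm b ^+ 2 * nrm f ^+ 2 * normc c * nrm x ^+ 2)).
    have -> : nrm b ^+ 2 * nrm f ^+ 2 * normc c * nrm x ^+ 2 = normc c * (t ^+ 2 * nrm x ^+ 2).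
      by rewrite /t; ring.
    by rewrite ler_peMl // mulr_ge0 ?sqr_ge0.
  apply: le_trans h _; rewrite ler_wpM2l ?hnorm_ge0 // ler_wpM2l ?(ltW t0) //.
  by rewrite -y1; apply: hJ.
have [->|x0] := eqVneq (nrm x) 0; first by rewrite mulr_ge0 ?hnorm_ge0 ?(le_trans ler01).
have nx : 0 < nrm x by rewrite lt_neqAle eq_sym x0 hnorm_ge0.
have tx : 0 < t ^+ 2 * nrm x by rewrite mulr_gt0 ?exprn_gt0.
rewrite -(ler_pM2l tx); move: h1; set j := nrm (J x).
have -> : j * (t * (k * (t * nrm x))) = t ^+ 2 * nrm x * (k * j) by ring.
by rewrite [nrm x ^+ 2]expr2 mulrA.
Qed.

End Plane.

(** [J] maps the span of [a] and [b] into itself and fixes its orthogonal complement, so squared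
    norms add and k >= 1 settles the complement. If [a] is a multiple of [b], the span is replaced
    by the line of [b], on which [J] is multiplication by [c]. *)
Lemma rank_one_lower_bound x : nrm x <= k * nrm (J x).
Proof.
have k0 : 0 <= k by apply: le_trans k1.
have [b0|b0] := eqVneq b 0.
  by rewrite /J b0 (ip0r hip) scale0r addr0 ler_peMl ?hnorm_ge0.
have B0 : ip b b != 0.
  by rewrite (ip_self hip) real_complex_eq0 sqrf_eq0 gt_eqF // (hnorm_gt0 hip).
pose f := a - (ip a b / ip b b) *: b.
have af : a = (ip a b / ip b b) *: b + f by rewrite /f addrC subrK.
have fb : ip f b = 0 by rewrite /f (ipBl hip) (ipZl hip) divfK // subrr.
have bf : ip b f = 0 by rewrite (ipC hip) fb conjc0.
pose p := ip x b / ip b b.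
suff [q [z [xE zb zf hq]]] : exists q z, [/\ x = (p *: b + q *: f) + z, ip z b = 0, ip z f = 0 &
    nrm (p *: b + q *: f) <= k * nrm (J (p *: b + q *: f))].
  set e := p *: b + q *: f in xE hq.
  have Jx : J x = J e + z by rewrite /J {1}xE xE (ipDl hip) zb addr0 addrAC.
  have ez : ip e z = 0.
    by rewrite (ipC hip) (ipDr hip) !(ipZr hip) zb zf !mulr0 addr0 conjc0.
  have Jez : ip (J e) z = 0.
    have az : ip a z = 0 by rewrite (ipC hip) af (ipDr hip) (ipZr hip) zb zf mulr0 addr0 conjc0.
    by rewrite /J (ipDl hip) ez (ipZl hip) az mulr0 addr0.
  rewrite -(@ler_pXn2r _ 2) ?nnegrE ?mulr_ge0 ?hnorm_ge0 // exprMn Jx xE.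
  rewrite (pythagoras e z ez) (pythagoras (J e) z Jez).
  rewrite mulrDr; apply: lerD.
    by rewrite -exprMn; apply: lerXn2r; rewrite ?nnegrE ?mulr_ge0 ?hnorm_ge0.
  by rewrite ler_peMl ?sqr_ge0 // expr_ge1.
have [f0|f0] := eqVneq f 0.
  exists 0, (x - p *: b); split.
  - by rewrite scale0r addr0 addrC subrK.
  - by rewrite (ipBl hip) (ipZl hip) divfK // subrr.
  - by rewrite f0 (ip0r hip).
  rewrite scale0r addr0.
  have -> : J (p *: b) = c *: (p *: b).
    rewrite /J (ipZl hip) af f0 addr0 /c !scalerA -scalerDl; congr (_ *: _).
    by field.
  rewrite [nrm (c *: _)](hnormZ hip) mulrA ler_peMl ?hnorm_ge0 //.
  by rewrite -[1]mulr1; apply: ler_pM.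
have S0 : ip f f != 0.
  by rewrite (ip_self hip) real_complex_eq0 sqrf_eq0 gt_eqF // (hnorm_gt0 hip).
pose q := ip x f / ip f f; exists q, (x - (p *: b + q *: f)); split.
- by rewrite addrC subrK.
- by rewrite (ipBl hip) (ipDl hip) !(ipZl hip) fb mulr0 addr0 divfK // subrr.
- by rewrite (ipBl hip) (ipDl hip) !(ipZl hip) bf mulr0 add0r divfK // subrr.
exact: (plane_lower_bound f).
Qed.

End RankOneLowerBound.

(** * The resolvent of the power bounded perturbation *)

Section PowerBounded.
Context {R : realType} {H K : lmodType R[i]}.
Context {ipH : H -> H -> R[i]} {ipK : K -> K -> R[i]}.
Hypotheses (hH : is_inner_product ipH) (hK : is_inner_product ipK).
Hypotheses (cH : hcomplete ipH) (cK : hcomplete ipK).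
Local Notation C := R[i].
Local Notation nH := (hnorm ipH).
Local Notation nK := (hnorm ipK).
Variables (V V' : H -> H) (U U' : K -> K).
Hypotheses (hV : unitary_pair (ip := ipH) V V') (hU : unitary_pair (ip := ipK) U U').
Variables (u v : H) (X : H -> K) (X' : K -> H) (cX M : R).
Hypotheses (lX : is_linear_map X) (adX : forall x y, ipK (X x) y = ipH x (X' y)).
Hypotheses (cX0 : 0 <= cX) (hcX : forall x, nK (X x) <= cX * nH x).
Hypothesis X'dense : forall h e, 0 < e -> exists y, nH (h - X' y) < e.
Hypothesis Xinj : forall x, X x = 0 -> x = 0.
Let T (x : H) : H := V x + ipH x v *: u.
Hypothesis hXT : forall x, X (T x) = U (X x).
Hypotheses (M1 : 1 <= M) (hM : forall n x, nH (iter n T x) <= M * nH x).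
Local Notation d := (perturbation_det (ipH := ipH) V u v).
Hypothesis hdet : forall l, l != 0 -> normc l < 1 -> normc (d (conjc l)^-1) <= normc (d l).

Let lV : is_linear_map V. Proof. by case: hV. Qed.
Let M0 : 0 <= M. Proof. exact: le_trans M1. Qed.

Lemma perturbed_lin : is_linear_map T.
Proof. by move=> a x y; rewrite /T lV (ip_lin hH); hring hH. Qed.

(** The Sherman-Morrison formula: pairing the equation with [v] leaves one scalar unknown, whose
    coefficient is [d l]. *)
Lemma perturbed_resolvable l : resolvable V l -> d l != 0 -> resolvable T l /\
  forall x, resolvent T l x =
    resolvent V l x + (ipH (resolvent V l x) v / d l) *: resolvent V l u.
Proof.
move=> rV dl; set q := resolvent V l u.
have qE : l *: q - V q = u := resolventP V l u rV.
have dq : ipH q v = 1 - d l by rewrite /perturbation_det -/q; ring.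
have sol x : l *: (resolvent V l x + (ipH (resolvent V l x) v / d l) *: q) -
    T (resolvent V l x + (ipH (resolvent V l x) v / d l) *: q) = x.
  set p := resolvent V l x; set s := ipH p v / d l.
  rewrite /T (linD V) // (linZ V) // (ipDl hH) (ipZl hH) dq.
  have -> : l *: (p + s *: q) - (V p + s *: V q + (ipH p v + s * (1 - d l)) *: u) =
    (l *: p - V p) + s *: (l *: q - V q) - (ipH p v + s * (1 - d l)) *: u by hring hH.
  rewrite qE (resolventP V l x rV).
  have -> : ipH p v = s * d l by rewrite /s divfK.
  by hring hH.
have rT : resolvable T l.
  split=> [x|y hy]; first by eexists; exact: sol.
  have lR := resolvent_lin hH _ _ lV rV.
  have yq : y = ipH y v *: q.
    rewrite /q -(linZ _ _ _ lR); apply/esym; apply: (resolventE hH) => //.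
    by apply/eqP; rewrite -subr_eq0 -[X in _ == X]hy /T; apply/eqP; hring hH.
  have : ipH y v = 0.
    have := congr1 (fun z => ipH z v) yq; rewrite (ipZl hH) dq => h.
    have /eqP : ipH y v * d l = 0 by rewrite -[d l](subKr 1) mulrBr mulr1 -h subrr.
    by rewrite mulf_eq0 (negPf dl) orbF => /eqP.
  by move=> y0; rewrite yq y0 scale0r.
by split=> // x; apply: (resolventE hH) => //; exact: perturbed_lin.
Qed.

Let rVout l : 1 < normc l -> resolvable V l.
Proof. exact: (unitary_resolvable_gt1 hH _ _ _ cH hV). Qed.

Lemma det_root_eigenvector l : resolvable V l -> d l = 0 ->
  exists2 q, q != 0 & T q = l *: q.
Proof.
move=> rV dl; exists (resolvent V l u); set q := resolvent V l u.
  by apply: contra_eq_neq dl => q0; rewrite /perturbation_det -/q q0 (ip0l hH) subr0 oner_neq0.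
have dq : ipH q v = 1 by apply/eqP; rewrite eq_sym -subr_eq0; apply/eqP.
rewrite /T dq scale1r -[u](resolventP V l u rV) -/q.
by hring hH.
Qed.

Lemma iter_eigenvector l q n : T q = l *: q -> iter n T q = l ^+ n *: q.
Proof.
move=> h; elim: n => [|n IH]; first by rewrite expr0 scale1r.
by rewrite /= IH (linZ T) // ?h ?scalerA ?exprSr //; exact: perturbed_lin.
Qed.

(** A zero would be an eigenvalue of [T] of modulus above 1, against power boundedness. *)
Lemma det_outside l : 1 < normc l -> d l != 0.
Proof.
move=> l1; apply/eqP => dl; have [q q0 Tq] := det_root_eigenvector l (rVout l l1) dl.
have nq := hnorm_gt0 hH _ q0.
have r01 : 0 <= (normc l)^-1 < 1.
  by rewrite invr_ge0 normc_ge0 /= invf_lt1 // (lt_trans ltr01).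
have [n hn] := geometric_lt M _ _ r01 ltr01.
have := hM n q; rewrite (iter_eigenvector l) // (hnormZ hH) normcX ler_pM2r //.
have := hn n (leqnn n); have ln : 0 < normc l ^+ n by rewrite exprn_gt0 // (lt_trans ltr01).
rewrite exprVn ltr_pdivrMr // mul1r => h1 h2.
by have := lt_le_trans h1 h2; rewrite ltxx.
Qed.

(** A zero would be an eigenvalue of [T]; its eigenvector is carried by the injective [X] to an
    eigenvector of the isometry [U] with eigenvalue of modulus below 1. *)
Lemma det_inside l : l != 0 -> normc l < 1 -> d l != 0.
Proof.
move=> l0 l1; apply/eqP => dl.
have rV : resolvable V l by apply: (unitary_resolvable hH V V') => //; rewrite lt_eqF.
have [q q0 Tq] := det_root_eigenvector l rV dl.
have Xq : X q = 0.
  apply: (hnorm_le0 hK); have := unitary_hnorm _ _ (X q) hU.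
  rewrite -hXT Tq (linZ X) // (hnormZ hK) => h; have := hnorm_ge0 (ip := ipK) (X q).
  by move: h l1; move: (nK _) (normc l) => s t; nra.
by move: q0; rewrite (Xinj _ Xq) eqxx.
Qed.

Let rT l : l != 0 -> normc l != 1 -> resolvable T l.
Proof.
move=> l0; rewrite neq_lt => /orP[l1|l1].
  have rV : resolvable V l by apply: (unitary_resolvable hH V V') => //; rewrite lt_eqF.
  by have [] := perturbed_resolvable l rV (det_inside l l0 l1).
by have [] := perturbed_resolvable l (rVout l l1) (det_outside l l1).
Qed.

(** [T] is a contraction for the equivalent norm sup_n |T^n y|; passing to that norm costs one
    factor [M]. *)
Lemma perturbed_resolvent_le l x : 1 < normc l ->
  nH (resolvent T l x) <= M * nH x / (normc l - 1).
Proof.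
move=> l1; have l0 : l != 0 by apply: contraTneq l1 => ->; rewrite normc0 ltNge ler01.
have hy := resolventP T l x (rT l l0 (negbT (gt_eqF l1))); set y := resolvent T l x in hy *.
pose S : set R := range (fun n : nat => nH (iter n T y)).
have Sne : S !=set0 by exists (nH y), 0%N.
have Sub : has_ubound S by exists (M * nH y) => _ [n _ <-]; apply: hM.
have ysup n : nH (iter n T y) <= sup S by apply: ub_le_sup => //; exists n.
have key : normc l * sup S <= M * nH x + sup S.
  have lp : 0 < normc l by apply: lt_trans l1.
  rewrite mulrC -ler_pdivlMr //; apply: ge_sup => // _ [n _ <-]; rewrite ler_pdivlMr // mulrC.
  rewrite -(hnormZ hH); have lTn := lin_iter _ n perturbed_lin.
  rewrite -(linZ (iter n T)) //.
  have -> : l *: y = x + T y by rewrite -hy subrK.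
  rewrite (linD (iter n T)) // -iterSr; apply: le_trans (hnormD hH _ _) _.
  by apply: lerD; [apply: hM | apply: ysup].
rewrite ler_pdivlMr ?subr_gt0 //; have := ysup 0%N; rewrite /= => h.
apply: (@le_trans _ _ (sup S * (normc l - 1))).
  by rewrite ler_wpM2r // subr_ge0 ltW.
by move: key; rewrite mulrBr mulr1 mulrC; lra.
Qed.

Section Reflection.
Variable l : C.
Hypotheses (l0 : l != 0) (l1 : normc l < 1).
Let r := normc l.
Let m := (conjc l)^-1.
Let r0 : 0 < r. Proof. exact: normc_gt0. Qed.
Let mE : normc m = r^-1. Proof. by rewrite /m normcV normcJ. Qed.
Let m1 : 1 < normc m. Proof. by rewrite mE invf_gt1. Qed.
Let m0 : m != 0. Proof. by rewrite invr_eq0 conjc_eq0. Qed.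
Let rVl : resolvable V l.
Proof. by apply: (unitary_resolvable hH V V') => //; rewrite lt_eqF. Qed.
Let rVm : resolvable V m := rVout m m1.
Let rTl : resolvable T l. Proof. by apply: rT => //; rewrite lt_eqF. Qed.
Let rTm : resolvable T m. Proof. by apply: rT => //; rewrite gt_eqF. Qed.

Let lm : l = (r ^+ 2)%:C * m.
Proof. by rewrite -normc_mulJ /m mulfK // conjc_eq0. Qed.

(** Says that (l - V) (m - V)^-1 is r times an isometry. As l = r^2 m, the cross terms of the
    squared norms have ratio r^2, and r^2 + 1 = r^2 (r^-2 + 1) settles the rest. *)
Lemma moebius_isometry g : nH (g - (m - l) *: resolvent V m g) = r * nH g.
Proof.
set p := resolvent V m g; have gE : m *: p - V p = g := resolventP V m g rVm.
have -> : g - (m - l) *: p = l *: p - V p by rewrite -{1}gE; hring hH.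
apply/eqP; rewrite -(@eqrXn2 _ 2) ?mulr_ge0 ?hnorm_ge0 ?(ltW r0) // exprMn -[in X in _ == X]gE.
rewrite !(hnormB_sqr hH) !(ipZl hH) !(hnormZ hH) (unitary_hnorm _ _ _ hV) -/r mE.
rewrite {1}lm -mulrA ReZ; apply/eqP; rewrite !exprMn exprVn.
by field; rewrite gt_eqF.
Qed.

Let k := r^-1 * (1 + (1 + r) * M).

(** Origin of [k]: (l - T) (m - T)^-1 has norm at most 1 + |m - l| M / (|m| - 1) = 1 + (1 + r) M,
    and r^-1 strips off the Moebius factor. The rank one lemma gives the inverse the same
    constant. *)
Lemma reflected_bound h : r * nH (m *: h - T h) <= k * nH (l *: h - T h).
Proof.
set g := m *: h - T h.
have hE : h = resolvent T m g by apply/esym; apply: (resolventE hH) => //; exact: perturbed_lin.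
have thE : l *: h - T h = g - (m - l) *: h by rewrite /g; hring hH.
have dm := det_outside m m1.
have [_ RTm] := perturbed_resolvable m rVm dm.
(* With this [a] and [b], [ident] below factors (l - T) (m - T)^-1 as (l - V) (m - V)^-1 after [J],
   and 1 + (a, b) = d l / d m. *)
pose b := resolvent V' (conjc m) v; pose a := - ((m - l) / d m) *: resolvent V l u.
have rV'm : resolvable V' (conjc m).
  apply: (unitary_resolvable_gt1 hH _ _ _ cH (unitary_pair_sym hH _ _ hV)).
  by rewrite normcJ.
have bE x : ipH (resolvent V m x) v = ipH x b by apply: (resolvent_adj hH V V').
have lR := resolvent_lin hH _ _ lV rVm.
pose J x := x + ipH x b *: a.
have ident x : x - (m - l) *: resolvent T m x = J x - (m - l) *: resolvent V m (J x).
  have rid := resolvent_identity hH V m l u lV rVm rVl.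
  rewrite RTm /J (linD _ _ _ lR) (linZ _ _ _ lR) /a (linZ _ _ _ lR) bE.
  move: rid; set q := resolvent V m u; set ql := resolvent V l u; set ml := resolvent V m ql => rid.
  have -> : q = ql + (l - m) *: ml by rewrite -rid addrC subrK.
  by hring hH.
have Jn x : nH (J x) = r^-1 * nH (x - (m - l) *: resolvent T m x).
  by rewrite ident moebius_isometry mulrA mulVf ?mul1r // gt_eqF.
have k1 : 1 <= k.
  rewrite /k mulrC ler_pdivlMr // mul1r; have := mulr_ge0 (addr_ge0 ler01 (ltW r0)) M0.
  by move: l1; rewrite -/r; lra.
have Jk x : nH (J x) <= k * nH x.
  rewrite Jn /k -mulrA ler_wpM2l ?invr_ge0 ?(ltW r0) //.
  apply: le_trans (hnormB hH _ _) _; rewrite mulrDl mul1r lerD2l (hnormZ hH).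
  have -> : normc (m - l) = r^-1 - r.
    have -> : m - l = (1 - r ^+ 2)%:C * m by rewrite rmorphB rmorph1 mulrBl mul1r -lm.
    rewrite normcM mE normcR.
    rewrite ger0_norm; first by field; rewrite gt_eqF.
    by rewrite subr_ge0 expr_le1 ?(ltW r0) // ltW.
  have := perturbed_resolvent_le m x m1; rewrite mE => hb.
  have rr : 0 <= r^-1 - r by rewrite subr_ge0 (le_trans (ltW l1)) // invf_ge1 // ltW.
  apply: le_trans (ler_wpM2l rr hb) _; rewrite le_eqVlt; apply/orP; left; apply/eqP.
  field; apply/andP; split; first by rewrite gt_eqF.
  by rewrite mulN1r gt_eqF // subr_gt0.
have c1 : 1 <= normc (1 + ipH a b).
  have -> : 1 + ipH a b = d l / d m.
    have rid := congr1 (fun z => ipH z v) (resolvent_identity hH V m l u lV rVm rVl).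
    rewrite /= (ipBl hH) (ipZl hH) in rid.
    have qb : (m - l) * ipH (resolvent V l u) b = d m - d l.
      by rewrite -bE -[LHS]opprK -mulNr opprB -rid /perturbation_det; ring.
    rewrite /a (ipZl hH) mulNr mulrAC qb.
    by field.
  rewrite normcM normcV ler_pdivlMr ?mul1r; last exact: normc_gt0.
  exact: hdet.
have := rank_one_lower_bound hH a b k k1 Jk c1 g.
rewrite -/(J g) Jn -hE -thE mulrCA => hb.
by rewrite -ler_pdivlMl.
Qed.

(** Apply [reflected_bound] to h = (l - T)^-1 (m - T)^-1 x: by commutation (m - T) h and (l - T) h
    are the two resolvents at [x]. *)
Lemma reflected_resolvent x :
  nH (resolvent T l x) <= r^-1 * k * nH (resolvent T m x).
Proof.
set p := resolvent T m x; pose h := resolvent T l p.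
have lT := perturbed_lin.
have hE : l *: h - T h = p := resolventP T l p rTl.
have <- : m *: h - T h = resolvent T l x.
  apply/esym; apply: (resolventE hH) => //.
  have -> : l *: (m *: h - T h) - T (m *: h - T h) = m *: (l *: h - T h) - T (l *: h - T h).
    by rewrite !(linB T) // !(linZ T) //; hring hH.
  by rewrite hE; apply: resolventP.
have := reflected_bound h; rewrite hE => hb.
by rewrite -mulrA ler_pdivlMl.
Qed.

End Reflection.

(** * Averages over the circles of radius r and 1 / r *)

Section Averaging.
Variables (r : R) (x : H) (n : nat).
Hypothesis r01 : 0 < r < 1.
Let r0 : 0 < r. Proof. by case/andP: r01. Qed.
Let r1 : r < 1. Proof. by case/andP: r01. Qed.
Let kap := (1 + (1 + r) * M) / r ^+ 2.
Let lT := perturbed_lin.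

Let kap0 : 0 <= kap.
Proof. by rewrite divr_ge0 ?sqr_ge0 // addr_ge0 // mulr_ge0 // addr_ge0 // ltW. Qed.

Section Family.
Variables (N : nat) (w : 'I_N -> C).
Hypotheses (hw : root_family N w) (rN : M * r ^+ N <= 2^-1).
Let N0 : (0 < N)%N. Proof. by case: hw. Qed.
Let w1 j : normc (w j) = 1 := root_family_normc N w j hw.
Let w0 j : w j != 0.
Proof. exact: normc1_neq0. Qed.
Let f j := resolvent T (r%:C * w j) x.
Let f' j := resolvent T ((r^-1)%:C * w j) x.
Let a k := dft N w f k.
Let a' k := dft N w f' k.

Let nrw j : normc (r%:C * w j) = r. Proof. by rewrite normcM w1 mulr1 normcR gtr0_norm. Qed.
Let nrw' j : normc ((r^-1)%:C * w j) = r^-1.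
Proof. by rewrite normcM w1 mulr1 normcR gtr0_norm // invr_gt0. Qed.

Let hf j : (r%:C * w j) *: f j - T (f j) = x.
Proof.
apply: resolventP; apply: rT; last by rewrite nrw lt_eqF.
by rewrite mulf_neq0 // real_complex_eq0 gt_eqF.
Qed.

Let hf' j : ((r^-1)%:C * w j) *: f' j - T (f' j) = x.
Proof.
apply: resolventP; apply: rT; last by rewrite nrw' gt_eqF // invf_gt1.
by rewrite mulf_neq0 // real_complex_eq0 invr_eq0 gt_eqF.
Qed.

Let rr : r%:C * (r^-1)%:C = 1 :> C.
Proof. by rewrite -rmorphM divff ?gt_eqF // rmorph1. Qed.

Lemma reflected_mean : \sum_(k < N) nH (a k) ^+ 2 <= kap ^+ 2 * \sum_(k < N) nH (a' k) ^+ 2.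
Proof.
rewrite !(parseval hH _ _ hw) -avgZ; apply: avg_le => j; rewrite -exprMn.
apply: lerXn2r; rewrite ?nnegrE ?hnorm_ge0 ?(mulr_ge0 kap0 (hnorm_ge0 _)) //.
have lj0 : r%:C * w j != 0 by rewrite mulf_neq0 // real_complex_eq0 gt_eqF.
have lj1 : normc (r%:C * w j) < 1 by rewrite nrw.
have := reflected_resolvent _ lj0 lj1 x; rewrite nrw.
have -> : (conjc (r%:C * w j))^-1 = (r^-1)%:C * w j.
  rewrite conjcM conjc_real invfM fmorphV; congr (_ * _).
  apply: (mulIf (x := conjc (w j))); first by rewrite conjc_eq0.
  by rewrite mulVf ?conjc_eq0 // (root_family_mulJ N w j hw).
have -> : r^-1 * (r^-1 * (1 + (1 + r) * M)) = kap by rewrite /kap; field; rewrite gt_eqF.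
by [].
Qed.

Let a'E k : (k < N)%N -> a' k = r%:C ^+ k *: iter k T (a' 0).
Proof.
move=> kN; rewrite (dft_iter hH N w hw T (r^-1)%:C x f' lT hf' k kN) scalerA.
by rewrite -exprMn rr expr1n scale1r.
Qed.

Let a'0E : a' 0 = r%:C *: x + r%:C ^+ N *: iter N T (a' 0).
Proof.
rewrite (dft_cycle hH N w hw T (r^-1)%:C x f' lT hf').
have e1 : r%:C ^+ N * (r^-1)%:C ^+ N = 1 :> C by rewrite -exprMn rr expr1n.
have e2 : r%:C ^+ N * (r^-1)%:C ^+ N.-1 = r%:C :> C.
  by rewrite -{1}(prednK N0) exprS -mulrA -exprMn rr expr1n mulr1.
by rewrite scalerBr scalerA e1 scale1r scalerA e2 addrC subrK.
Qed.

Let nrC k : normc (r%:C ^+ k) = r ^+ k.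
Proof. by rewrite normcX normcR gtr0_norm. Qed.

Let a'0le : nH (a' 0) <= 2 * nH x.
Proof.
move: a'0E; move: (a' 0) => A0 e.
have : nH A0 <= r * nH x + r ^+ N * (M * nH A0).
  rewrite {1}e; apply: le_trans (hnormD hH _ _) _; rewrite !(hnormZ hH) nrC normcR gtr0_norm //.
  by rewrite lerD2l ler_wpM2l ?exprn_ge0 ?(ltW r0) // hM.
have Y0 := hnorm_ge0 (ip := ipH) x.
have h : r ^+ N * (M * nH A0) <= 2^-1 * nH A0.
  by rewrite mulrA ler_wpM2r ?hnorm_ge0 // mulrC.
have h' : r * nH x <= nH x by rewrite ler_piMl // ltW.
by move: h h' Y0; generalize (r ^+ N * (M * nH A0)), (r * nH x), (nH A0), (nH x) => t z A Y; lra.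
Qed.

(** Outside the disc a'_k = r^k T^k a'_0 with a'_0 close to r x. Terms with k < n are bounded
    crudely and disappear as r -> 1; for k >= n power boundedness gives |T^k a'_0| <= M |T^n a'_0|,
    and (1 - r^2) times the sum of r^(2k) is at most 1. *)
Lemma outer_mean : (1 - r ^+ 2) * \sum_(k < N) nH (a' k) ^+ 2 <=
  (1 - r ^+ 2) * (n%:R * (M * (2 * nH x)) ^+ 2) +
  (M * (nH (iter n T x) + 2 * M * nH x * r ^+ N)) ^+ 2.
Proof.
have r2 : 0 <= 1 - r ^+ 2 by rewrite subr_ge0 expr_le1 ?(ltW r0) // ltW.
have Tn : nH (iter n T (a' 0)) <= nH (iter n T x) + 2 * M * nH x * r ^+ N.
  move: a'0E a'0le; move: (a' 0) => A0 e hA; rewrite {1}e.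
  have lTn := lin_iter _ n lT.
  rewrite (linD (iter n T)) // !(linZ (iter n T)) // -iterD.
  apply: le_trans (hnormD hH _ _) _; rewrite !(hnormZ hH) nrC normcR gtr0_norm //.
  apply: lerD; first by rewrite ler_piMl ?hnorm_ge0 // ltW.
  rewrite mulrC ler_wpM2r ?exprn_ge0 ?(ltW r0) //; apply: le_trans (hM _ _) _.
  by rewrite -mulrA mulrCA ler_wpM2l.
set B := nH (iter n T x) + _ in Tn *.
have bound k : (k < N)%N -> nH (a' k) ^+ 2 <=
    (if (k < n)%N then (M * (2 * nH x)) ^+ 2 else 0) + r ^+ k.*2 * (M * B) ^+ 2.
  move=> kN; rewrite a'E // (hnormZ hH) nrC; case: ltnP => kn.
    rewrite -[X in X <= _]addr0; apply: lerD; last by rewrite mulr_ge0 ?sqr_ge0 ?exprn_ge0 ?(ltW r0).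
    apply: lerXn2r; rewrite ?nnegrE ?mulr_ge0 ?exprn_ge0 ?hnorm_ge0 ?(ltW r0) //.
    apply: (@le_trans _ _ (nH (iter k T (a' 0)))).
      by rewrite ler_piMl ?hnorm_ge0 // exprn_ile1 // ltW.
    by apply: le_trans (hM _ _) _; rewrite ler_wpM2l.
  rewrite add0r exprMn -exprM muln2 ler_wpM2l ?exprn_ge0 ?(ltW r0) //.
  apply: lerXn2r; rewrite ?nnegrE ?hnorm_ge0 //.
    by rewrite mulr_ge0 // (le_trans _ Tn) ?hnorm_ge0.
  rewrite -(subnK kn) iterD; apply: le_trans (hM _ _) _.
  by rewrite ler_wpM2l.
have sum1 : \sum_(k < N) (if (k < n)%N then (M * (2 * nH x)) ^+ 2 else 0) <=
    n%:R * (M * (2 * nH x)) ^+ 2.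
  have [nN|Nn] := leqP n N.
    by rewrite -big_mkcond (big_ord_narrow nN) sumr_const card_ord -[X in X <= _]mulr_natl.
  apply: (@le_trans _ _ (\sum_(k < N) (M * (2 * nH x)) ^+ 2)).
    by apply: ler_sum => k _; case: ifP => // _; exact: sqr_ge0.
  by rewrite sumr_const card_ord -[X in X <= _]mulr_natl ler_wpM2r ?sqr_ge0 // ler_nat ltnW.
have sum2 : (1 - r ^+ 2) * \sum_(k < N) r ^+ k.*2 <= 1.
  have -> : \sum_(k < N) r ^+ k.*2 = \sum_(k < N) (r ^+ 2) ^+ k.
    by apply: eq_bigr => k _; rewrite -exprM mul2n.
  have := subrX1 (r ^+ 2) N => e.
  have -> : (1 - r ^+ 2) * \sum_(k < N) (r ^+ 2) ^+ k = 1 - (r ^+ 2) ^+ N.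
    by rewrite -[LHS]opprK -mulNr opprB -e opprB.
  by rewrite gerBl !exprn_ge0 // ltW.
have h : \sum_(k < N) nH (a' k) ^+ 2 <=
   \sum_(k < N) (if (k < n)%N then (M * (2 * nH x)) ^+ 2 else 0) +
   (\sum_(k < N) r ^+ k.*2) * (M * B) ^+ 2.
  by rewrite mulr_suml -big_split; apply: ler_sum => k _; apply: bound.
apply: le_trans (ler_wpM2l r2 h) _; rewrite mulrDr; apply: lerD; first by rewrite ler_wpM2l.
by rewrite mulrA ler_piMl ?sqr_ge0.
Qed.

Let lastE : T (a N.-1) = r%:C *: a 0 - x.
Proof. exact: (dft_last hH N w hw T r%:C x f lT hf). Qed.

Let aE k : (k < N)%N -> iter k T (a 0) = r%:C ^+ k *: a k.
Proof. exact: (dft_iter hH N w hw T r%:C x f lT hf k). Qed.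

Let shiftE j k : (j + k < N)%N -> iter j T (a k) = r%:C ^+ j *: a (j + k)%N.
Proof.
move=> jk; have kN : (k < N)%N by apply: leq_ltn_trans jk; apply: leq_addl.
have rk : r%:C ^+ k != 0 :> C by rewrite expf_neq0 // real_complex_eq0 gt_eqF.
apply: (scalerI rk); rewrite -(linZ (iter j T)) ?aE //; last exact: lin_iter.
by rewrite -(aE k kN) -iterD (aE (j + k)%N jk) exprD mulrC -scalerA.
Qed.

(** Inside the disc the coefficients behave like a backward orbit: T^(j+1) a_(N-1-j) = r^j (r a_0 -
    x). Power boundedness bounds each coefficient from below, and the squares are summed over j. *)
Lemma inner_lower : nH (x - r%:C *: a 0) ^+ 2 * (1 - (r ^+ N) ^+ 2) <=
  (1 - r ^+ 2) * (M ^+ 2 * \sum_(k < N) nH (a k) ^+ 2).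
Proof.
have e : x - r%:C *: a 0 = - T (a N.-1) by rewrite lastE opprB.
have step j : (j < N)%N -> r ^+ j * nH (x - r%:C *: a 0) <= M * nH (a (N.-1 - j)%N).
  move=> jN; have jN1 : (j <= N.-1)%N by rewrite -ltnS prednK.
  have := hM j.+1 (a (N.-1 - j)%N).
  rewrite iterS shiftE; last by rewrite subnKC // prednK.
  by rewrite subnKC // (linZ T) // (hnormZ hH) nrC e (hnormN hH).
have r2 : 0 <= 1 - r ^+ 2 by rewrite subr_ge0 expr_le1 ?(ltW r0) // ltW.
have -> : 1 - (r ^+ N) ^+ 2 = (1 - r ^+ 2) * \sum_(j < N) (r ^+ j) ^+ 2.
  have -> : \sum_(j < N) (r ^+ j) ^+ 2 = \sum_(j < N) (r ^+ 2) ^+ j.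
    by apply: eq_bigr => j _; rewrite exprAC.
  have := subrX1 (r ^+ 2) N => h.
  by rewrite exprAC -[LHS]opprB h -mulNr opprB.
rewrite mulrCA ler_wpM2l // mulr_sumr mulr_sumr.
rewrite [X in _ <= X](reindex_inj rev_ord_inj) /=; apply: ler_sum => j _.
rewrite -!exprMn; apply: lerXn2r; rewrite ?nnegrE ?mulr_ge0 ?hnorm_ge0 ?exprn_ge0 ?(ltW r0) //.
by rewrite mulrC; have := step j (ltn_ord j); rewrite -subn1 -subnDA add1n.
Qed.

Let XT k y : X (iter k T y) = iter k U (X y).
Proof. by elim: k => [//|k IH]; rewrite !iterS hXT IH. Qed.

Let Un k y : nK (iter k U y) = nK y.
Proof. by elim: k => [//|k IH] /=; rewrite (unitary_hnorm _ _ _ hU) IH. Qed.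

(** The wrap-around term r a_0 need not be small in norm, but its image under [X] is: [U] preserves
    norms and U^(N-1) X a_0 = X T^(N-1) a_0 = r^(N-1) X a_(N-1). *)
Lemma intertwined_vanish : nK (X (r%:C *: a 0)) <=
  r ^+ N * (cX * Num.sqrt (\sum_(k < N) nH (a k) ^+ 2)).
Proof.
have N1 : (N.-1 < N)%N by rewrite prednK.
rewrite (linZ X) // (hnormZ hK) normcR gtr0_norm // -{1}(prednK N0) exprS -mulrA ler_pM2l //.
rewrite -(Un N.-1) -XT aE // (linZ X) // (hnormZ hK) nrC ler_wpM2l ?exprn_ge0 ?(ltW r0) //.
apply: le_trans (hcX _) _; rewrite ler_wpM2l // -[X in X <= _](ger0_norm (hnorm_ge0 _)) -sqrtr_sqr.
rewrite ler_wsqrtr // (bigD1 (Ordinal N1)) //= lerDl sumr_ge0 // => k _; exact: sqr_ge0.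
Qed.

(** Replaces a weak limit: pairing with X' y close to [x] makes r a_0 negligible, so |x| is bounded
    by |x - r a_0| up to small terms. *)
Lemma weak_estimate (e : R) y : nH (x - X' y) <= e ->
  nH x ^+ 2 <= e * nH x + nH (x - r%:C *: a 0) * (nH x + e) +
    r ^+ N * (cX * Num.sqrt (\sum_(k < N) nH (a k) ^+ 2)) * nK y.
Proof.
move=> hy; rewrite (hnorm_sqr hH).
have -> : ipH x x = ipH x (x - X' y) + (ipH (x - r%:C *: a 0) (X' y) + ipK (X (r%:C *: a 0)) y).
  by rewrite adX (ipBr hH) (ipBl hH); ring.
apply: le_trans (Re_le_normc _) _; apply: le_trans (normcD _ _) _; rewrite -addrA; apply: lerD.
  by apply: le_trans (cauchy_schwarz hH _ _) _; rewrite mulrC ler_wpM2r ?hnorm_ge0.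
apply: le_trans (normcD _ _) _; apply: lerD.
  apply: le_trans (cauchy_schwarz hH _ _) _; rewrite ler_wpM2l ?hnorm_ge0 //.
  have -> : X' y = x - (x - X' y) by hring hH.
  by apply: le_trans (hnormB hH _ _) _; rewrite lerD2l.
apply: le_trans (cauchy_schwarz hK _ _) _; rewrite ler_wpM2r ?hnorm_ge0 //.
exact: intertwined_vanish.
Qed.

End Family.

(** The limit N -> infinity at fixed [r], chaining [weak_estimate], [inner_lower], [reflected_mean]
    and [outer_mean]. *)
Lemma averaged_lower_bound : nH x ^+ 2 <= (M * kap) ^+ 2 *
  ((1 - r ^+ 2) * (n%:R * (M * (2 * nH x)) ^+ 2) + (M * nH (iter n T x)) ^+ 2).
Proof.
set A := n%:R * _; set b := nH (iter n T x); set G := _ * _.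
have A0 : 0 <= A by rewrite mulr_ge0 ?sqr_ge0.
have r2 : 0 < 1 - r ^+ 2 by rewrite subr_gt0 expr_lt1 ?(ltW r0).
have G0 : 0 <= G by rewrite mulr_ge0 ?sqr_ge0 // addr_ge0 ?sqr_ge0 // mulr_ge0 // ltW.
have b0 : 0 <= b := hnorm_ge0 _.
have x0 : 0 <= nH x := hnorm_ge0 _.
have c0 : 0 <= 2 * M * nH x by rewrite !mulr_ge0.
set c := 2 * M * nH x in c0.
(* The bound of [outer_mean] as a function of t = r^N; its value at t = 0, times (M kap)^2, is
   [G]. *)
pose D t := (1 - r ^+ 2) * A + (M * (b + c * t)) ^+ 2.
have D1 t : 0 <= t <= 1 -> D t <= D 1.
  move=> /andP[t0 t1]; rewrite lerD2l; apply: lerXn2r; rewrite ?nnegrE ?mulr_ge0 ?addr_ge0 ?mulr_ge0 //.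
  by rewrite ler_wpM2l // lerD2l ler_wpM2l.
have Dlin t : 0 <= t <= 1 -> (M * kap) ^+ 2 * D t <= G + (M * kap) ^+ 2 * (M ^+ 2 * (2 * b * c + c ^+ 2)) * t.
  move=> /andP[t0 t1]; rewrite /G -mulrA -mulrDr ler_wpM2l ?sqr_ge0 // /D -addrA lerD2l.
  have tt : t ^+ 2 <= t by rewrite expr2 ler_piMl.
  have := ler_wpM2l (mulr_ge0 (sqr_ge0 M) (sqr_ge0 c)) tt.
  by rewrite -subr_ge0 => h; rewrite -subr_ge0; apply: le_trans h _; rewrite le_eqVlt; apply/orP; left; apply/eqP; ring.
suff hs s : 0 < s -> G < s ^+ 2 -> nH x <= s.
  have gg : nH x <= Num.sqrt G.
    apply: ler_of_forall_addgt => e e0; apply: hs.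
      by rewrite ltr_wpDl ?sqrtr_ge0.
    rewrite -{1}(sqr_sqrtr G0); apply: ltrXn2r => //; rewrite ?nnegrE ?sqrtr_ge0 //.
    by rewrite ltrDl.
  by rewrite -(sqr_sqrtr G0); apply: lerXn2r; rewrite ?nnegrE ?sqrtr_ge0.
move=> s0 Gs.
have [xx|xx] := eqVneq (nH x) 0; first by rewrite xx ltW.
have xp : 0 < nH x by rewrite lt_neqAle eq_sym xx.
rewrite -(ler_pM2r xp) -[_ * _]/(nH x ^+ 2).
pose B := kap ^+ 2 * (D 1 / (1 - r ^+ 2)).
apply: ler_of_forall_addgt => e' e'0.
pose e := e' / (nH x + s + 1).
have den : 0 < nH x + s + 1 by rewrite !addr_gt0.
have e0 : 0 < e by rewrite divr_gt0.
have [y hy] := X'dense x e e0.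
have rlt : 0 <= r < 1 by rewrite ltW.
have gap : 0 < s ^+ 2 - G by rewrite subr_gt0.
have half0 : 0 < 2^-1 :> R by rewrite invr_gt0.
(* [N1] provides the assumption of [outer_mean], [N2] makes |x - r a_0| <= s because s^2 > G, and
   [N3] makes the last term of [weak_estimate] at most [e]. By its choice, [e] times |x| + s + 1 is
   the allowed error e'. *)
have [N1 hN1] := geometric_lt M _ _ rlt half0.
have [N2 hN2] := geometric_lt ((M * kap) ^+ 2 * (M ^+ 2 * (2 * b * c + c ^+ 2)) + s ^+ 2) _ _ rlt gap.
have [N3 hN3] := geometric_lt (cX * Num.sqrt B * nK y) _ _ rlt e0.
have [N [NN [w hw]]] := root_family_exists (R := R) (N1 + N2 + N3)%N.
have L1 : (N1 <= N)%N by apply: leq_trans NN; rewrite -addnA leq_addr.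
have L2 : (N2 <= N)%N by apply: leq_trans NN; rewrite addnAC leq_addl.
have L3 : (N3 <= N)%N by apply: leq_trans NN; rewrite leq_addl.
have Np : (0 < N)%N by case: hw.
have rN := ltW (hN1 N L1).
have t01 : 0 <= r ^+ N <= 1 by rewrite exprn_ge0 ?exprn_ile1 ?(ltW r0) // ltW.
have tlt : r ^+ N < 1 by rewrite exprn_ilt1 ?(ltW r0) // -lt0n.
have om := outer_mean N w hw rN; have rm := reflected_mean N w hw.
have il := inner_lower N w hw; have we := weak_estimate N w hw e y (ltW hy).
move: om rm il we (hN2 N L2) (hN3 N L3); rewrite -/A -/b -/c.
move: (\sum_(k < N) _) (\sum_(k < N) _) => Si So.
have Dt := Dlin _ t01; have D1t := D1 _ t01.
rewrite -/(D (r ^+ N)).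
move: (nH (x - _)) (hnorm_ge0 (ip := ipH) (x - r%:C *: dft N w (fun j => resolvent T (r%:C * w j) x) 0)) => Phi.
move: Dt D1t t01 tlt; move: (r ^+ N) => t Dt D1t /andP[t0 t1] tlt Phi0 om rm il we h2 h3.
have SoD : So <= D t / (1 - r ^+ 2) by rewrite ler_pdivlMr // mulrC.
have SiB : Si <= B.
  apply: le_trans rm _; rewrite ler_wpM2l ?sqr_ge0 //; apply: le_trans SoD _.
  by rewrite ler_wpM2r // invr_ge0 ltW.
have PhiD : Phi ^+ 2 * (1 - t ^+ 2) <= (M * kap) ^+ 2 * D t.
  apply: le_trans il _; apply: (@le_trans _ _ ((M * kap) ^+ 2 * ((1 - r ^+ 2) * So))).
    rewrite [X in _ <= X]mulrCA ler_wpM2l ?(ltW r2) // exprMn -mulrA ler_wpM2l ?sqr_ge0 //.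
  by rewrite ler_wpM2l ?sqr_ge0.
have tt : t ^+ 2 <= t by rewrite expr2 ler_piMl.
have st : s ^+ 2 * t ^+ 2 <= s ^+ 2 * t by rewrite ler_wpM2l ?sqr_ge0.
have Phis : Phi <= s.
  have tp : 0 < 1 - t ^+ 2 by rewrite subr_gt0 (le_lt_trans tt).
  rewrite -(@ler_pXn2r _ 2) ?nnegrE ?(ltW s0) // -(ler_pM2r tp); apply: le_trans PhiD _.
  apply: le_trans Dt _; move: st h2; rewrite mulrDl [in X in _ -> _ -> X]mulrBr mulr1.
  have alg (p q z g o : R) : q <= z -> p + z < o - g -> g + p <= o - q by lra.
  exact: alg.
apply: le_trans we _.
have -> : e' = e * (nH x + s + 1) by rewrite /e divfK // gt_eqF.
have g1 : Phi * (nH x + e) <= s * (nH x + e) by rewrite ler_wpM2r // addr_ge0 // ltW.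
have g2 : t * (cX * Num.sqrt Si) * nK y <= e.
  apply: le_trans (ltW h3); rewrite -mulrA mulrC ler_wpM2r // ler_wpM2r ?hnorm_ge0 //.
  by rewrite ler_wpM2l // ler_wsqrtr.
move: g1 g2; rewrite !mulrDr mulr1 [s * e]mulrC.
have alg (p q z g o i j : R) : q + p <= z + g -> i <= j -> o + (q + p) + i <= z + (o + g + j) by lra.
exact: alg.
Qed.

End Averaging.

(** The limit r -> 1, parametrised by q = r^2: the crude first n terms vanish, and kap^2 <= (2 M +
    1)^2 / q^2. *)
Lemma power_lower_bound n x : nH x <= M ^+ 2 * (M *+ 2 + 1) * nH (iter n T x).
Proof.
have x0 : 0 <= nH x := hnorm_ge0 _.
set b := nH (iter n T x); have b0 : 0 <= b := hnorm_ge0 _.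
have P0 : 0 <= M * (M *+ 2 + 1) by rewrite mulr_ge0 // addr_ge0 // mulrn_wge0.
rewrite -(@ler_pXn2r _ 2) ?nnegrE ?mulr_ge0 ?sqr_ge0 ?addr_ge0 ?mulrn_wge0 //.
pose A := n%:R * (M * (2 * nH x)) ^+ 2.
have A0 : 0 <= A by rewrite mulr_ge0 ?sqr_ge0.
pose P := (M * (M *+ 2 + 1)) ^+ 2; have Pp : 0 <= P := sqr_ge0 _.
have key q : 0 < q -> q < 1 -> nH x ^+ 2 <= P * (M * b) ^+ 2 + (1 - q) * (P * A + 2 * nH x ^+ 2).
  move=> q0 q1; have s01 : 0 < Num.sqrt q < 1.
    by rewrite sqrtr_gt0 q0 -sqrtr1 ltr_sqrt.
  have := averaged_lower_bound (Num.sqrt q) x n s01.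
  rewrite (sqr_sqrtr (ltW q0)) -/A -/b => h.
  have h1 : q ^+ 2 * nH x ^+ 2 <= P * ((1 - q) * A + (M * b) ^+ 2).
    have qq : 0 < q ^+ 2 by rewrite exprn_gt0.
    rewrite -ler_pdivlMl //; apply: le_trans h _; rewrite [X in _ <= X]mulrA ler_wpM2r //.
      by rewrite addr_ge0 ?sqr_ge0 // mulr_ge0 // subr_ge0 ltW.
    rewrite mulrA expr_div_n [X in _ <= X]mulrC /P ler_wpM2r ?invr_ge0 ?(ltW qq) //.
    apply: lerXn2r; rewrite ?nnegrE ?(mulr_ge0, addr_ge0, mulrn_wge0, sqrtr_ge0) // ler_wpM2l //.
    rewrite addrC lerD2r mulrDl mul1r mulr2n lerD2l ler_piMl //.
    by case/andP: s01 => _ /ltW.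
  have h2 := mulr_ge0 (sqr_ge0 (1 - q)) (sqr_ge0 (nH x)).
  have alg (p a B2 X2 : R) : q ^+ 2 * X2 <= p * ((1 - q) * a + B2) -> 0 <= (1 - q) ^+ 2 * X2 ->
    X2 <= p * B2 + (1 - q) * (p * a + 2 * X2) by nra.
  exact: alg h1 h2.
have -> : (M ^+ 2 * (M *+ 2 + 1) * b) ^+ 2 = P * (M * b) ^+ 2 by rewrite /P; ring.
apply: (ler_of_forall_mulle1 _ _ (2^-1 * (P * A + 2 * nH x ^+ 2))) => e e0 e1.
have := key (1 - e / 2).
have -> : (1 - (1 - e / 2)) * (P * A + 2 * nH x ^+ 2) = 2^-1 * (P * A + 2 * nH x ^+ 2) * e by field.
by apply; lra.
Qed.

End PowerBounded.

(** * Similarity to a unitary operator *)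

Section Isometry.
Context {R : realType} {H K : lmodType R[i]}.
Context {ipH : H -> H -> R[i]} {ipK : K -> K -> R[i]}.
Hypotheses (hH : is_inner_product ipH) (hK : is_inner_product ipK).
Local Notation nH := (hnorm ipH).
Local Notation nK := (hnorm ipK).

Lemma isometry_ip (A : H -> K) : is_linear_map A -> (forall x, nK (A x) = nH x) ->
  forall x y, ipK (A x) (A y) = ipH x y.
Proof.
move=> lA iA.
have re x y : Re (ipK (A x) (A y)) = Re (ipH x y).
  have := hnormD_sqr hK (A x) (A y); rewrite -linD // !iA (hnormD_sqr hH).
  by rewrite !mulr2n; lra.
move=> x y; have := re ('i *: x) y; rewrite (linZ A) // (ipZl hK) (ipZl hH).
move: (re x y); case: (ipK _ _) (ipH _ _) => [a b] [c d] /= -> h.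
by congr (_ +i* _); move: h; lra.
Qed.

End Isometry.

Section PolynomialProduct.
Context {R : realType} {K : lmodType R[i]} {ip : K -> K -> R[i]}.
Hypothesis hip : is_inner_product ip.
Local Notation C := R[i].
Variables (A : K -> K).
Hypothesis lA : is_linear_map A.

Lemma polyop_lin p : is_linear_map (polyop A p).
Proof.
move=> a x y; rewrite /polyop scaler_sumr -big_split; apply: eq_bigr => i _.
by rewrite (lin_iter _ i lA) scalerDr !scalerA mulrC.
Qed.

Lemma polyopM p q x : polyop A (p * q) x = polyop A p (polyop A q x).
Proof.
elim/(poly_linear_ind (R := R)): p => [p1 p2 h1 h2|c p hp|n].
- by rewrite mulrDl !polyopD h1 h2.
- by rewrite -scalerAl !polyopZ hp.
rewrite polyopXn; elim/(poly_linear_ind (R := R)): q => [p1 p2 h1 h2|c p hp|m].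
- by rewrite mulrDr !polyopD h1 h2 (linD _ _ _ (lin_iter _ n lA)).
- by rewrite -scalerAr !polyopZ hp (linZ _ _ _ (lin_iter _ n lA)).
by rewrite -exprD !polyopXn iterD.
Qed.

Lemma polyop1 x : polyop A 1 x = x.
Proof. by rewrite -(expr0 'X) polyopXn. Qed.

Lemma polyopX x : polyop A 'X x = A x.
Proof. by rewrite -(expr1 'X) polyopXn. Qed.

Lemma polyopB p q x : polyop A (p - q) x = polyop A p x - polyop A q x.
Proof. by rewrite -[- q]scaleN1r polyopD polyopZ scaleN1r. Qed.

Lemma polyop_commute B p x : is_linear_map B -> (forall z, A (B z) = B (A z)) ->
  polyop A p (B x) = B (polyop A p x).
Proof.
move=> lB AB; rewrite /polyop (lin_sum B) //; apply: eq_bigr => i _.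
rewrite (linZ B) //; congr (_ *: _); elim: (nat_of_ord i) => // n IH.
by rewrite !iterS IH AB.
Qed.

End PolynomialProduct.

Section NonnegativeCoefficients.
Context {R : realType}.
Local Notation C := R[i].
Implicit Types p q : {poly C}.

(** In the order of [R[i]] this forces real coefficients, hence self-adjoint polynomials of a
    self-adjoint operator. *)
Definition nonneg_coef p := forall i, 0 <= p`_i.

Lemma nonneg_coefC (c : C) : 0 <= c -> nonneg_coef c%:P.
Proof. by move=> c0 i; rewrite coefC; case: ifP. Qed.

Lemma nonneg_coefX : nonneg_coef ('X : {poly C}).
Proof. by move=> i; rewrite coefX; case: eqP. Qed.

Lemma nonneg_coefD p q : nonneg_coef p -> nonneg_coef q -> nonneg_coef (p + q).
Proof. by move=> hp hq i; rewrite coefD addr_ge0. Qed.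

Lemma nonneg_coefM p q : nonneg_coef p -> nonneg_coef q -> nonneg_coef (p * q).
Proof. by move=> hp hq i; rewrite coefM sumr_ge0 // => j _; rewrite mulr_ge0. Qed.

Lemma nonneg_coefXn p n : nonneg_coef p -> nonneg_coef (p ^+ n).
Proof.
move=> hp; elim: n => [|n IH]; first exact: (nonneg_coefC 1 ler01).
by rewrite exprS; apply: nonneg_coefM.
Qed.

End NonnegativeCoefficients.

(* The polynomials [rsqrt_poly k] approximate (1 - z)^(-1/2): they have nonnegative coefficients,
   and (1 - z) (rsqrt_poly k)^2 = 1 - rsqrt_rem k, where [rsqrt_rem k] vanishes to order 2 ^ k at 0. *)
Section InverseSquareRoot.
Context {R : realType}.
Local Notation C := R[i].
Let h : {poly C} := (2^-1)%:P.

(** Newton's iteration for y^-2 = 1 - z: if r = 1 - (1 - z) y^2, then the step y (1 + r / 2) has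
    remainder r^2 (3 + r) / 4. *)
Fixpoint rsqrt_rem (k : nat) : {poly C} :=
  if k is n.+1 then h ^+ 2 * (rsqrt_rem n ^+ 2 * (3 + rsqrt_rem n)) else 'X.

Fixpoint rsqrt_poly (k : nat) : {poly C} :=
  if k is n.+1 then rsqrt_poly n * (1 + h * rsqrt_rem n) else 1.

Let h_nneg : nonneg_coef h. Proof. by apply: nonneg_coefC; rewrite invr_ge0. Qed.

Let h2 : h + h = 1.
Proof. by rewrite -polyCD -polyC1; congr (_%:P); field. Qed.

Lemma rsqrt_rem_nneg k : nonneg_coef (rsqrt_rem k).
Proof.
elim: k => [|k IH] /=; first exact: nonneg_coefX.
apply: nonneg_coefM; first exact: nonneg_coefXn.
apply: nonneg_coefM; first exact: nonneg_coefXn.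
by apply: nonneg_coefD => //; rewrite -[3]polyC_natr; apply: nonneg_coefC.
Qed.

(** The normalisation s(1) = 1 makes the cofactor a convex combination of powers, which turns it
    into an average when an operator is inserted. *)
Lemma rsqrt_rem_factor k : exists s, [/\ nonneg_coef s, s.[1] = 1 & rsqrt_rem k = 'X^(2 ^ k) * s].
Proof.
elim: k => [|k [s [sn s1 rE]]].
  exists 1; split; [exact: (nonneg_coefC 1 ler01) | exact: hornerC |].
  by rewrite mulr1 expn0 expr1.
exists (h ^+ 2 * (s ^+ 2 * (3 + rsqrt_rem k))); split.
- apply: nonneg_coefM; first exact: nonneg_coefXn.
  apply: nonneg_coefM; first exact: nonneg_coefXn.
  apply: nonneg_coefD; last exact: rsqrt_rem_nneg.
  by rewrite -[3]polyC_natr; apply: nonneg_coefC.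
- rewrite -[3]polyC_natr rE !(hornerM, hornerD, hornerXn, horner_exp, hornerC) s1 !expr1n.
  by field.
by rewrite /= {1}rE expnS mulnC exprM exprMn; ring.
Qed.

Lemma rsqrt_poly_nneg k : nonneg_coef (rsqrt_poly k).
Proof.
elim: k => [|k IH] /=; first exact: (nonneg_coefC 1 ler01).
apply: nonneg_coefM => //; apply: nonneg_coefD; first exact: (nonneg_coefC 1 ler01).
by apply: nonneg_coefM => //; apply: rsqrt_rem_nneg.
Qed.

Lemma rsqrt_poly_sqr k : (1 - 'X) * rsqrt_poly k ^+ 2 = 1 - rsqrt_rem k.
Proof.
elim: k => [|k IH] /=; first by rewrite expr1n mulr1.
rewrite exprMn [LHS]mulrA IH; move: (rsqrt_rem k) => r.
apply/eqP; rewrite -subr_eq0; apply/eqP.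
transitivity ((h + h - 1) * (r + (h * r ^+ 2) *+ 2)); last by rewrite h2 subrr mul0r.
by ring.
Qed.

Lemma rsqrt_poly_incr k n : nonneg_coef (rsqrt_poly (k + n)%N - rsqrt_poly k).
Proof.
elim: n => [|n IH]; first by rewrite addn0 subrr => i; rewrite coef0.
rewrite addnS /= mulrDr mulr1 addrAC; apply: nonneg_coefD => //.
apply: nonneg_coefM; first exact: rsqrt_poly_nneg.
by apply: nonneg_coefM => //; apply: rsqrt_rem_nneg.
Qed.

End InverseSquareRoot.

(** * The unitary part of the intertwining operator *)

Section PolarDecomposition.
Context {R : realType} {H K : lmodType R[i]}.
Context {ipH : H -> H -> R[i]} {ipK : K -> K -> R[i]}.
Hypotheses (hH : is_inner_product ipH) (hK : is_inner_product ipK).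
Hypotheses (cH : hcomplete ipH) (cK : hcomplete ipK).
Local Notation C := R[i].
Local Notation nH := (hnorm ipH).
Local Notation nK := (hnorm ipK).
Variables (W W' : H -> H) (U U' : K -> K) (X : H -> K) (X' : K -> H).
Hypotheses (hW : unitary_pair (ip := ipH) W W') (hU : unitary_pair (ip := ipK) U U').
Hypotheses (lX : is_linear_map X) (adX : forall x y, ipK (X x) y = ipH x (X' y)).
Hypotheses (X1 : forall x, nK (X x) <= nH x) (Xinj : forall x, X x = 0 -> x = 0).
Hypothesis Xdense : forall y e, 0 < e -> exists x, nK (y - X x) < e.
Hypothesis hXW : forall x, X (W x) = U (X x).

Let lX' : is_linear_map X'. Proof. exact: (adjoint_lin hH hK _ _ adX). Qed.
Let X'1 y : nH (X' y) <= nK y.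
Proof.
rewrite -[nK y]mul1r; apply: (adjoint_hnorm hH hK _ _ _ ler01 adX) => x.
by rewrite mul1r.
Qed.

Let A x := X' (X x).
Let D x := x - A x.
Let lA : is_linear_map A. Proof. by move=> a x y; rewrite /A lX lX'. Qed.
Let lD : is_linear_map D. Proof. by move=> a x y; rewrite /D lA; hring hH. Qed.

Let A_adj x y : ipH (A x) y = ipH x (A y).
Proof. by rewrite (ipC hH) /A -adX -(ipC hK) adX. Qed.

Let D_adj x y : ipH (D x) y = ipH x (D y).
Proof. by rewrite (ipBl hH) (ipBr hH) A_adj. Qed.

Let Dn_adj n x y : ipH (iter n D x) y = ipH x (iter n D y).
Proof. by elim: n x y => // n IH x y; rewrite iterSr IH D_adj. Qed.

Let AD x : A (D x) = D (A x). Proof. by rewrite /D (linB A). Qed.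

Let AE x : ipH (A x) x = (nK (X x) ^+ 2)%:C.
Proof. by rewrite A_adj -adX (ip_self hK). Qed.

Let D_ge0 x : 0 <= ipH (D x) x.
Proof.
rewrite (ipBl hH) AE (ip_self hH) -rmorphB lecR subr_ge0.
by apply: lerXn2r; rewrite ?nnegrE ?hnorm_ge0.
Qed.

Let AD_ge0 x : 0 <= ipH (A (D x)) x.
Proof.
have -> : ipH (A (D x)) x = (nK (X x) ^+ 2 - nH (A x) ^+ 2)%:C.
  by rewrite rmorphB /= -AE /D (linB A) // (ipBl hH) (A_adj (A x)) (ip_self hH).
rewrite lecR subr_ge0; apply: lerXn2r; rewrite ?nnegrE ?hnorm_ge0 //; exact: X'1.
Qed.

(** Writing n = 2 m or 2 m + 1 and moving D^m to the other side leaves the form of [B] or of [B D]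
    at D^m x. *)
Let split_iter (B : H -> H) : (forall x, 0 <= ipH (B x) x) -> (forall x, 0 <= ipH (B (D x)) x) ->
  (forall x, B (D x) = D (B x)) -> forall n x, 0 <= ipH (B (iter n D x)) x.
Proof.
move=> h0 h1 BD n x; have BDn m z : B (iter m D z) = iter m D (B z).
  by elim: m => //= m IH; rewrite BD IH.
rewrite -(odd_double_half n) -addnn addnCA iterD BDn Dn_adj.
by case: (odd n); [exact: h1 | exact: h0].
Qed.

Let a n x := ipH (iter n D x) x.

Let a_ge0 n x : 0 <= a n x.
Proof.
by apply: (split_iter id) => // z; rewrite (ip_self hH) lecR sqr_ge0.
Qed.

Let a_decr n x : a n.+1 x <= a n x.
Proof.
rewrite -subr_ge0 /a -(ipBl hH).
have -> : iter n D x - iter n.+1 D x = A (iter n D x) by rewrite /= {2}/D opprB addrC subrK.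
by apply: (split_iter A) => // z; rewrite AE lecR sqr_ge0.
Qed.

Let a_le m n x : (m <= n)%N -> a n x <= a m x.
Proof.
by move/subnK => <-; elim: (n - m)%N => // k IH; apply: le_trans (a_decr _ _) IH.
Qed.

Let aR n x : a n x = (Re (a n x))%:C.
Proof. by have := a_ge0 n x; case: (a n x) => p q; rewrite lecE /= => /andP[/eqP -> _]. Qed.

Let phi p x := ipH (polyop D p x) x.

Let phiE p x : phi p x = \sum_(i < size p) p`_i * a i x.
Proof. by rewrite /phi /polyop (ip_suml hH); apply: eq_bigr => i _; rewrite (ipZl hH). Qed.

Let phi_ge0 p x : nonneg_coef p -> 0 <= phi p x.
Proof. by move=> hp; rewrite phiE sumr_ge0 // => i _; rewrite mulr_ge0. Qed.

Let phiB p q x : phi (p - q) x = phi p x - phi q x.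
Proof. by rewrite /phi polyopB (ipBl hH). Qed.

Let phiA_ge0 p x : nonneg_coef p -> 0 <= phi ((1 - 'X) * p) x.
Proof.
move=> hp; rewrite mulrBl mul1r phiB /phi polyopM // polyopX -(ipBl hH).
rewrite -(polyop_commute D D p) //.
rewrite -(linB _ _ _ (polyop_lin D lD p)) /polyop (ip_suml hH) sumr_ge0 // => i _.
rewrite (ipZl hH) mulr_ge0 //.
have -> : x - D x = A x by rewrite /D opprB addrC subrK.
have -> : iter i D (A x) = A (iter i D x) by elim: (nat_of_ord i) => //= n ->; rewrite AD.
by apply: (split_iter A) => // z; rewrite AE lecR sqr_ge0.
Qed.

Let polyop_adj p x y : nonneg_coef p -> ipH (polyop D p x) y = ipH x (polyop D p y).
Proof.
move=> hp; rewrite /polyop (ip_suml hH) (ip_sumr hH); apply: eq_bigr => i _.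
rewrite (ipZl hH) (ipZr hH) Dn_adj; congr (_ * _).
by have := hp i; case: (p`_i) => s t; rewrite lecE /= => /andP[/eqP -> _]; rewrite oppr0.
Qed.

Let norm_X p x : nonneg_coef p ->
  (nK (X (polyop D p x)) ^+ 2)%:C = phi ((1 - 'X) * p ^+ 2) x.
Proof.
move=> hp; rewrite -AE -polyop_adj // /phi.
have -> : (1 - 'X) * p ^+ 2 = p * ((1 - 'X) * p) by rewrite expr2; ring.
rewrite !polyopM // polyopB polyop1 polyopX.
by have -> : forall z, z - D z = A z by move=> z; rewrite /D opprB addrC subrK.
Qed.

(** The remainder is a convex combination of powers of order at least 2^k >= k, and the numbers (D^n
    x, x) decrease. *)
Let rem_le k x : phi (rsqrt_rem k) x <= a k x.
Proof.
have [s [sn s1 rE]] := rsqrt_rem_factor (R := R) k; rewrite rE.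
rewrite mulrC /phi polyopM // polyopXn /polyop (ip_suml hH).
have -> : a k x = \sum_(i < size s) s`_i * a k x.
  rewrite -mulr_suml -[LHS]mul1r -s1 horner_coef; congr (_ * _).
  by apply: eq_bigr => i _; rewrite expr1n mulr1.
apply: ler_sum => i _; rewrite (ipZl hH) ler_wpM2l // -iterD.
by apply: a_le; apply: leq_trans (leq_addl _ _); rewrite ltnW // ltn_expl.
Qed.

Let D_norm x : nH (D x) <= nH x.
Proof.
rewrite -(@ler_pXn2r _ 2) ?nnegrE ?hnorm_ge0 // !(hnorm_sqr hH) -D_adj -lecR.
by rewrite -[ipH (D (D x)) x]/(a 2 x) -[ipH x x]/(a 0 x) -!aR; apply: a_le.
Qed.

(** Being decreasing and nonnegative, (D^n x, x) converges; since |D^m x - D^n x|^2 is a combination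
    of such numbers, D^n x is Cauchy. Its limit is fixed by [D], hence killed by X' X, hence 0 by
    injectivity. *)
Let a_cvg0 x e : 0 < e -> exists N, forall n, (N <= n)%N -> Re (a n x) < e.
Proof.
move=> e0; pose b n := Re (a n x).
have b0 n : 0 <= b n by rewrite -lecR -aR.
have bd m n : (m <= n)%N -> b n <= b m by move=> mn; rewrite -lecR -!aR; apply: a_le.
have binf : has_inf (range b).
  by split; [exists (b 0%N), 0%N | exists 0 => _ [n _ <-]].
have cauchy d : 0 < d -> exists N, forall m n, (N <= m)%N -> (N <= n)%N ->
    nH (iter m D x - iter n D x) < d.
  move=> d0; have dd : 0 < d ^+ 2 / 2 by rewrite divr_gt0 ?exprn_gt0.
  have [_ [N _ <-] hN] := inf_adherent dd binf.
  have lo n : inf (range b) <= b n by apply: ge_inf; [case: binf | exists n].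
  exists N => m n Nm Nn; rewrite -(@ltr_pXn2r _ 2) ?nnegrE ?hnorm_ge0 ?(ltW d0) //.
  rewrite (hnormB_sqr hH) !(hnorm_sqr hH) -!Dn_adj -!iterD -![Re _]/(b _).
  have := bd _ _ (leq_trans Nm (leq_addl m m)); have := bd _ _ (leq_trans Nn (leq_addl n n)).
  have := lo (n + m)%N; move: hN.
  have alg (i p q z o g : R) : p < i + o / 2 -> i <= q -> z <= p -> g <= p -> g - q *+ 2 + z < o by lra.
  exact: alg.
have [l hl] := cH _ cauchy.
have Dl : D l = l.
  apply: (hcvg_unique hH (fun n => iter n.+1 D x)) => d d0; last first.
    by have [N hN] := hl d d0; exists N => n Nn; apply: hN; apply: leqW.
  have [N hN] := hl d d0; exists N => n Nn.
  rewrite iterS -(linB D) //; apply: le_lt_trans (hN n Nn).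
  exact: D_norm.
have l0 : l = 0.
  apply: Xinj; apply: (hnorm_eq0 hK); apply/eqP; rewrite -sqrf_eq0 -real_complex_eq0 -AE.
  by rewrite -[A l](subKr l) -/(D l) Dl subrr (ip0l hH).
have ex : 0 < nH x + 1 by rewrite ltr_wpDl ?hnorm_ge0.
have [N hN] := hl _ (divr_gt0 e0 ex); exists N => n Nn.
apply: le_lt_trans (Re_le_normc _) _; apply: le_lt_trans (cauchy_schwarz hH _ _) _.
have := hN n Nn; rewrite l0 subr0 ltr_pdivlMr //; apply: le_lt_trans.
by rewrite ler_wpM2l ?hnorm_ge0 // lerDl.
Qed.


Let adX' k z : ipH (X' k) z = ipK k (X z).
Proof. by rewrite (ipC hH) -adX -(ipC hK). Qed.

Let X'U k : X' (U k) = W (X' k).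
Proof.
apply: (ip_ext hH) => z; case: hW hU => _ _ adW WK W'K [_ _ adU UK U'K].
by rewrite adX' adU adW adX' -{1}[z]W'K hXW UK.
Qed.

Let DW z : D (W z) = W (D z).
Proof. by case: hW => lW _ _ _ _; rewrite /D /A hXW X'U (linB W). Qed.

(** Approximates X (X' X)^(-1/2). The inverse square root alone may be unbounded, so the limit is
    taken after applying [X]. *)
Let y n x := X (polyop D (rsqrt_poly n) x).

Let y_lin n : is_linear_map (y n).
Proof. by move=> c z x; rewrite /y (polyop_lin D lD) lX. Qed.

Let y_sqr n x : (nK (y n x) ^+ 2)%:C = (nH x ^+ 2)%:C - phi (rsqrt_rem n) x.
Proof.
rewrite norm_X; last exact: rsqrt_poly_nneg.
by rewrite rsqrt_poly_sqr phiB /phi polyop1 (ip_self hH).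
Qed.

(** With Q and P the polynomials of index n and n + k, (1 - z) (P - Q)^2 is the difference of the
    two remainders minus 2 (1 - z) Q (P - Q); all that is subtracted has a nonnegative form, so the
    remainder of index n dominates. *)
Let y_dist n k x : (nK (y (n + k)%N x - y n x) ^+ 2)%:C <= a n x.
Proof.
rewrite /y -(linB X) // -polyopB norm_X; last exact: rsqrt_poly_incr.
have incr := rsqrt_poly_incr (R := R) n k.
have := rsqrt_poly_sqr (R := R) (n + k)%N; have := rsqrt_poly_sqr (R := R) n.
have Qn := rsqrt_poly_nneg (R := R) n.
move: incr Qn; move: (rsqrt_poly n) (rsqrt_poly (n + k)%N) => Q P incr Qn hQ hP.
have -> : (1 - 'X) * (P - Q) ^+ 2 =
    ((1 - 'X) * P ^+ 2 - (1 - 'X) * Q ^+ 2) - ((1 - 'X) * (Q * (P - Q))) *+ 2 by ring.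
rewrite hP hQ mulr2n; set E := _ * (Q * _).
have E0 : 0 <= phi E x by apply: phiA_ge0; apply: nonneg_coefM.
apply: le_trans (rem_le n x).
have -> : 1 - rsqrt_rem (n + k)%N - (1 - rsqrt_rem n) - (E + E) =
    rsqrt_rem n - (rsqrt_rem (n + k)%N + (E + E)) by ring.
rewrite phiB gerBl /phi !polyopD !(ipDl hH) -![ipH _ x]/(phi _ x).
by rewrite !addr_ge0 // phi_ge0 //; apply: rsqrt_rem_nneg.
Qed.

Let y_cvg x : exists l, hcvg (ip := ipK) (y^~ x) l.
Proof.
apply: cK => e e0; have [N hN] := a_cvg0 x _ (exprn_gt0 2 e0).
have wlog m n : (N <= n <= m)%N -> nK (y m x - y n x) < e.
  move=> /andP[Nn nm]; rewrite -(@ltr_pXn2r _ 2) ?nnegrE ?hnorm_ge0 ?(ltW e0) //.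
  by apply: le_lt_trans (hN n Nn); rewrite -lecR -aR -(subnKC nm).
exists N => m n Nm Nn; have [nm|mn] := leqP n m; first by apply: wlog; rewrite Nn.
by rewrite (hnorm_subC hK); apply: wlog; rewrite Nm ltnW.
Qed.

Lemma polar_unitary : exists (Y : H -> K) (Z : K -> H),
  [/\ is_linear_map Y /\ is_linear_map Z, cancel Y Z /\ cancel Z Y,
      forall x, nK (Y x) = nH x & forall x, Y (W x) = U (Y x)].
Proof.
have [Y hY] := choice y_cvg.
have lU : is_linear_map U by case: hU.
have lW : is_linear_map W by case: hW.
have lY : is_linear_map Y.
  move=> c x z; apply: (hcvg_unique hK _ _ _ (hY _)) => e e0.
  have c1 : 0 < normc c + 1 by rewrite ltr_wpDl ?normc_ge0.
  have e2 : 0 < e / 2 by rewrite divr_gt0.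
  have [N1 h1] := hY x _ (divr_gt0 e2 c1); have [N2 h2] := hY z _ e2.
  exists (maxn N1 N2) => n; rewrite geq_max => /andP[n1 n2].
  have -> : y n (c *: x + z) - (c *: Y x + Y z) = c *: (y n x - Y x) + (y n z - Y z).
    by rewrite y_lin; hring hK.
  apply: le_lt_trans (hnormD hK _ _) _; rewrite (hnormZ hK).
  have := h2 n n2; have := h1 n n1; rewrite ltr_pdivlMr // mulrDr mulr1 mulrC.
  by have := hnorm_ge0 (ip := ipK) (y n x - Y x); lra.
have iY x : nK (Y x) = nH x.
  apply/eqP; rewrite eq_le; apply/andP; split.
    apply: ler_of_forall_addgt => e e0; have [N hN] := hY x e e0.
    have yx : nK (y N x) <= nH x.
      rewrite -(@ler_pXn2r _ 2) ?nnegrE ?hnorm_ge0 // -lecR y_sqr gerBl phi_ge0 //.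
      exact: rsqrt_rem_nneg.
    have := hN N (leqnn N); have := hnorm_subr_ge hK (Y x) (y N x).
    by rewrite (hnorm_subC hK (Y x)); lra.
  rewrite -(@ler_pXn2r _ 2) ?nnegrE ?hnorm_ge0 //.
  apply: (ler_of_forall_mulle1 _ _ (nK (Y x) *+ 2 + 2)) => e e0 e1.
  have [N1 h1] := hY x e e0; have [N2 h2] := a_cvg0 x e e0.
  pose N := maxn N1 N2; have := h1 N (leq_maxl _ _); have := h2 N (leq_maxr _ _).
  have : nH x ^+ 2 <= nK (y N x) ^+ 2 + Re (a N x).
    by rewrite -lecR rmorphD /= y_sqr -aR -addrA lerDl addrC subr_ge0 rem_le.
  have := hnorm_subr_ge hK (y N x) (Y x); have := hnorm_ge0 (ip := ipK) (Y x).
  have := hnorm_ge0 (ip := ipK) (y N x).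
  move: (nK (Y x)) (nK (y N x)) (nK (_ - _)) (Re _) (nH x ^+ 2) => p q d g o q0 p0 qp h gd de.
  have qp2 : q <= p + e by lra.
  have : q ^+ 2 <= (p + e) ^+ 2 by apply: lerXn2r => //; rewrite nnegrE // (le_trans q0).
  by nra.
have ipY := isometry_ip hH hK Y lY iY.
have [Z hZ] : exists Z : K -> H, forall x z, ipK (Y x) z = ipH x (Z z).
  apply: (adjoint_exists hH hK) => //; split=> //; exists 1 => x.
  by rewrite iY mul1r.
have lZ := adjoint_lin hH hK Y Z hZ.
have YZ : cancel Y Z.
  by move=> x; apply: (ip_ext hH) => z; rewrite (ipC hH) -hZ -(ipC hK) ipY.
have ZY : cancel Z Y.
  (* [q] is orthogonal to the range of [Y]. For p = X' q, (y_n p, q) is at least |p|^2, as each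
     approximating polynomial is 1 plus nonnegative coefficients, and it tends to (Y p, q) = 0. So
     X' q = 0, and density of the range of [X] gives q = 0. *)
  move=> z; apply/eqP; rewrite -subr_eq0; apply/eqP; set q := Y (Z z) - z.
  have Zq : Z q = 0 by rewrite /q (linB Z) // YZ subrr.
  suff X'q : X' q = 0.
    apply: (hnorm_le0 hK); apply: ler_of_forall_addgt => e e0; rewrite add0r.
    have [q0|q0] := eqVneq (nK q) 0; first by rewrite q0 ltW.
    have qp : 0 < nK q by rewrite lt_neqAle eq_sym q0 hnorm_ge0.
    have [x hx] := Xdense q e e0.
    rewrite -(ler_pM2r qp) -expr2 (hnorm_sqr hK).
    have -> : ipK q q = ipK (q - X x) q.
      by rewrite (ipBl hK) adX X'q (ip0r hH) subr0.
    apply: le_trans (Re_le_normc _) _; apply: le_trans (cauchy_schwarz hK _ _) _.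
    by rewrite ler_wpM2r ?hnorm_ge0 // ltW.
  set p := X' q; apply: (hnorm_le0 hH).
  have low n : nH p ^+ 2 <= Re (ipK (y n p) q).
    rewrite /y adX -/p -[ipH _ p]/(phi (rsqrt_poly n) p) -lecR.
    have -> : rsqrt_poly n = (rsqrt_poly (0 + n)%N - rsqrt_poly 0%N) + 1 :> {poly C} by rewrite add0n -[LHS](subrK 1).
    have h := phi_ge0 _ p (rsqrt_poly_incr (R := R) 0 n).
    rewrite /phi polyopD polyop1 (ipDl hH) ReD rmorphD /= (ip_self hH) /= lerDr.
    by move: h; rewrite /phi; case: (ipH _ _) => s t; rewrite !lecE /= eqxx => /andP[_ ->].
  rewrite -(@ler_pXn2r _ 2) ?nnegrE ?hnorm_ge0 // expr0n.
  apply: (ler_of_forall_mulgt _ _ (nK q)) => e e0; rewrite add0r.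
  have [N hN] := hY p e e0; apply: le_trans (low N) _.
  have -> : ipK (y N p) q = ipK (y N p - Y p) q by rewrite (ipBl hK) hZ Zq (ip0r hH) subr0.
  apply: le_trans (Re_le_normc _) _; apply: le_trans (cauchy_schwarz hK _ _) _.
  by rewrite mulrC ler_wpM2l ?hnorm_ge0 // ltW // hN.
exists Y, Z; split=> // x.
apply: (hcvg_unique hK _ _ _ (hY _)) => e e0.
have [N hN] := hY x e e0; exists N => n Nn; apply: le_lt_trans (hN n Nn).
rewrite /y (polyop_commute D W) // hXW -(linB U) // (unitary_hnorm _ _ _ hU) //.
Qed.

End PolarDecomposition.

(** * A Banach limit *)

Section BanachLimit.
Context {R : realType}.
Implicit Types s t : nat -> R.

Definition bounded_seq s := exists b : R, forall n, `|s n| <= b.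

Let cesaro s n := (\sum_(i < n.+1) s i) / n.+1%:R.

Let cesaro_shift s n : cesaro (fun k => s k.+1) n = cesaro s n + (s n.+1 - s 0%N) / n.+1%:R.
Proof.
rewrite /cesaro -mulrDl; congr (_ / _).
by rewrite big_ord_recr [in RHS]big_ord_recl /=; ring.
Qed.

Let cesaro_le s b n : (forall n, s n <= b) -> cesaro s n <= b.
Proof.
move=> h; rewrite ler_pdivrMr // -[n.+1 in X in _ <= X]card_ord mulr_natr -sumr_const.
exact: ler_sum.
Qed.

Let cesaro_lin a s t n : cesaro (fun k => a * s k + t k) n = a * cesaro s n + cesaro t n.
Proof. by rewrite /cesaro big_split -mulr_sumr mulrDl mulrA. Qed.

(* A limit of the Cesaro means along a free ultrafilter. *)
Lemma banach_limit_exists : exists L : (nat -> R) -> R,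
  [/\ forall a s t, bounded_seq s -> bounded_seq t ->
        L (fun n => a * s n + t n) = a * L s + L t,
      forall s c, bounded_seq s -> (forall n, c <= s n) -> c <= L s &
      forall s, bounded_seq s -> L (fun n => s n.+1) = L s].
Proof.
have [G [GU sG]] := ultraFilterLemma (F := \oo) _.
have cvgG s : bounded_seq s -> cvg (cesaro s @ G).
  move=> [b hb]; have cb n : `[(- b), b]%classic (cesaro s n).
    rewrite /= in_itv /=; apply/andP; split; last by apply: cesaro_le => k; have /ler_normlP[] := hb k.
    have /(cesaro_le (fun k => - s k) b n) : forall k, - s k <= b by move=> k; have /ler_normlP[] := hb k.
    by rewrite lerNl /cesaro sumrN mulNr.
  (* Cesaro means of a bounded sequence stay in a compact interval, and a cluster point along an
     ultrafilter is a limit. *)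
  have [|p [_ clp]] := @segment_compact R (- b) b (cesaro s @ G) _.
    exact: (filterE _ cb).
  apply/cvg_ex; exists p => V Vp; have [//|GV] := in_ultra_setVsetC (cesaro s @^-1` V) GU.
  by have [q [nVq Vq]] := clp (~` V) V GV Vp.
exists (fun s => lim (cesaro s @ G)); split.
- move=> a s t hs ht; apply/cvg_lim => //.
  rewrite (_ : cesaro _ = fun n => a * cesaro s n + cesaro t n); last exact/funext/cesaro_lin.
  by apply: cvgD; [apply: cvgMr|]; apply: cvgG.
- move=> s c hs hc; apply: limr_ge; first exact: cvgG.
  apply: filterE => n; rewrite -lerN2.
  have /(cesaro_le (fun k => - s k) (- c) n) : forall k, - s k <= - c by move=> k; rewrite lerN2.
  by rewrite /cesaro sumrN mulNr.
move=> s hs; apply/cvg_lim => //.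
rewrite (_ : cesaro _ = fun n => cesaro s n + (s n.+1 - s 0%N) / n.+1%:R); last exact/funext/cesaro_shift.
rewrite -[X in _ --> X]addr0; apply: cvgD; first exact: cvgG.
have [b hb] := hs; have b0 : 0 < b *+ 2 + 1 by rewrite ltr_wpDl // mulrn_wge0 // (le_trans _ (hb 0%N)).
apply/cvgr0Pnorm_lt => e e0; apply: sG; have [N hN] := invS_lt _ (divr_gt0 e0 b0).
exists N => // n Nn /=; have := hN n Nn; rewrite ltr_pdivlMr // normrM normfV normr_nat.
apply: le_lt_trans; rewrite mulrC ler_wpM2l ?invr_ge0 //.
by apply: le_trans (ler_normB _ _) _; have := hb n.+1; have := hb 0%N; rewrite mulr2n; lra.
Qed.

End BanachLimit.

(** * An equivalent invariant inner product *)

Section InvariantInnerProduct.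
Context {R : realType} {H : lmodType R[i]} {ip : H -> H -> R[i]}.
Hypotheses (hip : is_inner_product ip) (hc : hcomplete ip).
Local Notation C := R[i].
Local Notation nrm := (hnorm ip).
Variables (T S : H -> H) (M k : R).
Hypotheses (lT : is_linear_map T) (lS : is_linear_map S) (TK : cancel T S) (SK : cancel S T).
Hypotheses (M0 : 0 <= M) (hM : forall n x, nrm (iter n T x) <= M * nrm x).
Hypotheses (k0 : 0 < k) (hk : forall n x, nrm x <= k * nrm (iter n T x)).

Let orbit_ip (x y : H) n := ip (iter n T x) (iter n T y).

Let orbit_bound x y n : normc (orbit_ip x y n) <= M * nrm x * (M * nrm y).
Proof.
by apply: le_trans (cauchy_schwarz hip _ _) _; apply: ler_pM; rewrite ?hnorm_ge0.
Qed.

Let Im_le_normc (z : C) : `|Im z| <= normc z.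
Proof.
rewrite -(@ler_pXn2r _ 2) ?nnegrE ?normc_ge0 // normc_sqr real_normK ?num_real //.
by rewrite lerDr sqr_ge0.
Qed.

Let absRe_le_normc (z : C) : `|Re z| <= normc z.
Proof.
rewrite -(@ler_pXn2r _ 2) ?nnegrE ?normc_ge0 // normc_sqr real_normK ?num_real //.
by rewrite lerDl sqr_ge0.
Qed.

Let Re_bounded x y : bounded_seq (fun n => Re (orbit_ip x y n)).
Proof. by eexists => n; apply: le_trans (absRe_le_normc _) (orbit_bound x y n). Qed.

Let Im_bounded x y : bounded_seq (fun n => Im (orbit_ip x y n)).
Proof. by eexists => n; apply: le_trans (Im_le_normc _) (orbit_bound x y n). Qed.

(** The lower bound [hk] makes the limiting form definite and its norm equivalent to the old one,
    which transfers completeness; shift invariance makes [T] isometric. *)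
Lemma invariant_inner_product : exists bp : H -> H -> C,
  [/\ is_inner_product bp, hcomplete bp, unitary_pair (ip := bp) T S,
      forall x, hnorm bp x <= M * nrm x & forall x, nrm x <= k * hnorm bp x].
Proof.
have [L [Llin Lge Lshift]] := @banach_limit_exists R.
have bounded_lin (a : R) s t : bounded_seq s -> bounded_seq t -> bounded_seq (fun n => a * s n + t n).
  move=> [b hb] [b' hb']; exists (`|a| * b + b') => n; apply: le_trans (ler_normD _ _) _.
  by rewrite normrM; apply: lerD => //; rewrite ler_wpM2l.
have b0 : bounded_seq (fun=> 0 : R) by exists 0 => n; rewrite normr0.
have L0 : L (fun=> 0) = 0.
  have := Llin 1 _ _ b0 b0; rewrite (_ : (fun n => _) = fun=> 0).
    by lra.
  by apply/funext => n; rewrite mulr0 addr0.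
have LZ a s : bounded_seq s -> L (fun n => a * s n) = a * L s.
  move=> hs; have := Llin a _ _ hs b0; rewrite L0 addr0 => <-.
  by congr L; apply/funext => n; rewrite addr0.
have Lle s c : bounded_seq s -> (forall n, s n <= c) -> L s <= c.
  move=> hs h; rewrite -lerN2 -(mulN1r (L s)) -LZ //; apply: Lge.
    have [b hb] := hs; by exists b => n; rewrite mulN1r normrN.
  by move=> n; rewrite mulN1r lerN2.
pose bp x y := L (fun n => Re (orbit_ip x y n)) +i* L (fun n => Im (orbit_ip x y n)).
have bpxx x : bp x x = (L (fun n => nrm (iter n T x) ^+ 2))%:C.
  congr (_ +i* _); first by congr L; apply/funext => n; rewrite (hnorm_sqr hip).
  by rewrite -[RHS]L0; congr L; apply/funext => n; rewrite /orbit_ip (ip_self hip).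
have sqb x : bounded_seq (fun n => nrm (iter n T x) ^+ 2).
  have [b hb] := Re_bounded x x; exists b => n.
  by rewrite (hnorm_sqr hip); apply: hb.
have bp_le x : L (fun n => nrm (iter n T x) ^+ 2) <= (M * nrm x) ^+ 2.
  by apply: Lle => // n; apply: lerXn2r; rewrite ?nnegrE ?mulr_ge0 ?hnorm_ge0.
have bp_ge x : (nrm x / k) ^+ 2 <= L (fun n => nrm (iter n T x) ^+ 2).
  apply: Lge => // n; apply: lerXn2r; rewrite ?nnegrE ?divr_ge0 ?hnorm_ge0 ?(ltW k0) //.
  by rewrite ler_pdivrMr // mulrC.
have L_ge0 x : 0 <= L (fun n => nrm (iter n T x) ^+ 2) by apply: le_trans (bp_ge x); exact: sqr_ge0.
have bpn x : hnorm bp x = Num.sqrt (L (fun n => nrm (iter n T x) ^+ 2)) by rewrite {1}/hnorm bpxx.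
have norm_le x : hnorm bp x <= M * nrm x.
  rewrite bpn -[X in _ <= X]ger0_norm ?mulr_ge0 ?hnorm_ge0 //.
  by rewrite -[X in _ <= X]sqrtr_sqr ler_wsqrtr.
have norm_ge x : nrm x <= k * hnorm bp x.
  rewrite mulrC -ler_pdivrMr // bpn.
  by rewrite -[X in X <= _]ger0_norm ?divr_ge0 ?hnorm_ge0 ?(ltW k0) // -[X in X <= _]sqrtr_sqr ler_wsqrtr.
have bp_ip : is_inner_product bp.
  split=> [a x y z|x y|x|x].
  - have e n : orbit_ip (a *: x + y) z n = a * orbit_ip x z n + orbit_ip y z n.
      by rewrite /orbit_ip (lin_iter _ n lT) (ip_lin hip).
    rewrite /bp; case: a e => [p q] e; congr (_ +i* _) => /=.
      rewrite -addrA -mulNr -Llin // -Llin //; last exact: bounded_lin.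
      congr L; apply/funext => n; rewrite e; case: (orbit_ip x z n) (orbit_ip y z n) => [s t] [s' t'] /=.
      by ring.
    rewrite -addrA -Llin // -Llin //; last exact: bounded_lin.
    congr L; apply/funext => n; rewrite e; case: (orbit_ip x z n) (orbit_ip y z n) => [s t] [s' t'] /=.
    by ring.
  - rewrite /bp /=; congr (_ +i* _).
      by congr L; apply/funext => n; rewrite /orbit_ip (ipC hip); case: (ip _ _).
    rewrite -mulN1r -LZ //; congr L; apply/funext => n; rewrite mulN1r /orbit_ip (ipC hip).
    by case: (ip _ _).
  - by rewrite bpxx lecR.
  rewrite bpxx => /eqP; rewrite real_complex_eq0 => /eqP h.
  apply: (hnorm_eq0 hip); apply/eqP; have := bp_ge x; rewrite h exprMn -[X in _ <= X](mul0r (k^-1 ^+ 2)).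
  rewrite ler_pM2r ?exprn_gt0 ?invr_gt0 // => h'.
  by rewrite -sqrf_eq0 eq_le h' sqr_ge0.
exists bp; split=> //.
  move=> s hs; have [e e0|l hl] := hc s _.
    have [N hN] := hs _ (divr_gt0 e0 k0); exists N => m n Nm Nn.
    by apply: le_lt_trans (norm_ge _) _; rewrite mulrC -ltr_pdivlMr // hN.
  exists l => e e0; have M1 : 0 < M + 1 by rewrite ltr_wpDl.
  have [N hN] := hl _ (divr_gt0 e0 M1); exists N => n Nn.
  apply: le_lt_trans (norm_le _) _; have := hN n Nn; rewrite ltr_pdivlMr // mulrDr mulr1 mulrC.
  by have := hnorm_ge0 (ip := ip) (s n - l); lra.
split=> // x y.
have shift z w : bp (T z) (T w) = bp z w.
  rewrite /bp -(Lshift _ (Re_bounded z w)) -(Lshift _ (Im_bounded z w)).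
  by congr (L _ +i* L _); apply/funext => n; rewrite /orbit_ip -!iterSr.
by rewrite -{1}[y]SK shift.
Qed.

End InvariantInnerProduct.

(** * Inverse, similarity and the final bound *)

Section Conclusion.
Context {R : realType} {H K : lmodType R[i]}.
Context {ipH : H -> H -> R[i]} {ipK : K -> K -> R[i]}.
Hypotheses (hH : is_inner_product ipH) (hK : is_inner_product ipK).
Hypotheses (cH : hcomplete ipH) (cK : hcomplete ipK).
Local Notation C := R[i].
Local Notation nH := (hnorm ipH).
Local Notation nK := (hnorm ipK).

Lemma quasiaffine_similarity (T S : H -> H) (U U' : K -> K) (X : H -> K) (M k : R) :
  is_linear_map T -> is_linear_map S -> cancel T S -> cancel S T ->
  0 <= M -> (forall n x, nH (iter n T x) <= M * nH x) ->
  0 < k -> (forall n x, nH x <= k * nH (iter n T x)) ->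
  unitary_pair (ip := ipK) U U' -> quasiaffinity ipH ipK X -> (forall x, X (T x) = U (X x)) ->
  exists (Y : H -> K) (Z : K -> H), is_bounded_inverse ipH ipK Y Z /\ forall x, Y (T x) = U (Y x).
Proof.
move=> lT lS TK SK M0 hM k0 hk hU [bX Xinj Xdense] hXT.
have [bp [hbp cbp hTS bple bpge]] :=
  invariant_inner_product hH cH T S M k lT lS TK SK M0 hM k0 hk.
have [lX _] := bX; have [c c0 hc] := bounded_op_ge0 X bX.
(* Dividing [X] by [q] makes it a contraction for the new norm, as the polar decomposition requires;
   the summand 1 keeps [q] positive. *)
pose q := c * k + 1; have q0 : 0 < q by rewrite ltr_wpDl // mulr_ge0 // ltW.
have nq : normc (q^-1)%:C = q^-1 by rewrite normcR ger0_norm // invr_ge0 ltW.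
pose X1 x := (q^-1)%:C *: X x.
have lX1 : is_linear_map X1 by move=> a x y; rewrite /X1 lX; hring hK.
have X1le x : nK (X1 x) <= hnorm bp x.
  rewrite /X1 (hnormZ hK) nq ler_pdivrMl //; apply: le_trans (hc x) _.
  apply: (@le_trans _ _ (c * k * hnorm bp x)); first by rewrite -mulrA ler_wpM2l.
  by rewrite ler_wpM2r ?hnorm_ge0 // lerDl.
have [X1' adX1] : exists B : K -> H, forall x y, ipK (X1 x) y = bp x (B y).
  apply: (adjoint_exists hbp hK) => //; split=> //; exists 1 => x.
  by rewrite mul1r.
have qq : q%:C * (q^-1)%:C = 1 :> C by rewrite -rmorphM divff ?gt_eqF // rmorph1.
have X1inj x : X1 x = 0 -> x = 0.
  move=> h; apply: Xinj; rewrite (lin0 _ lX) -[X x]scale1r -qq -scalerA -/(X1 x) h.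
  exact: scaler0.
have X1dense y e : 0 < e -> exists x, nK (y - X1 x) < e.
  move=> e0; have [x hx] := Xdense y e e0; exists (q%:C *: x).
  by rewrite /X1 (linZ _ _ _ lX) scalerA mulrC qq scale1r.
have X1T x : X1 (T x) = U (X1 x).
  by case: hU => lU _ _ _ _; rewrite /X1 hXT (linZ _ _ _ lU).
have [Y [Z [[lY lZ] [YZ ZY] iY YT]]] :=
  polar_unitary hbp hK cbp cK T S U U' X1 X1' hTS hU lX1 adX1 X1le X1inj X1dense X1T.
exists Y, Z; split=> //; split=> //.
  by split=> //; exists M => x; rewrite iY.
by split=> //; exists k => y; apply: le_trans (bpge _) _; rewrite -iY ZY.
Qed.

(** V' T is the identity plus a rank one operator with determinant d = 1 + (V' u, v). As T V' u = d
    u, the lower bound excludes d = 0, and the rank one formula then yields the inverse. *)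
Lemma rank_one_perturbation_inverse (V V' : H -> H) (u v : H) (c : R) :
  unitary_pair (ip := ipH) V V' ->
  (forall x, nH x <= c * nH (V x + ipH x v *: u)) ->
  let T x := V x + ipH x v *: u in
  exists S, [/\ is_linear_map S, cancel T S, cancel S T & forall x, nH (S x) <= c * nH x].
Proof.
move=> hV low T; have [lV lV' _ VK V'K] := hV.
have lT : is_linear_map T by exact: (perturbed_lin hH V V').
pose d := 1 + ipH (V' u) v.
have d0 : d != 0.
  apply/eqP => dE; have TV'u : T (V' u) = d *: u by rewrite /T V'K /d; hring hH.
  have q0 : V' u = 0.
    apply: (hnorm_le0 hH); apply: le_trans (low _) _.
    by rewrite -/(T (V' u)) TV'u dE scale0r (hnorm0 hH) mulr0.
  by move/eqP: dE; rewrite /d q0 (ip0l hH) addr0 oner_eq0.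
pose S x := V' x - (ipH (V' x) v / d) *: V' u.
have SK : cancel S T.
  move=> x; rewrite /T /S (linB V) // (linZ V) // !V'K (ipBl hH) (ipZl hH).
  have -> : ipH (V' u) v = d - 1 by rewrite /d addrC addKr.
  move: (ipH (V' x) v) => s.
  have -> : s - s / d * (d - 1) = s / d by field.
  by rewrite subrK.
have Tinj x y : T x = T y -> x = y.
  move=> e; apply/eqP; rewrite -subr_eq0; apply/eqP/(hnorm_le0 hH); apply: le_trans (low _) _.
  by rewrite -/(T (x - y)) (linB T) // e subrr (hnorm0 hH) mulr0.
exists S; split=> // [a x y|x|x].
- by rewrite /S lV' (ip_lin hH); hring hH.
- by apply: Tinj; rewrite SK.
by apply: le_trans (low _) _; rewrite -/(T (S x)) SK.
Qed.

Lemma opnorm_ge0 (A : H -> K) : bounded_op ipH ipK A -> 0 <= opnorm ipH ipK A.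
Proof.
move=> hA; have [lA _] := hA; have [c c0 hc] := bounded_op_ge0 A hA.
rewrite -(hnorm0 hK) -(lin0 A lA); apply: ub_le_sup.
  by exists c => _ [x /= x1 <-]; apply: le_trans (hc x) _; exact: ler_piMr.
by exists 0 => //=; rewrite (hnorm0 hH) ler01.
Qed.

Lemma bounded_op_iter (T : H -> H) n : bounded_op ipH ipH T -> bounded_op ipH ipH (iter n T).
Proof.
move=> hT; have [lT _] := hT; split; first exact: lin_iter.
have [c c0 hc] := bounded_op_ge0 T hT; exists (c ^+ n) => x.
elim: n => [|n IH]; first by rewrite expr0 mul1r.
by apply: le_trans (hc _) _; rewrite exprS -mulrA ler_wpM2l.
Qed.

End Conclusion.

Theorem mainTheorem1 (R : realType)
    (H : lmodType R[i]) (ipH : H -> H -> R[i])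
    (K : lmodType R[i]) (ipK : K -> K -> R[i])
    (hH : is_sep_hilbert ipH) (hK : is_sep_hilbert ipK)
    (T V : H -> H) (u v : H) (U : K -> K) (X : H -> K)
    (hV : unitary ipH V)
    (hT : forall x : H, T x = V x + ipH x v *: u)
    (hpb : has_ubound (range (fun n : nat => opnorm ipH ipH (iter n T))))
    (hU : singular_unitary ipK U)
    (hX : quasiaffinity ipH ipK X)
    (hXTU : forall x : H, X (T x) = U (X x)) :
  let M := sup (range (fun n : nat => opnorm ipH ipH (iter n T))) in
  (exists S : H -> H, is_bounded_inverse ipH ipH T S /\
     forall n : nat, opnorm ipH ipH (iter n S) <= (M ^+ 2 *+ 2 + 1) * M ^+ 5)
  /\
  (exists (Y : H -> K) (Z : K -> H), is_bounded_inverse ipH ipK Y Z /\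
     forall x : H, Y (T x) = U (Y x)).
Proof.
have [hipH cH _] := hH; have [hipK cK _] := hK.
have [[lV [cV hcV]] _] := hV; have [V' hV'] := unitary_pairP V hV.
have [uU sU] := hU; have [U' hU'] := unitary_pairP U uU.
have [bX Xinj Xdense] := hX; have [lX _] := bX.
have [cX cX0 hcX] := bounded_op_ge0 X bX.
have TE : T = fun x => V x + ipH x v *: u by apply/funext.
have X0 x : X x = 0 -> x = 0 by move=> h; apply: Xinj; rewrite h (lin0 _ lX).
have [X' adX] := adjoint_exists hipH hipK X cH bX.
have X'dense := adjoint_dense hipH hipK X X' cH adX X0.
have bT : bounded_op ipH ipH T.
  split; first by rewrite TE; exact: (perturbed_lin hipH V V').
  exists (cV + hnorm ipH v * hnorm ipH u) => x; rewrite hT.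
  apply: le_trans (hnormD hipH _ _) _; rewrite (hnormZ hipH) mulrDl; apply: lerD => //.
  have := cauchy_schwarz hipH x v => h; rewrite mulrAC.
  by rewrite ler_wpM2r ?hnorm_ge0 // mulrC.
have lT : is_linear_map T by case: bT.
move=> M.
have opM n : opnorm ipH ipH (iter n T) <= M by apply: ub_le_sup => //; exists n.
have powM n x : hnorm ipH (iter n T x) <= M * hnorm ipH x.
  apply: le_trans (le_opnorm hipH hipH _ x (bounded_op_iter T n bT)) _.
  by rewrite ler_wpM2r ?hnorm_ge0.
have M0 : 0 <= M by apply: le_trans (opM 0%N); apply: opnorm_ge0 => //; exact: bounded_op_iter.
(* [M] is 0 when [H] is the zero space, while the estimates assume a constant at least 1. *)
pose M1 := Num.max M 1; have M11 : 1 <= M1 by rewrite le_max lexx orbT.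
have powM1 n x : hnorm ipH (iter n T x) <= M1 * hnorm ipH x.
  by apply: le_trans (powM n x) _; rewrite ler_wpM2r ?hnorm_ge0 // le_max lexx.
have hXT x : X (V x + ipH x v *: u) = U (X x) by rewrite -hT.
have hdet : forall l : R[i], l != 0 -> normc l < 1 ->
    normc (perturbation_det (ipH := ipH) V u v (conjc l)^-1) <=
    normc (perturbation_det (ipH := ipH) V u v l).
  apply: (det_inside_outside hipH hipK cH cK V V' U U' hV' hU' u v X X') => // l e l1 e0.
  have [mu [_ hmom hsing]] := sU (X u).
  exact: (singular_polynomial hipK U U' (X u) hU' mu hmom hsing).
pose k := M1 ^+ 2 * (M1 *+ 2 + 1).
have k0 : 0 < k.
  have M10 : 0 < M1 by apply: lt_le_trans M11.
  by rewrite mulr_gt0 ?exprn_gt0 // addr_gt0 // mulrn_wgt0.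
have low n x : hnorm ipH x <= k * hnorm ipH (iter n T x).
  have := power_lower_bound hipH hipK cH V V' U U' hV' hU' u v X X' cX M1 lX adX cX0 hcX
    X'dense X0 hXT M11 _ hdet n x.
  by rewrite -TE; apply.
have [S [lS TS ST Sle]] : exists S, [/\ is_linear_map S, cancel T S, cancel S T &
    forall x, hnorm ipH (S x) <= k * hnorm ipH x].
  have low1 x : hnorm ipH x <= k * hnorm ipH (V x + ipH x v *: u) by rewrite -hT; apply: (low 1%N).
  have := rank_one_perturbation_inverse hipH V V' u v k hV' low1.
  by rewrite TE.
have STn n : cancel (iter n S) (iter n T).
  by elim: n => // n IH x; rewrite iterSr iterS ST IH.
split; last first.
  exact: (quasiaffine_similarity hipH hipK cH cK T S U U' X M k).
exists S; split.
  by split=> //; split=> //; exists k.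
move=> n; apply: opnorm_le => //.
  by rewrite mulr_ge0 ?exprn_ge0 // addr_ge0 // mulrn_wge0 // sqr_ge0.
move=> x; have := low n (iter n S x); rewrite STn => h.
have [x0|x0] := eqVneq (hnorm ipH x) 0.
  by move: h; rewrite x0 !mulr0.
have M_ge1 : 1 <= M.
  have xp : 0 < hnorm ipH x by rewrite lt_neqAle eq_sym x0 hnorm_ge0.
  by have := powM 0%N x; rewrite /= -{1}[hnorm ipH x]mul1r ler_pM2r.
have M1E : M1 = M by rewrite /M1; apply/max_idPl.
apply: le_trans h _; rewrite ler_wpM2r ?hnorm_ge0 // /k M1E.
(* For M >= 1, M^2 <= M^5 and 2 M + 1 <= 2 M^2 + 1, so M^2 (2 M + 1) is within the stated bound. *)
have M2 : M <= M ^+ 2 by rewrite expr2 ler_peMl.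
have M25 : M ^+ 2 <= M ^+ 5 by rewrite ler_weXn2l.
rewrite mulrC; apply: ler_pM => //.
- by rewrite addr_ge0 // mulrn_wge0.
- exact: sqr_ge0.
- by rewrite lerD2r lerMn2r.
Qed.
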